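(* Let $P_1,\dots,P_n$ and $Q_1,\dots,Q_n$ be convex polytopes in $\mathbb R^n$ such that $P_i\subseteq Q_i$ for every $i\in\{1,\dots,n\}$. For a non-zero vector $u\in\mathbb R^n$ let $B_{i,u}=\{x\in Q_i\mid \langle u,x\rangle\ge h_{P_i}(u)\}$ for $1\le i\le n$. The following are equivalent: (1) $V(P_1,\dots,P_n)<V(Q_1,\dots,Q_n)$; (2) there exists a fully mixed $(2n-1)$-dimensional simplex $\mathcal C(E_1,\dots,E_n)$ contained in the relative closure of $\mathcal C(Q_1,\dots,Q_n)\setminus\mathcal C(P_1,\dots,P_n)$; (3) there exists a non-zero vector $u\in\mathbb R^n$ such that the collection $\{B_{1,u},\dots,B_{n,u}\}$ is essential.
   Context: $V(\cdot)$ is the mixed volume of $n$ convex bodies in $\mathbb R^n$ and $h_K(u)=\max\{\langle u,x\rangle\mid x\in K\}$ is the support function. A collection $\{K_1,\dots,K_m\}$ of convex bodies in $\mathbb R^n$ is essential if $\dim\sum_{i\in I}K_i\ge|I|$ for every $I\subseteq\{1,\dots,m\}$ with $|I|\le n$. For polytopes $P_1,\dots,P_k\subset\mathbb R^n$, the Cayley polytope $\mathcal C(P_1,\dots,P_k)$ is the convex hull in $\mathbb R^n\times\mathbb R^k$ of $\bigcup_{i=1}^k P_i\times\{e_i\}$, where $e_1,\dots,e_k$ is the standard basis of $\mathbb R^k$; it is called fully mixed if $\dim P_i\ge1$ for all $i$. Thus $\mathcal C(E_1,\dots,E_n)$ in (2) is the Cayley polytope of polytopes $E_1,\dots,E_n\subset\mathbb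 R^n$ (necessarily $E_i\subseteq Q_i$ as it lies in $\mathcal C(Q_1,\dots,Q_n)$). The relative closure is the closure taken within the affine span of $\mathcal C(Q_1,\dots,Q_n)$. *)

(* Defs.v *)
From HB Require Import structures.
From mathcomp Require Import all_boot all_order all_algebra.
From mathcomp Require Import all_classical all_reals all_analysis.

Set Implicit Arguments.
Unset Strict Implicit.
Unset Printing Implicit Defensive.

Import Order.TTheory GRing.Theory Num.Theory.
Import numFieldNormedType.Exports.
Local Open Scope classical_set_scope.
Local Open Scope ring_scope.

Section Convex.
Variable R : realType.

Definition dotp (n : nat) (u x : 'rV[R]_n) : R := \sum_(i < n) u 0 i * x 0 i.

Definition conv (n : nat) (A : set 'rV[R]_n) : set 'rV[R]_n :=
  [set x | exists (k : nat) (w : 'I_k -> R) (p : 'I_k -> 'rV[R]_n),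
     [/\ forall j, 0 <= w j, \sum_(j < k) w j = 1, forall j, A (p j)
       & x = \sum_(j < k) w j *: p j]].

Definition aff (n : nat) (A : set 'rV[R]_n) : set 'rV[R]_n :=
  [set x | exists (k : nat) (w : 'I_k -> R) (p : 'I_k -> 'rV[R]_n),
     [/\ \sum_(j < k) w j = 1, forall j, A (p j)
       & x = \sum_(j < k) w j *: p j]].

Definition polytope (n : nat) (P : set 'rV[R]_n) : Prop :=
  exists s : seq 'rV[R]_n, s != [::] /\ P = conv [set x | x \in s].

(** Support function h_K(u) = max { <u,x> | x in K } (a sup; attained for
    polytopes). *)
Definition supp_fun (n : nat) (K : set 'rV[R]_n) (u : 'rV[R]_n) : R :=
  sup [set dotp u x | x in K].

Definition msum (n m : nat) (I : {set 'I_m}) (K : 'I_m -> set 'rV[R]_n)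
  : set 'rV[R]_n :=
  [set x | exists f : 'I_m -> 'rV[R]_n,
     (forall i, i \in I -> K i (f i)) /\ x = \sum_(i in I) f i].

(** Affine dimension: dim K >= d  iff  K contains d+1 affinely independent
    points x0, x0 + M_1, ..., x0 + M_d (rows M_j of M linearly independent).
    The dimension of K is the dimension of its affine hull, i.e. the maximal
    such d. *)
Definition dim_ge (n : nat) (K : set 'rV[R]_n) (d : nat) : Prop :=
  exists (x0 : 'rV[R]_n) (M : 'M[R]_(d, n)),
    [/\ K x0, row_free M & forall j : 'I_d, K (x0 + row j M)].

Definition essential (n m : nat) (K : 'I_m -> set 'rV[R]_n) : Prop :=
  forall I : {set 'I_m}, (#|I| <= n)%N -> dim_ge (msum I K) #|I|.

Fixpoint iter_int (k : nat) : (seq R -> \bar R) -> \bar R :=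
  match k with
  | O => fun g => g [::]
  | k'.+1 => fun g =>
      (\int[@lebesgue_measure R]_(x in setT)
          iter_int k' (fun s => g (x :: s)))%E
  end.

(** n-dimensional volume (Lebesgue measure) of A, computed as the iterated
    integral of its indicator function (Fubini/Tonelli). *)
Definition vol (n : nat) (A : set 'rV[R]_n) : R :=
  fine (iter_int n (fun s => ((\1_A (\row_(i < n) nth 0 s i)) : R)%:E)).

(** Mixed volume, through the polarization formula
    V(K_1..K_n) = 1/n! sum_{I subset [n]} (-1)^{n-|I|} vol(sum_{i in I} K_i). *)
Definition mixed_volume (n : nat) (K : 'I_n -> set 'rV[R]_n) : R :=
  (n`!%:R)^-1 * \sum_(I : {set 'I_n})
                   (-1) ^+ (n - #|I|) * vol (msum I K).

Definition ebasis (k : nat) (i : 'I_k) : 'rV[R]_k := \row_(j < k) (i == j)%:R.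

Definition cayley (n k : nat) (P : 'I_k -> set 'rV[R]_n) : set 'rV[R]_(n + k) :=
  conv [set z | exists i : 'I_k, exists2 x, P i x & z = row_mx x (ebasis i)].

Definition fully_mixed (n k : nat) (P : 'I_k -> set 'rV[R]_n) : Prop :=
  forall i, dim_ge (P i) 1.

Definition simplex (m : nat) (S : set 'rV[R]_m) (d : nat) : Prop :=
  exists (x0 : 'rV[R]_m) (M : 'M[R]_(d, m)),
    row_free M /\
    S = conv [set z | z = x0 \/ exists j : 'I_d, z = x0 + row j M].

Definition rel_closure (m : nat) (A S : set 'rV[R]_m) : set 'rV[R]_m :=
  closure S `&` aff A.

Definition Bset (n : nat) (P Q : set 'rV[R]_n) (u : 'rV[R]_n) : set 'rV[R]_n :=
  [set x | Q x /\ supp_fun P u <= dotp u x].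

End Convex.

(* Main.v *)
(* Lift the vertices of the polytopes S_1, ..., S_n generically and consider the
   induced regular triangulation of their Cayley polytope.  Its maximal simplices are
   the bases of R^(2n) formed by vectors (v, e_i), v a vertex of S_i, that are optimal
   for the linear program minimising the height.  Intersecting with the slice over the
   indicator vector of I decomposes the Minkowski sum of the S_i, i in I, up to
   hyperplanes; the inclusion-exclusion sum defining the mixed volume then kills every
   simplex with a single vertex over some e_i.  Hence n! V(S_1, ..., S_n) is the total
   volume of the fully mixed cells, for any generic heights.

   If the vertices of P get much lower heights than the other vertices of Q, the
   triangulation of Q extends that of P, so V(P) < V(Q) exactly when some fully mixed
   simplex uses a point outside P; the leading part of its supporting functional is the
   vector u of (3).  Conversely, Rado's theorem extracts from an essential collection
   n segments with independent directions, and heights adapted to u put the simplex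
   over these segments in the triangulation of Q but not in that of P.  Finally such a
   simplex lies outside P, and a simplex as in (2) is separated from C(P) by Farkas'
   lemma when C(P) is full-dimensional, while V(P) = 0 < V(Q) otherwise. *)

Require Import Defs.
From HB Require Import structures.
From mathcomp Require Import all_boot all_order all_algebra.
From mathcomp Require Import all_classical all_reals all_analysis.
From mathcomp Require Import measurable_realfun ring lra polyrcf.
Import Order.TTheory GRing.Theory Num.Theory.
Import numFieldNormedType.Exports.
Local Open Scope classical_set_scope.
Local Open Scope ring_scope.
Set Implicit Arguments.
Unset Strict Implicit.
Unset Printing Implicit Defensive.

(** All three statements are compared with one condition, [critical]: a nonzero [u] and [n] segments
    with independent directions, the i-th one inside $B_{i,u}$. As [vol] is an iterated integral,
    changes of variables are avoided and no simplex volume is ever computed: translation invariance,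
    cubes, null hyperplanes and additivity up to hyperplanes suffice, and strictness comes from
    cells having positive volume. One family of bases must serve all slices. The slice over $I$ sees
    only vertices with index in $I$, so an optimal solution there is completed by one vertex over
    each other index. In the full slice the coefficient of that vertex is forced, so the two slices
    of the cell are translates. Heights need two scales above genericity: endpoints of the segments
    and vertices of $P_i$ may lie on the same supporting hyperplane, a tie that the second scale
    breaks. Polynomials in one large parameter [H] reduce the comparison of scales to the sign of a
    leading coefficient. *)

(** * Iterated Lebesgue integrals *)

Section IteratedIntegral.
Variable R : realType.
Local Notation mu := (@lebesgue_measure R).
Implicit Types (g : seq R -> \bar R) (k j : nat).
Local Open Scope ereal_scope.

(** The integral of a nonnegative function is a supremum over the simple functions below it, so it
    grows with the function. Volumes of arbitrary sets can thus be bounded above. *)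
Lemma ge0_le_integralT (f g : R -> \bar R) :
  (forall x, 0 <= f x) -> (forall x, f x <= g x) ->
  \int[mu]_(x in setT) f x <= \int[mu]_(x in setT) g x.
Proof.
move=> f0 fg.
have g0 x : 0 <= g x by apply: le_trans (fg x).
rewrite !ge0_integralE//; apply: ereal_sup_le => _ [h hf <-].
by exists h => // x; apply: le_trans (hf x) _; rewrite !patchT ?inE.
Qed.

(** A translate of Lebesgue measure has the same value on every interval []b, c]], so uniqueness
    applies; the change of variables is a pushforward. *)
Lemma integral_addr (a : R) (f : R -> \bar R) :
  measurable_fun [set: R] f -> (forall x, 0 <= f x) ->
  \int[mu]_(x in setT) f (x + a)%R = \int[mu]_(x in setT) f x.
Proof.
move=> mf f0.
pose phi : measurableTypeR R -> measurableTypeR R := fun x => (x + a)%R.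
have mphi : measurable_fun setT phi by exact: measurable_funD.
have := @ge0_integral_pushforward _ _ _ _ R phi mphi mu setT f measurableT mf.
rewrite preimage_setT => <-; last by move=> y _; exact: f0.
apply: eq_measure_integral => //= A mA _; apply/esym.
apply: lebesgue_measure_unique => //= _ [[b c]] _ <-.
rewrite /pushforward.
have -> : phi @^-1` `]b, c] = `](b - a)%R, (c - a)%R]%classic.
  apply/seteqP; split => x /=; rewrite !in_itv/= /phi => /andP[? ?];
    apply/andP; split; lra.
rewrite !lebesgue_measure_itv/= !lte_fin ltrD2r.
by case: ifP => // _; rewrite !EFinN -!EFinD -?EFinB; congr (_%:E); lra.
Qed.

(* Measurability of a function of k real variables, phrased so that it passes
   to sections and partial integrals without building the k-fold product. *)
Definition seq_measurable k g :=
  forall (d : measure_display) (T : measurableType d) (fs : seq (T -> R)),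
    size fs = k -> (forall i, measurable_fun setT (nth (cst 0%R) fs i)) ->
    measurable_fun setT (fun t => g [seq f t | f <- fs]).

Lemma seq_measurable_cons k g x :
  seq_measurable k.+1 g -> seq_measurable k (fun s => g (x :: s)).
Proof.
move=> mg d T fs sfs mfs.
by apply: (mg d T (cst x :: fs)) => [|[|i]] //=; rewrite sfs.
Qed.

Lemma iter_int_ge0 k g : (forall s, 0 <= g s) -> 0 <= iter_int k g.
Proof.
elim: k g => [|k IH] g g0 //=; apply: integral_ge0 => x _; exact: IH.
Qed.

(** The outermost integration variable is adjoined as the coordinate [snd] on [T * R]: by induction
    the inner integral is measurable there, and Tonelli's theorem integrates that variable out. *)
Lemma iter_int_measurable k j g : (forall s, 0 <= g s) ->
  seq_measurable (j + k) g ->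
  seq_measurable j (fun s => iter_int k (fun s' => g (s ++ s'))).
Proof.
move=> g0; elim: k j => [|k IH] j mg d T fs sfs mfs.
  under eq_fun do rewrite /= cats0.
  by apply: mg => //; rewrite addn0.
have mgj : seq_measurable (j.+1 + k) g by rewrite addSn -addnS.
pose gs : seq (T * R -> R) := rcons [seq f \o fst | f <- fs] snd.
have sgs : size gs = j.+1 by rewrite size_rcons size_map sfs.
have mgs i : measurable_fun setT (nth (cst 0%R) gs i).
  rewrite nth_rcons size_map sfs; case: ltngtP => ij.
  - rewrite (nth_map (cst 0%R)) ?sfs//.
    exact: measurableT_comp (mfs i) measurable_fst.
  - exact: measurable_cst.
  - exact: measurable_snd.
have := @measurable_fun_fubini_tonelli_F _ _ _ _ R mu _ (IH j.+1 mgj _ _ gs sgs mgs) _.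
move=> /(_ (fun=> iter_int_ge0 _ (fun=> g0 _))).
apply: eq_measurable_fun => t _; rewrite /fubini_F/=.
apply: eq_integral => x _; congr iter_int; apply/funext => s.
rewrite /gs map_rcons cat_rcons -map_comp; congr (g (_ ++ _)).
Qed.

Lemma measurable_iter_int_cons k g : (forall s, 0 <= g s) ->
  seq_measurable k.+1 g ->
  measurable_fun setT (fun x : R => iter_int k (fun s => g (x :: s))).
Proof.
move=> g0 mg.
apply: (@iter_int_measurable k 1 g g0 mg _ (measurableTypeR R) [:: id]) => //.
by case=> [|[|i]] //=; exact: measurable_cst.
Qed.

Lemma eq_iter_int k g1 g2 : (forall s, size s = k -> g1 s = g2 s) ->
  iter_int k g1 = iter_int k g2.
Proof.
elim: k g1 g2 => [|k IH] g1 g2 e /=; first exact: e.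
by apply: eq_integral => x _; apply: IH => s ss; apply: e; rewrite /= ss.
Qed.

Lemma le_iter_int k g1 g2 : (forall s, 0 <= g1 s) ->
  (forall s, g1 s <= g2 s) -> iter_int k g1 <= iter_int k g2.
Proof.
elim: k g1 g2 => [|k IH] g1 g2 g0 g12 //=.
by apply: ge0_le_integralT => x; [exact: iter_int_ge0 | exact: IH].
Qed.

Lemma iter_intD k g1 g2 : (forall s, 0 <= g1 s) -> (forall s, 0 <= g2 s) ->
  seq_measurable k g1 -> seq_measurable k g2 ->
  iter_int k (fun s => g1 s + g2 s) = iter_int k g1 + iter_int k g2.
Proof.
elim: k g1 g2 => [|k IH] g1 g2 g10 g20 m1 m2 //=.
rewrite -ge0_integralD//.
- by apply: eq_integral => x _; apply: IH => // ; exact: seq_measurable_cons.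
- by move=> x _; exact: iter_int_ge0.
- exact: measurable_iter_int_cons.
- by move=> x _; exact: iter_int_ge0.
- exact: measurable_iter_int_cons.
Qed.

Lemma iter_int0 k : iter_int k (fun=> 0 : \bar R) = 0.
Proof.
by elim: k => //= k IH; under eq_integral do rewrite IH; rewrite integral0.
Qed.

Lemma seq_measurable_sum k (I : Type) (r : seq I) (G : I -> seq R -> \bar R) :
  (forall i, seq_measurable k (G i)) ->
  seq_measurable k (fun s => \sum_(i <- r) G i s).
Proof.
move=> mG d T fs sfs mfs.
by apply: emeasurable_sum => i; exact: mG.
Qed.

Lemma iter_int_sum k (I : Type) (r : seq I) (G : I -> seq R -> \bar R) :
  (forall i s, 0 <= G i s) -> (forall i, seq_measurable k (G i)) ->
  iter_int k (fun s => \sum_(i <- r) G i s) = \sum_(i <- r) iter_int k (G i).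
Proof.
move=> G0 mG; elim: r => [|i r IH].
  by rewrite big_nil; under eq_fun do rewrite big_nil; exact: iter_int0.
rewrite big_cons -IH -iter_intD//.
- by congr iter_int; apply/funext => s; rewrite big_cons.
- by move=> s; apply: sume_ge0.
- exact: seq_measurable_sum.
Qed.

Lemma iter_int_add k (a : seq R) g : size a = k -> (forall s, 0 <= g s) ->
  seq_measurable k g ->
  iter_int k (fun s => g [seq (p.1 + p.2)%R | p <- zip s a]) = iter_int k g.
Proof.
elim: k a g => [|k IH] [|b a] g //= [sa] g0 mg.
rewrite -(@integral_addr b (fun x => iter_int k (fun s => g (x :: s)))).
- apply: eq_integral => x _.
  rewrite (IH a (fun s => g ((x + b)%R :: s)))//.
  exact: seq_measurable_cons.
- exact: measurable_iter_int_cons.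
- by move=> x; exact: iter_int_ge0.
Qed.

(** If a coefficient after the first is nonzero, each section is again a hyperplane and induction
    applies; otherwise the equation fixes the first coordinate. *)
Lemma iter_int_hyperplane k (y : seq R) (c : R) : size y = k ->
  has (fun r => r != 0%R) y ->
  iter_int k (fun s =>
    ((\sum_(i < k) nth 0%R y i * nth 0%R s i == c)%R%:R : R)%:E) = 0.
Proof.
elim: k y c => [|k IH] [|b y] c //= [sy].
have step x : iter_int k (fun s =>
    ((\sum_(i < k.+1) nth 0%R (b :: y) i * nth 0%R (x :: s) i == c)%R%:R
      : R)%:E) = iter_int k (fun s =>
    ((\sum_(i < k) nth 0%R y i * nth 0%R s i == c - b * x)%R%:R : R)%:E).
  apply: eq_iter_int => s _; rewrite big_ord_recl/=.
  rewrite -(inj_eq (addrI (- (b * x))%R)) addrA addNr add0r.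
  by rewrite [(c - _)%R]addrC.
have [hy _|hy] := boolP (has (fun r => r != 0%R) y).
  by under eq_integral do rewrite step IH//; rewrite integral0.
rewrite orbF => b0.
have y0 i : nth 0%R y i = 0%R.
  have [iy|iy] := ltnP i (size y); last by rewrite nth_default.
  move: hy => /hasPn/(_ _ (mem_nth 0%R iy)).
  by rewrite negbK => /eqP.
apply/eqP; rewrite eq_le integral_ge0; last first.
  by move=> x _; apply: iter_int_ge0 => s; rewrite lee_fin.
rewrite andbT.
pose z := (c / b)%R.
(* The value at the single point [z] is bounded by [+oo], whose integral over a point is still
   zero. *)
rewrite -(@integral_set1 R (fun=> +oo) z) [leRHS]integral_mkcond.
apply: ge0_le_integralT => x; rewrite step.
  by apply: iter_int_ge0 => s; rewrite lee_fin.
rewrite patchE; case: ifPn => [|/negP xz]; first by rewrite leey.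
rewrite (@eq_iter_int _ _ (fun=> 0)) ?iter_int0// => s _.
rewrite big1 => [|i _]; last by rewrite y0 mul0r.
case: eqP => // e; exfalso; apply: xz; rewrite inE/= /z.
have -> : c = (b * x)%R by lra.
by rewrite mulrAC divff// mul1r.
Qed.

(** Cubes are the only full-dimensional sets whose volume is evaluated: they give finiteness for
    bounded sets and positivity for sets with interior. *)
Lemma iter_int_box k (a : seq R) (r : R) : (0 <= r)%R -> size a = k ->
  iter_int k (fun s =>
    ([forall i : 'I_k, `|nth 0%R s i - nth 0%R a i| <= r]%R%:R : R)%:E) =
  ((2 * r) ^+ k)%R%:E.
Proof.
move=> r0; elim: k a => [|k IH] [|b a] //=.
  by move=> _; rewrite expr0; case: forallP => // -[]; case.
move=> [sa].
have step x : iter_int k (fun s =>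
   ([forall i : 'I_k.+1, `|nth 0%R (x :: s) i - nth 0%R (b :: a) i| <= r]%R%:R
     : R)%:E) = ((2 * r) ^+ k)%R%:E * (\1_(`[(b - r)%R, (b + r)%R]%classic) x)%:E.
  rewrite -(IH a sa).
  have xb : (`|x - b| <= r)%R = (x \in `[(b - r)%R, (b + r)%R]).
    by rewrite in_itv/= ler_distl.
  rewrite indicE mem_setE; have [xI|xI] := boolP (x \in `[_, _]).
    rewrite mule1; apply: eq_iter_int => s _; congr ((_ : bool)%:R)%:E.
    apply/forallP/forallP => h i.
      by have := h (lift ord0 i).
    by case: (unliftP ord0 i) => [i'|] -> //=; [exact: h | rewrite xb].
  rewrite mule0 (@eq_iter_int _ _ (fun=> 0)) ?iter_int0// => s _.
  by case: forallP => // /(_ ord0)/=; rewrite xb (negbTE xI).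
under eq_integral do rewrite step.
rewrite ge0_integralZl//; last 2 first.
- by apply/measurable_EFinP; exact: measurable_indic.
- by rewrite lee_fin exprn_ge0// mulr_ge0.
rewrite integral_indic// setIT exprSr EFinM; congr (_ * _).
rewrite [LHS](lebesgue_measure_itv `[(b - r)%R, (b + r)%R])/= lte_fin.
case: ltP => h.
  by rewrite -EFinD; congr _%:E; lra.
by congr _%:E; lra.
Qed.

End IteratedIntegral.

(** * Volume of sets of row vectors, up to finitely many hyperplanes *)

Section Volume.
Variables (R : realType) (n : nat).
Implicit Types (A B : set 'rV[R]_n) (x y : 'rV[R]_n) (c r : R).

Lemma dotpDr (m : nat) (u a b : 'rV[R]_m) : dotp u (a + b) = dotp u a + dotp u b.
Proof.
by rewrite /dotp -big_split/=; apply: eq_bigr => i _; rewrite mxE mulrDr.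
Qed.

Lemma dotpZr (m : nat) (u a : 'rV[R]_m) (k : R) : dotp u (k *: a) = k * dotp u a.
Proof.
by rewrite /dotp mulr_sumr; apply: eq_bigr => i _; rewrite mxE mulrCA.
Qed.

Lemma dotp0r (m : nat) (u : 'rV[R]_m) : dotp u 0 = 0.
Proof. by rewrite /dotp big1// => i _; rewrite mxE mulr0. Qed.

Lemma dotpNr (m : nat) (u a : 'rV[R]_m) : dotp u (- a) = - dotp u a.
Proof. by rewrite -scaleN1r dotpZr mulN1r. Qed.

Lemma dotpBr (m : nat) (u a b : 'rV[R]_m) : dotp u (a - b) = dotp u a - dotp u b.
Proof. by rewrite dotpDr dotpNr. Qed.

Lemma dotp_sumr (m : nat) (u : 'rV[R]_m) (I : Type) (s : seq I) (P : pred I)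
    (F : I -> 'rV[R]_m) :
  dotp u (\sum_(i <- s | P i) F i) = \sum_(i <- s | P i) dotp u (F i).
Proof. by apply: (big_morph (dotp u)); [exact: dotpDr|exact: dotp0r]. Qed.

Lemma dotpC (m : nat) (u a : 'rV[R]_m) : dotp u a = dotp a u.
Proof. by rewrite /dotp; apply: eq_bigr => i _; rewrite mulrC. Qed.

(** Borel sets, tested by preimages under coordinatewise measurable maps. This replaces a
    sigma-algebra on row vectors and fits [seq_measurable]. *)
Definition borel_like A :=
  forall (d : measure_display) (T : measurableType d) (F : T -> 'rV[R]_n),
    (forall i, measurable_fun setT (fun t => F t 0 i)) ->
    measurable (F @^-1` A).

Lemma measurable_dotp (d : measure_display) (T : measurableType d)
    (F : T -> 'rV[R]_n) y :
  (forall i, measurable_fun setT (fun t => F t 0 i)) ->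
  measurable_fun setT (fun t => dotp y (F t)).
Proof.
by move=> mF; apply: measurable_sum => i; apply: measurable_funM.
Qed.

Lemma borel_like_halfspace y c : borel_like [set x | 0 <= dotp y x + c].
Proof.
move=> d T F mF; rewrite -[X in measurable X]setTI.
have -> : F @^-1` [set x | 0 <= dotp y x + c] =
          (fun t => dotp y (F t)) @^-1` `[- c, +oo[.
  by apply/seteqP; split => t /=; rewrite in_itv/= andbT => h; lra.
exact: measurable_dotp.
Qed.

Lemma borel_likeC A : borel_like A -> borel_like (~` A).
Proof. by move=> mA d T F mF; rewrite preimage_setC; apply/measurableC/mA. Qed.

Lemma borel_like_forall (X : finType) (C : X -> set 'rV[R]_n) :
  (forall p, borel_like (C p)) -> borel_like [set x | forall p, C p x].
Proof.
move=> mC d T F mF.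
have -> : F @^-1` [set x | forall p, C p x] =
          \big[setI/setT]_(p : X) (F @^-1` C p).
  apply/seteqP; split => t /=.
    move=> h; elim: (index_enum X) => [|p s IH]; first by rewrite big_nil.
    by rewrite big_cons; split => //; exact: h.
  by move=> h p; move: h; rewrite (bigD1 p)//= => -[].
by apply: big_ind => // [A B|p _]; [exact: measurableI | exact: mC].
Qed.

Lemma borel_likeI A B : borel_like A -> borel_like B -> borel_like (A `&` B).
Proof.
by move=> mA mB d T F mF; rewrite preimage_setI; apply: measurableI;
  [exact: mA | exact: mB].
Qed.

Lemma borel_like_hyperplane y c : borel_like [set x | dotp y x = c].
Proof.
have -> : [set x | dotp y x = c] =
    [set x | 0 <= dotp y x + (- c)] `&` [set x | 0 <= dotp (- y) x + c].
  apply/seteqP; split => x /=; rewrite !(dotpC (- y)) dotpNr (dotpC x).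
    by move=> ->; split; lra.
  by move=> [h1 h2]; lra.
exact/borel_likeI/borel_like_halfspace/borel_like_halfspace.
Qed.

(** [vol] before [fine], so that inequalities can be proved before finiteness is checked. *)
Definition evol A : \bar R :=
  iter_int n (fun s => ((\1_A (\row_(i < n) nth 0 s i)) : R)%:E).

Lemma seq_measurable_indic A : borel_like A ->
  seq_measurable n (fun s => ((\1_A (\row_(i < n) nth 0 s i)) : R)%:E).
Proof.
move=> mA d T fs sfs mfs; apply/measurable_EFinP.
pose F t : 'rV[R]_n := \row_(i < n) nth 0 [seq f t | f <- fs] i.
have mF i : measurable_fun setT (fun t => F t 0 i).
  apply: eq_measurable_fun (mfs i) => t _ /=.
  by rewrite mxE (nth_map (cst 0%R)) ?sfs.
exact: measurable_indic (mA _ _ F mF).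
Qed.

Lemma evol_ge0 A : (0 <= evol A)%E.
Proof. by apply: iter_int_ge0 => s; rewrite lee_fin. Qed.

Lemma le_evol A B : A `<=` B -> (evol A <= evol B)%E.
Proof.
move=> AB; apply: le_iter_int => s; rewrite lee_fin//.
rewrite !indicE ler_nat; case: (boolP (_ \in A)) => //.
by rewrite !inE => /AB /mem_set ->.
Qed.

Lemma evol_hyperplane y c : y != 0 -> evol [set x | dotp y x = c] = 0%E.
Proof.
move=> y0.
pose ys := [seq y 0 i | i <- enum 'I_n].
have sy : size ys = n by rewrite size_map size_enum_ord.
have ysE (i : 'I_n) : nth 0 ys i = y 0 i.
  by rewrite (nth_map i) ?size_enum_ord// nth_ord_enum.
rewrite -(@iter_int_hyperplane _ n ys c sy).
  apply: eq_iter_int => s _; rewrite indicE; congr ((_ : bool)%:R)%:E.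
  apply/idP/eqP; rewrite inE/= /dotp => h.
    by rewrite -[RHS]h; apply: eq_bigr => i _; rewrite ysE mxE.
  by rewrite -[RHS]h; apply: eq_bigr => i _; rewrite ysE mxE.
apply: contra_neqT y0 => /hasPn h; apply/rowP => i; rewrite mxE.
have /h := map_f (fun i => y 0 i) (mem_enum 'I_n i).
by rewrite negbK => /eqP.
Qed.

Lemma evol_box x r : 0 <= r ->
  evol [set y | forall i, `|y 0 i - x 0 i| <= r] = ((2 * r) ^+ n)%:E.
Proof.
move=> r0.
pose xs := [seq x 0 i | i <- enum 'I_n].
have sx : size xs = n by rewrite size_map size_enum_ord.
have xsE (i : 'I_n) : nth 0 xs i = x 0 i.
  by rewrite (nth_map i) ?size_enum_ord// nth_ord_enum.
rewrite -(@iter_int_box _ n xs r r0 sx).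
apply: eq_iter_int => s _; rewrite indicE; congr ((_ : bool)%:R)%:E.
apply/idP/forallP; rewrite inE/= => h i; have := h i; first by rewrite mxE xsE.
by rewrite mxE xsE.
Qed.

Lemma evolS_sum (J : Type) (s : seq J) A (C : J -> set 'rV[R]_n) :
  (forall j, borel_like (C j)) ->
  (forall x, A x -> \sum_(j <- s) (\1_(C j) x : R) >= 1) ->
  (evol A <= \sum_(j <- s) evol (C j))%E.
Proof.
move=> mC cov; rewrite /evol -iter_int_sum; last 2 first.
- by move=> j t; rewrite lee_fin.
- by move=> j; exact: seq_measurable_indic.
apply: le_iter_int => t; rewrite ?lee_fin// sumEFin lee_fin {1}indicE.
case: (boolP (_ \in A)) => [|_]; first by rewrite inE => /cov.
by apply: sumr_ge0 => j _; rewrite indicE.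
Qed.

Lemma evol_sum_le (J : Type) (s : seq J) A (C : J -> set 'rV[R]_n) :
  (forall j, borel_like (C j)) ->
  (forall x, \sum_(j <- s) (\1_(C j) x : R) <= \1_A x) ->
  (\sum_(j <- s) evol (C j) <= evol A)%E.
Proof.
move=> mC cov; rewrite /evol -iter_int_sum; last 2 first.
- by move=> j t; rewrite lee_fin.
- by move=> j; exact: seq_measurable_indic.
apply: le_iter_int => t; last by rewrite sumEFin lee_fin.
by apply: sume_ge0 => j _; rewrite lee_fin.
Qed.

Definition hyperplanes (s : seq ('rV[R]_n * R)) : set 'rV[R]_n :=
  [set x | has (fun h => dotp h.1 x == h.2) s].

(** The negligible sets of the proof: a class closed under finite unions that contains all walls of
    the triangulations. *)
Definition small A := exists2 s : seq ('rV[R]_n * R),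
  all (fun h => h.1 != 0) s & A `<=` hyperplanes s.

Lemma smallU A B : small A -> small B -> small (A `|` B).
Proof.
move=> [s sn As] [t tn Bt]; exists (s ++ t); first by rewrite all_cat sn.
by move=> x [/As|/Bt] h; rewrite /hyperplanes/= has_cat; apply/orP;
  [left | right].
Qed.

Lemma sub_small A B : A `<=` B -> small B -> small A.
Proof. by move=> AB [s sn Bs]; exists s => // x /AB /Bs. Qed.

Lemma small_exists (J : finType) (C : J -> set 'rV[R]_n) :
  (forall j, small (C j)) -> small [set x | exists j, C j x].
Proof.
move=> sC.
apply: (@sub_small _ (\big[setU/set0]_(j : J) C j)).
  by move=> x [j Cjx]; rewrite (bigD1 j)//=; left.
by apply: big_ind => // [|A B]; [by exists [::] | exact: smallU].
Qed.

Lemma small_hyperplane y c : y != 0 -> small [set x | dotp y x = c].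
Proof.
move=> y0; exists [:: (y, c)]; first by rewrite /= y0.
by move=> x /= xc; rewrite /hyperplanes/= xc eqxx.
Qed.

Lemma borel_like_hyperplanes s : borel_like (hyperplanes s).
Proof.
elim: s => [|h s IH].
  have -> : hyperplanes [::] = set0 by apply/seteqP; split.
  by move=> d T F _; rewrite preimage_set0.
have -> : hyperplanes (h :: s) =
    ~` (~` [set x | dotp h.1 x = h.2] `&` ~` hyperplanes s).
  rewrite setCI !setCK; apply/seteqP; split => x /=.
    by move=> /orP[/eqP|]; [left|right].
  move=> [hx|hs]; rewrite /hyperplanes/=; first by rewrite hx eqxx.
  by rewrite (hs : has _ _) orbT.
by apply/borel_likeC/borel_likeI; apply: borel_likeC => //;
  exact: borel_like_hyperplane.
Qed.

Lemma evol_small A : small A -> evol A = 0%E.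
Proof.
move=> [s sn As]; apply/eqP; rewrite eq_le evol_ge0 andbT.
apply: (@le_trans _ _ (\sum_(h <- s) evol [set x | dotp h.1 x = h.2])%E).
  apply: evolS_sum => [h|x /As]; first exact: borel_like_hyperplane.
  move=> /hasP[h hs /eqP hx].
  elim: s hs {sn As} => // k s IH.
  have ge0 : 0 <= \sum_(j <- s) (\1_[set x | dotp j.1 x = j.2] x : R).
    by apply: sumr_ge0 => j _; rewrite indicE.
  rewrite inE big_cons => /orP[/eqP hk|/IH]; last by move=> ?; rewrite ler_wpDl.
  by rewrite -hk indicE mem_set// ler_wpDr.
rewrite big_seq big1// => h hs; apply: evol_hyperplane.
by move/allP: sn => /(_ _ hs).
Qed.

Definition bnd A := exists r, forall x, A x -> forall i, `|x 0 i| <= r.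

Lemma evol_fin A : bnd A -> evol A \is a fin_num.
Proof.
move=> [r Ar]; rewrite ge0_fin_numE ?evol_ge0//.
apply: (@le_lt_trans _ _ ((2 * `|r|) ^+ n)%:E); last by rewrite ltry.
rewrite -(@evol_box 0)//; apply: le_evol => x /Ar h i; rewrite mxE subr0.
by apply: le_trans (h i) _; exact: ler_norm.
Qed.

Lemma vol_small A : small A -> vol A = 0.
Proof. by move=> /evol_small h; rewrite /vol -/(evol A) h. Qed.

Lemma vol_gt0 A x r : bnd A -> 0 < r ->
  [set y : 'rV[R]_n | forall i, `|y 0 i - x 0 i| <= r] `<=` A -> 0 < vol A.
Proof.
move=> /evol_fin fA r0 /le_evol; rewrite (evol_box _ (ltW r0)) /vol -/(evol A).
rewrite -(fineK fA) lee_fin; apply: lt_le_trans.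
by rewrite exprn_gt0// mulr_gt0.
Qed.

Lemma vol_translate A (a : 'rV[R]_n) : borel_like A ->
  vol [set x | A (x + a)] = vol A.
Proof.
move=> mA; rewrite /vol; congr fine.
pose xs := [seq a 0 i | i <- enum 'I_n].
have sx : size xs = n by rewrite size_map size_enum_ord.
have xsE (i : 'I_n) : nth 0 xs i = a 0 i.
  by rewrite (nth_map i) ?size_enum_ord// nth_ord_enum.
rewrite -[RHS](iter_int_add sx); last 2 first.
- by move=> s; rewrite lee_fin.
- exact: seq_measurable_indic.
apply: eq_iter_int => s ss; rewrite !indicE; congr ((_ : bool)%:R)%:E.
suff -> : \row_(i < n) nth 0 [seq p.1 + p.2 | p <- zip s xs] i =
          \row_(i < n) nth 0 s i + a by apply/idP/idP; rewrite !inE.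
apply/rowP => i; rewrite !mxE (nth_map (0, 0)) ?size_zip ?ss ?sx ?minnn//.
by rewrite nth_zip ?ss ?sx//= xsE.
Qed.

(** The two inequalities are proved separately: the pieces and the exceptional hyperplanes together
    cover [A], and the pieces with the hyperplanes removed are disjoint inside [A]. *)
Lemma vol_decomposition (J : finType) (T : pred J) A (C : J -> set 'rV[R]_n)
    (N : set 'rV[R]_n) :
  bnd A -> (forall j, T j -> borel_like (C j)) -> small N ->
  (forall j, T j -> C j `<=` A) ->
  (forall x, A x -> ~ N x -> exists2 j, T j & C j x) ->
  (forall x j k, ~ N x -> T j -> T k -> C j x -> C k x -> j = k) ->
  vol A = \sum_(j | T j) vol (C j).
Proof.
move=> bA mC [s sn Ns] CA cov dis.
pose D := hyperplanes s.
have mD : borel_like D by exact: borel_like_hyperplanes.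
have vD : evol D = 0%E by apply: evol_small; exists s.
(* Pieces outside [T] are emptied, which makes every piece measurable. *)
pose C' j := if T j then C j else set0.
have mC' j : borel_like (C' j).
  rewrite /C'; case: ifP => [/mC//|_].
  by move=> d U F _; rewrite preimage_set0.
have C'E j x : T j -> C' j x = C j x by rewrite /C' => ->.
have C'T j x : C' j x -> T j by rewrite /C'; case: ifP.
pose r := [seq j <- index_enum J | T j].
suff vE : evol A = (\sum_(j <- r) evol (C' j))%E.
  rewrite /vol -/(evol A) vE -sum_fine.
    by rewrite big_filter; apply: eq_bigr => j Tj; rewrite /C' Tj.
  move=> j _; apply: evol_fin; have [b Ab] := bA; exists b => x.
  by move=> C'x; apply: Ab; apply: (CA j (C'T _ _ C'x)); rewrite -C'E// (C'T _ _ C'x).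
apply/eqP; rewrite eq_le; apply/andP; split.
  apply: (@le_trans _ _
    (\sum_(o <- None :: [seq Some j | j <- r])
       evol (if o is Some j then C' j else D))%E).
    apply: evolS_sum => [[j|]//|x Ax].
    rewrite big_cons big_map.
    have [Dx|Dx] := pselect (D x).
      rewrite [\1_D x]indicE mem_set// ler_wpDr//.
      by apply: sumr_ge0 => j _; rewrite indicE.
    have [j Tj Cjx] := cov x Ax (fun Nx => Dx (Ns x Nx)).
    rewrite ler_wpDl ?indicE// big_filter (bigD1 j)//=.
    rewrite indicE mem_set ?C'E// ler_wpDr//.
    by apply: sumr_ge0 => i _; rewrite indicE.
  by rewrite big_cons big_map vD add0e.
apply: (@le_trans _ _ (\sum_(j <- r) evol (C' j `&` ~` D))%E).
  apply: lee_sum => j _.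
  apply: (@le_trans _ _
    (\sum_(o <- [:: C' j `&` ~` D; D]) evol o)%E); last first.
    by rewrite !big_cons big_nil vD !adde0.
  have -> : (\sum_(o <- [:: C' j `&` ~` D; D]) evol o =
    \sum_(b <- [:: true; false]) evol (if b then C' j `&` ~` D else D))%E.
    by rewrite !big_cons !big_nil.
  apply: evolS_sum => [[]//|x C'x].
    exact/borel_likeI/borel_likeC.
  rewrite !big_cons big_nil addr0.
  have [Dx|Dx] := pselect (D x).
    by rewrite [X in _ + X]indicE mem_set// ler_wpDl// indicE.
  by rewrite indicE mem_set// ler_wpDr// indicE.
apply: evol_sum_le => [j|x]; first exact/borel_likeI/borel_likeC.
have [[j [C'x Dx]]|no] := pselect (exists j, (C' j `&` ~` D) x).
  have Tj := C'T _ _ C'x.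
  rewrite big_filter (bigD1 j)//= big1 => [|i /andP[Ti ij]].
    rewrite addr0 !indicE mem_set// mem_set//.
    by apply: (CA j Tj); rewrite -C'E.
  rewrite indicE; case: (boolP (_ \in _)) => //; rewrite inE => -[C'ix _].
  move: ij; rewrite (dis x i j) ?eqxx// -?C'E//.
  by move=> /Ns.
rewrite big1 => [|j _]; first by rewrite indicE.
rewrite indicE; case: (boolP (_ \in _)) => //; rewrite inE => h.
by exfalso; apply: no; exists j.
Qed.

End Volume.

(** * Linear programming over finitely many vectors *)

Lemma finite_min (R : realType) (F : finType) (P : F -> Prop) (f : F -> R) :
  (exists x, P x) -> exists2 x, P x & forall y, P y -> f x <= f y.
Proof.
move=> [x0 /asboolP Px0].
case: (arg_minP (P := fun x => `[< P x >]) f Px0) => x /asboolP Px fx.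
by exists x => // y /asboolP; exact: fx.
Qed.

Section LinearProgram.
Variables (R : realType) (m : nat) (X : finType) (A : X -> 'rV[R]_m).
Implicit Types (c d : X -> R) (s S : {set X}) (w Y : 'rV[R]_m).

Definition comb c : 'rV[R]_m := \sum_p c p *: A p.
Definition supported s c := forall p, p \notin s -> c p = 0.
Definition inspan s w := exists2 c, supported s c & comb c = w.
Definition indep s := forall c, supported s c -> comb c = 0 -> forall p, c p = 0.
Definition basis s := indep s /\ forall w, inspan s w.

Lemma combD c d : comb (fun p => c p + d p) = comb c + comb d.
Proof. by rewrite /comb -big_split; apply: eq_bigr => p _; rewrite scalerDl. Qed.

Lemma combZ (k : R) c : comb (fun p => k * c p) = k *: comb c.
Proof.
by rewrite /comb scaler_sumr; apply: eq_bigr => p _; rewrite scalerA.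
Qed.

Lemma combB c d : comb (fun p => c p - d p) = comb c - comb d.
Proof.
by rewrite -scaleN1r -combZ -combD; congr comb; apply/funext => p; rewrite mulN1r.
Qed.

Lemma comb_sum (I : Type) (r : seq I) (P : pred I) (c : I -> X -> R) :
  comb (fun p => \sum_(i <- r | P i) c i p) = \sum_(i <- r | P i) comb (c i).
Proof.
rewrite /comb exchange_big/=; apply: eq_bigr => p _.
by rewrite scaler_suml.
Qed.

Lemma comb1 p : comb (fun q => (q == p)%:R) = A p.
Proof.
rewrite /comb (bigD1 p)//= eqxx scale1r big1 ?addr0// => q /negbTE ->.
by rewrite scale0r.
Qed.

Lemma dotp_comb Y c : dotp Y (comb c) = \sum_p c p * dotp Y (A p).
Proof. by rewrite dotp_sumr; apply: eq_bigr => p _; rewrite dotpZr. Qed.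

Lemma eq_on_inspan s Y1 Y2 w : (forall p, p \in s -> dotp Y1 (A p) = dotp Y2 (A p)) ->
  inspan s w -> dotp Y1 w = dotp Y2 w.
Proof.
move=> e [c sc <-]; rewrite !dotp_comb; apply: eq_bigr => p _.
by have [/e ->//|/sc ->] := boolP (p \in s); rewrite !mul0r.
Qed.

Lemma inspan_sub s (t : {set X}) w : s \subset t -> inspan s w -> inspan t w.
Proof.
by move=> st [c sc cw]; exists c => // p pt; apply: sc; apply: contra pt => /(fintype.subsetP st).
Qed.

Lemma inspanD s w1 w2 : inspan s w1 -> inspan s w2 -> inspan s (w1 + w2).
Proof.
move=> [c sc <-] [d sd <-]; exists (fun p => c p + d p); last exact: combD.
by move=> p ps; rewrite sc// sd// addr0.
Qed.

Lemma inspanZ s (k : R) w : inspan s w -> inspan s (k *: w).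
Proof.
move=> [c sc <-]; exists (fun p => k * c p); last exact: combZ.
by move=> p ps; rewrite sc// mulr0.
Qed.

Lemma inspanN s w : inspan s w -> inspan s (- w).
Proof. by move=> h; rewrite -scaleN1r; exact: inspanZ. Qed.

Lemma inspan_sum s (I : finType) (P : pred I) (F : I -> 'rV[R]_m) :
  (forall i, P i -> inspan s (F i)) -> inspan s (\sum_(i | P i) F i).
Proof.
move=> h; apply: big_ind => // [|w1 w2]; last exact: inspanD.
by exists (fun=> 0) => //; rewrite /comb big1// => p _; rewrite scale0r.
Qed.

Lemma inspan1 s p : p \in s -> inspan s (A p).
Proof.
move=> ps; exists (fun q => (q == p)%:R); last exact: comb1.
by move=> q; apply: contraNeq; rewrite pnatr_eq0 eqb0 negbK => /eqP ->.
Qed.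

Lemma supported_uniq s c d : indep s -> supported s c -> supported s d ->
  comb c = comb d -> c =1 d.
Proof.
move=> is_ sc sd cd p; apply/eqP; rewrite -subr_eq0; apply/eqP.
apply: (is_ (fun q => c q - d q)); last by rewrite combB cd subrr.
by move=> q qs; rewrite sc// sd// subrr.
Qed.

Let rows s : 'M[R]_(#|s|, m) := \matrix_(i < #|s|) A (enum_val i).

Let coef s (u : 'rV[R]_#|s|) : X -> R :=
  fun p => \sum_(i < #|s|) u 0 i * (p == enum_val i)%:R.

Let coef_supported s u : supported s (coef (s := s) u).
Proof.
move=> p ps; apply: big1 => i _; case: eqP => [pi|_]; last by rewrite mulr0.
by move: ps; rewrite pi enum_valP.
Qed.

Let comb_coef s (u : 'rV[R]_#|s|) : comb (coef u) = u *m rows s.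
Proof.
rewrite /coef comb_sum mulmx_sum_row; apply: eq_bigr => i _.
by rewrite combZ comb1 rowK.
Qed.

Let coef_val s (u : 'rV[R]_#|s|) i : coef u (enum_val i) = u 0 i.
Proof.
rewrite /coef (bigD1 i)//= eqxx mulr1 big1 ?addr0// => j ji.
by rewrite (inj_eq enum_val_inj) eq_sym (negbTE ji) mulr0.
Qed.

Let row_free_rows s : indep s -> row_free (rows s).
Proof.
move=> is_; rewrite -kermx_eq0; apply/rowV0P => u /sub_kermxP uM.
apply/rowP => i; rewrite mxE -coef_val.
by apply: is_; [exact: coef_supported | rewrite comb_coef].
Qed.

Lemma card_basis s : basis s -> #|s| = m.
Proof.
move=> [/row_free_rows/eqP <- sp]; apply/eqP; rewrite -/(row_full _) -sub1mx.
apply/row_subP => i; have [c sc <-] := sp (row i 1%:M).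
apply: summx_sub => p _; have [ps|/sc ->] := boolP (p \in s); last first.
  by rewrite scale0r sub0mx.
apply: scalemx_sub; rewrite -[p](enum_rankK_in ps ps).
by rewrite -(rowK (fun i => A (enum_val i))) row_sub.
Qed.

(** A right inverse of the matrix of rows [A p] solves for [Y]. With [h] a height function, [Y]
    supports a lifted simplex; with [h] a Kronecker delta, it is a dual basis vector. *)
Lemma dual_exists s (h : X -> R) : indep s ->
  exists Y, forall p, p \in s -> dotp Y (A p) = h p.
Proof.
move=> /row_free_rows/row_freeP[B rB].
exists (B *m \col_i h (enum_val i))^T => p ps.
pose i := enum_rank_in ps p.
have ip : enum_val i = p by rewrite enum_rankK_in.
transitivity ((rows s *m (B *m \col_i h (enum_val i))) i 0).
  by rewrite [RHS]mxE dotpC; apply: eq_bigr => j _; rewrite !mxE ip.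
by rewrite mulmxA rB mul1mx mxE ip.
Qed.

Lemma annihilator_exists s w : ~ inspan s w ->
  exists Y, (forall p, p \in s -> dotp Y (A p) = 0) /\ dotp Y w != 0.
Proof.
move=> nw.
have : ~~ (w <= rows s)%MS.
  apply/negP => /submxP[u wu]; apply: nw; exists (coef u).
    exact: coef_supported.
  by rewrite comb_coef.
rewrite submxE => /matrix0Pn[i [j ij]].
have E (v : 'rV[R]_m) :
    dotp (row j (cokermx (rows s))^T) v = (v *m cokermx (rows s)) 0 j.
  by rewrite dotpC /dotp [RHS]mxE; apply: eq_bigr => k _; rewrite !mxE.
exists (row j (cokermx (rows s))^T); split=> [p ps|]; last by rewrite E -(ord1 i).
pose k := enum_rank_in ps p.
have kp : enum_val k = p by rewrite enum_rankK_in.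
by rewrite E -kp -(rowK (fun i => A (enum_val i)) k) -row_mul mulmx_coker !mxE.
Qed.

Definition supp c : {set X} := [set p | c p != 0].

Lemma suppP c : supported (supp c) c.
Proof. by move=> p; rewrite inE negbK => /eqP. Qed.

Definition feasible S w c :=
  [/\ forall p, 0 <= c p, supported S c & comb c = w].

Definition cost (h : X -> R) c := \sum_p c p * h p.

Lemma costD h c d : cost h (fun p => c p + d p) = cost h c + cost h d.
Proof. by rewrite /cost -big_split; apply: eq_bigr => p _; rewrite mulrDl. Qed.

Lemma costZ h (k : R) c : cost h (fun p => k * c p) = k * cost h c.
Proof. by rewrite /cost mulr_sumr; apply: eq_bigr => p _; rewrite mulrA. Qed.

Variable e : 'rV[R]_m.
Hypothesis eA : forall p, dotp e (A p) = 1.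

(** All [A p] lie on the affine hyperplane [dotp e = 1], so the coefficients of a linear relation
    sum to zero. *)
Lemma comb0_has_neg d : comb d = 0 -> (exists p, d p != 0) -> exists p, d p < 0.
Proof.
move=> d0 [p0 dp0]; apply/not_existsP => h.
have ge0 p : 0 <= d p by rewrite leNgt; apply/negP/h.
have : \sum_p d p = 0.
  transitivity (dotp e (comb d)); last by rewrite d0 dotp0r.
  by rewrite dotp_comb; apply: eq_bigr => p _; rewrite eA mulr1.
move/eqP; rewrite psumr_eq0// => /allP/(_ p0 (mem_index_enum _))/=.
by rewrite (negbTE dp0).
Qed.

(** A linear relation on the support, with the sign for which the cost does not increase, is added
    until a first coefficient vanishes; the support shrinks. *)
Lemma caratheodory h S w c : feasible S w c ->
  exists c', [/\ feasible S w c', cost h c' <= cost h c & indep (supp c')].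
Proof.
have [k] := ubnP #|supp c|; elim: k c => // k IH c ck [c0 cS cw].
have [is_|/existsNP[d /not_implyP[sd /not_implyP[d0 /existsNP[p0 dp0]]]]] :=
  pselect (indep (supp c)); first by exists c; split.
wlog dh : d sd d0 p0 dp0 / cost h d <= 0.
  move=> W; have [|ch] := leP (cost h d) 0; first exact: W d0 p0 dp0.
  apply: (W (fun p => -1 * d p) _ _ p0); rewrite ?costZ ?combZ ?d0 ?scaler0//.
  - by move=> p ps; rewrite sd// mulr0.
  - by rewrite mulN1r => /eqP; rewrite oppr_eq0 => /eqP.
  - by rewrite mulN1r oppr_le0 ltW.
have [p1 dp1] : exists p, d p < 0.
  by apply: comb0_has_neg => //; exists p0; exact/eqP.
have [q dq qmin] := @finite_min R X (fun p => d p < 0) (fun p => c p / - d p)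
  (ex_intro _ p1 dp1).
(* The largest step that keeps all coefficients nonnegative; the coefficient at [q] becomes zero. *)
pose t := c q / - d q.
have t0 : 0 <= t by rewrite divr_ge0// oppr_ge0 ltW.
pose c' p := c p + t * d p.
have c'q : c' q = 0.
  by rewrite /c' /t invrN mulrN mulNr divfK ?subrr// lt_eqF.
have c'0 p : 0 <= c' p.
  rewrite /c'; have [dp|dp] := ltP (d p) 0; last first.
    by rewrite addr_ge0// mulr_ge0.
  have := qmin _ dp; rewrite -/t ler_pdivlMr ?oppr_gt0// mulrN => ?; lra.
have sub p : p \notin supp c -> c' p = 0.
  by move=> ps; rewrite /c' sd// mulr0 addr0 suppP.
have [||c2 [f2 h2 i2]] := IH c'.
- rewrite ltnS in ck; apply: leq_trans ck; apply: proper_card.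
  apply/properP; split.
    by apply/fintype.subsetP => p; rewrite [in X in X -> _]inE; apply: contraR => /sub/eqP.
  exists q; last by rewrite inE c'q eqxx.
  by apply/negPn/negP => /sd dq0; move: dq; rewrite dq0 ltxx.
- split => //; last by rewrite combD combZ d0 scaler0 addr0.
  move=> p pS; apply: sub; rewrite inE negbK; exact/eqP/cS.
exists c2; split=> //; apply: le_trans h2 _.
by rewrite costD costZ gerDl mulr_ge0_le0.
Qed.

Lemma optimum_exists h S w c : feasible S w c ->
  exists c0, [/\ feasible S w c0, indep (supp c0) &
    forall c', feasible S w c' -> cost h c0 <= cost h c'].
Proof.
move=> fc.
pose P (s : {set X}) := exists c', [/\ feasible S w c', supp c' = s & indep s].
have exP : exists s, P s.
  by have [c' [? _ ?]] := caratheodory h fc; exists (supp c'), c'; split.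
have /choice[g gP] : forall s, exists c',
    P s -> [/\ feasible S w c', supp c' = s & indep s].
  move=> s.
  by have [[c' ?]|nP] := pselect (P s); [exists c' | exists (fun=> 0)].
have [s Ps smin] := @finite_min R _ P (fun s => cost h (g s)) exP.
have [f1 e1 i1] := gP _ Ps.
exists (g s); split; [by []|by rewrite e1|] => c1 /(caratheodory h)[c2 [f2 c21 i2]].
apply: le_trans c21.
have P2 : P (supp c2) by exists c2; split.
apply: le_trans (smin _ P2) _; have [[g0 gS gw] e2 _] := gP _ P2.
suff -> : g (supp c2) = c2 by [].
apply/funext; apply: (supported_uniq i2) => //; last by rewrite gw; case: f2.
- by rewrite -{1}e2; exact: suppP.
- exact: suppP.
Qed.

(* Otherwise pushing p into the support would lower the cost. *)
Lemma optimum_dual_le h S w c Y p : feasible S w c ->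
  (forall c', feasible S w c' -> cost h c <= cost h c') ->
  (forall q, q \in supp c -> dotp Y (A q) = h q) ->
  p \in S -> inspan (supp c) (A p) -> dotp Y (A p) <= h p.
Proof.
move=> [c0 cS cw] copt Yh pS [b bs bp]; rewrite leNgt; apply/negP => lt.
pose d q := (q == p)%:R - b q.
have costd : cost h d < 0.
  have -> : cost h d = h p - dotp Y (A p).
    rewrite /cost -bp dotp_comb.
    under eq_bigr do rewrite mulrBl.
    rewrite sumrB (bigD1 p)//= eqxx mul1r big1 ?addr0; last first.
      by move=> q /negbTE ->; rewrite mul0r.
    congr (_ - _); apply: eq_bigr => q _.
    by have [/Yh ->//|/bs ->] := boolP (q \in supp c); rewrite !mul0r.
  by rewrite subr_lt0.
have [t t0 ht] : exists2 t : R, 0 < t & forall q, 0 <= c q + t * d q.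
  have [t [t0 ht]] : exists t : R, 0 < t /\ forall q, q \in supp c ->
      t * `|d q| <= c q.
    have [|noq] := pselect (exists q, q \in supp c); last first.
      by exists 1; split => // q qs; case: noq; exists q.
    (* The [+ 1] keeps the ratio meaningful where [d q] vanishes. *)
    move=> /(@finite_min R X (fun q => q \in supp c) (fun q => c q / (`|d q| + 1))).
    move=> [q0 q0s qmin].
    have pos q : 0 < `|d q| + 1 by rewrite ltr_wpDl.
    exists (c q0 / (`|d q0| + 1)); split.
      by rewrite divr_gt0// lt_def c0 andbT; move: q0s; rewrite inE.
    move=> q qs; apply: le_trans (_ : (c q / (`|d q| + 1)) * `|d q| <= _).
      by rewrite ler_wpM2r// qmin.
    by rewrite mulrAC ler_pdivrMr// ler_wpM2l// lerDl.
  exists t => // q; have [qs|qs] := boolP (q \in supp c).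
    have := ht q qs; rewrite -[X in X * `|_|]gtr0_norm// -normrM ler_norml.
    by move=> /andP[? _]; lra.
  rewrite (suppP qs) /d (bs q qs) subr0 add0r mulr_ge0//; exact: ltW.
have := copt (fun q => c q + t * d q).
rewrite costD costZ lerDl pmulr_rge0// leNgt costd /= => h1.
suff : false by []; apply: h1; split => //.
- move=> q qS; rewrite cS// add0r /d bs ?inE ?cS ?eqxx//.
  by case: eqP qS => [->|_ _]; [rewrite pS | rewrite subr0 mulr0].
- rewrite combD combZ combB comb1 bp subrr scaler0 addr0//.
Qed.

End LinearProgram.

(** * The Cayley trick: Minkowski sums as slices *)

Lemma finite_lower_bound (R : realType) (F : finType) (P : F -> Prop)
    (f : F -> R) : (forall x, P x -> 0 < f x) ->
  exists2 r, 0 < r & forall x, P x -> r <= f x.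
Proof.
move=> f0; have [exP|noP] := pselect (exists x, P x).
  by have [x Px xmin] := finite_min f exP; exists (f x) => //; exact: f0.
by exists 1 => // x Px; case: noP; exists x.
Qed.

(** Weights of repeated points are merged on the index set, so coefficient functions on [X] replace
    families of arbitrary length. *)
Lemma convP (R : realType) (m : nat) (X : finType) (w : X -> 'rV[R]_m)
    (D : {set X}) x : Defs.conv [set y | exists2 p, p \in D & y = w p] x <->
  exists c : X -> R, [/\ forall p, 0 <= c p, forall p, p \notin D -> c p = 0,
     \sum_p c p = 1 & x = \sum_p c p *: w p].
Proof.
split.
  move=> [k [l [pt [l0 l1 ptS ->]]]].
  have /choice[q qP] : forall j, exists p, p \in D /\ pt j = w p.
    by move=> j; have [p pD pj] := ptS j; exists p.
  exists (fun p => \sum_(j < k) l j * (p == q j)%:R); split.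
  - by move=> p; apply: sumr_ge0 => j _; rewrite mulr_ge0.
  - move=> p pS; apply: big1 => j _; case: eqP => [e|]; last by rewrite mulr0.
    by move: pS; rewrite e; have [-> _] := qP j.
  - rewrite exchange_big/= -[RHS]l1; apply: eq_bigr => j _.
    rewrite -mulr_sumr (bigD1 (q j))//= eqxx [X in _ + X]big1 => [|p /negbTE -> //].
    by rewrite addr0 mulr1.
  - transitivity (\sum_(j < k) \sum_p (l j * (p == q j)%:R) *: w p).
      apply: eq_bigr => j _; have [_ ->] := qP j.
      rewrite (bigD1 (q j))//= eqxx mulr1 big1 ?addr0// => p /negbTE ->.
      by rewrite mulr0 scale0r.
    by rewrite exchange_big/=; apply: eq_bigr => p _; rewrite scaler_suml.
move=> [c [c0 cS c1 ->]].
have sumD (V : lmodType R) (F : X -> V) : (forall p, p \notin D -> F p = 0) ->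
    \sum_p F p = \sum_(j < #|D|) F (enum_val j).
  move=> F0; rewrite -(big_enum_val F)/= [RHS]big_mkcond/=; apply: eq_bigr => p _.
  by case: (boolP (p \in D)) => // /F0.
exists #|D|, (fun j => c (enum_val j)), (fun j => w (enum_val j)); split=> //.
- by rewrite -[RHS]c1 (sumD R^o).
- by move=> j; exists (enum_val j) => //; exact: enum_valP.
- by rewrite sumD// => p /cS ->; rewrite scale0r.
Qed.

Section Cayley.
Variables (R : realType) (n : nat) (X : finType).
Variables (idx : X -> 'I_n) (v : X -> 'rV[R]_n).
Implicit Types (c : X -> R) (s S : {set X}) (I : {set 'I_n}) (x : 'rV[R]_n).
Implicit Types (Y : 'rV[R]_(n + n)) (h : X -> R).

Definition point p : 'rV[R]_(n + n) := row_mx (v p) (ebasis R (idx p)).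

Local Notation pcomb := (comb point).
Local Notation pfeasible := (feasible point).

Lemma dotp_row_mx Y x l :
  dotp Y (row_mx x l) = dotp (lsubmx Y) x + dotp (rsubmx Y) l.
Proof.
rewrite /dotp big_split_ord/=; congr (_ + _); apply: eq_bigr => i _;
  by rewrite ?row_mxEl ?row_mxEr !mxE.
Qed.

Lemma dotp_ebasis (z : 'rV[R]_n) i : dotp z (ebasis R i) = z 0 i.
Proof.
rewrite /dotp (bigD1 i)//= mxE eqxx mulr1 big1 ?addr0// => j ji.
by rewrite mxE eq_sym (negbTE ji) mulr0.
Qed.

Lemma dotp_point Y p : dotp Y (point p) = dotp (lsubmx Y) (v p) + rsubmx Y 0 (idx p).
Proof. by rewrite dotp_row_mx dotp_ebasis. Qed.

Lemma comb_point c :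
  pcomb c = row_mx (\sum_p c p *: v p) (\row_i \sum_(p | idx p == i) c p).
Proof.
rewrite /comb -[LHS]hsubmxK; congr row_mx.
  rewrite [LHS]linear_sum; apply: eq_bigr => p _.
  by rewrite linearZ/= row_mxKl.
apply/rowP => i; rewrite linear_sum/= summxE mxE [RHS]big_mkcond/=.
apply: eq_bigr => p _; rewrite linearZ/= row_mxKr !mxE.
by case: eqP; rewrite ?mulr1 ?mulr0.
Qed.

Definition ind I : 'rV[R]_n := \row_i (i \in I)%:R.

(** The slice over the indicator vector of [I] of the cone spanned by the lifted points of [S]. It
    serves both for whole configurations, where it is a Minkowski sum, and for single simplices. *)
Definition cell S I : set 'rV[R]_n :=
  [set x | exists c, pfeasible S (row_mx x (ind I)) c].

Lemma feasible_cellP S I x c : pfeasible S (row_mx x (ind I)) c <->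
  [/\ forall p, 0 <= c p, supported S c, \sum_p c p *: v p = x
    & forall i, \sum_(p | idx p == i) c p = (i \in I)%:R].
Proof.
rewrite /feasible comb_point; split=> [[c0 cS]|[c0 cS <- ci]].
  move=> /eq_row_mx[<- e]; split=> // i.
  by move/rowP: e => /(_ i); rewrite !mxE.
by split=> //; congr row_mx; apply/rowP => i; rewrite !mxE ci.
Qed.

(** The functional that takes the value 1 on every lifted point; it plays the part of [e] in the
    linear programs. *)
Definition total : 'rV[R]_(n + n) := row_mx 0 (const_mx 1).

Lemma total_point p : dotp total (point p) = 1.
Proof.
rewrite dotp_point row_mxKl row_mxKr mxE dotpC dotp0r add0r//.
Qed.

Lemma cell_coef_le S I x c p : pfeasible S (row_mx x (ind I)) c ->
  0 <= c p <= (idx p \in I)%:R.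
Proof.
move=> /feasible_cellP[c0 _ _ ci]; rewrite c0/= -ci (bigD1 p)//= lerDl.
by apply: sumr_ge0.
Qed.

Lemma bnd_cell S I : bnd (cell S I).
Proof.
exists (\sum_p \sum_j `|v p 0 j|) => x [c fc] i.
have [c0 _ <- _] := (feasible_cellP _ _ _ _).1 fc.
rewrite summxE; apply: le_trans (ler_norm_sum _ _ _) _.
apply: ler_sum => p _; rewrite mxE normrM (bigD1 i)//=.
apply: (@le_trans _ _ `|v p 0 i|); last first.
  by rewrite lerDl; apply: sumr_ge0.
rewrite ler_piMl// ger0_norm//.
have /andP[_ /le_trans] := cell_coef_le p fc; apply.
by case: (_ \in _).
Qed.

Definition hull S (i : 'I_n) : set 'rV[R]_n :=
  Defs.conv [set x | exists p, [/\ p \in S, idx p = i & x = v p]].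

Lemma hullP S i x : hull S i x <->
  exists c, [/\ forall p, 0 <= c p, forall p, ~~ ((p \in S) && (idx p == i)) -> c p = 0,
     \sum_p c p = 1 & x = \sum_p c p *: v p].
Proof.
pose D : {set X} := [set p | (p \in S) && (idx p == i)]%SET.
have -> : hull S i = Defs.conv [set y | exists2 p, p \in D & y = v p].
  congr Defs.conv; apply/seteqP; split=> y /= [p].
    by move=> [pS pi ->]; exists p => //; rewrite inE pS pi eqxx.
  by rewrite inE => /andP[pS /eqP pi] ->; exists p.
rewrite convP; split=> -[c [c0 cS c1 cx]]; exists c; split=> // p pD; apply: cS.
  by rewrite inE.
by move: pD; rewrite inE.
Qed.

(** Coefficients over an index of [I] sum to 1 and describe a point of that hull; those over any
    other index sum to 0 and vanish. *)
Lemma msum_hull S I : Defs.msum I (hull S) = cell S I.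
Proof.
apply/seteqP; split=> x.
  move=> [f [fS ->]].
  have /choice[c cP] : forall i, exists c, i \in I ->
      [/\ forall p, 0 <= c p, forall p, ~~ ((p \in S) && (idx p == i)) -> c p = 0,
     \sum_p c p = 1 & f i = \sum_p c p *: v p].
    move=> i; have [iI|_] := boolP (i \in I); last by exists (fun=> 0).
    by have /hullP[c cP] := fS i iI; exists c.
  exists (fun p => if idx p \in I then c (idx p) p else 0).
  apply/feasible_cellP; split.
  - by move=> p; case: ifP => // /cP[].
  - by move=> p pS; case: ifP => // /cP[_ -> //]; rewrite (negbTE pS).
  - transitivity (\sum_(i in I) \sum_p (if idx p == i then c i p else 0) *: v p).
      rewrite exchange_big/=; apply: eq_bigr => p _; case: ifPn => pI.
        rewrite (bigD1 (idx p))//= eqxx big1 ?addr0// => i /andP[_].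
        by rewrite eq_sym => /negbTE ->; rewrite scale0r.
      rewrite scale0r big1// => i iI; case: eqP => [e|]; last by rewrite scale0r.
      by move: pI; rewrite e iI.
    apply: eq_bigr => i /cP[_ cS _ ->]; apply: eq_bigr => p _; case: ifPn => // pi.
    by rewrite cS ?scale0r// (negbTE pi) andbF.
  - move=> i; case: (boolP (i \in I)) => iI; last first.
      by apply: big1 => p /eqP ->; rewrite (negbTE iI).
    have [_ cS c1 _] := cP i iI; rewrite -[RHS]c1 big_mkcond/=.
    apply: eq_bigr => p _; case: eqP => [->|/eqP pi]; first by rewrite iI.
    by rewrite cS// (negbTE pi) andbF.
move=> [c /feasible_cellP[c0 cS <- ci]].
exists (fun i => \sum_(p | idx p == i) c p *: v p); split=> [i iI|].
  apply/hullP; exists (fun p => if idx p == i then c p else 0); split.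
  - by move=> p; case: ifP.
  - by move=> p; case: ifP => //; rewrite andbT => _ /cS.
  - by rewrite -big_mkcond/= ci iI.
  - by rewrite big_mkcond/=; apply: eq_bigr => p _; case: ifP; rewrite ?scale0r.
rewrite (partition_big idx predT)//= [RHS]big_mkcond/=; apply: eq_bigr => i _.
case: ifPn => // iI; apply: big1 => p /eqP pi.
suff -> : c p = 0 by rewrite scale0r.
have := ci i; rewrite (negbTE iI) => /eqP; rewrite psumr_eq0//.
by move=> /allP/(_ p (mem_index_enum _)); rewrite pi eqxx => /eqP.
Qed.

End Cayley.

(** * Cells of bases, their walls and their volumes *)

Section Simplices.
Variables (R : realType) (n : nat) (X : finType).
Variables (idx : X -> 'I_n) (v : X -> 'rV[R]_n).
Implicit Types (c : X -> R) (s S : {set X}) (I : {set 'I_n}) (x : 'rV[R]_n).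
Implicit Types (Y : 'rV[R]_(n + n)) (h : X -> R).

Local Notation point := (point idx v).
Local Notation cell := (cell idx v).
Local Notation pcomb := (comb point).
Local Notation pbasis := (basis point).
Local Notation ind := (ind R).

Definition alone s p := forall q, q \in s -> idx q = idx p -> q = p.

Definition multi s : {set 'I_n} :=
  [set i | [exists p in s, [exists q in s, [&& p != q, idx p == i & idx q == i]]]]%SET.

Lemma multiP s i : reflect
  (exists p q, [/\ p \in s, q \in s, p != q, idx p = i & idx q = i]) (i \in multi s).
Proof.
rewrite inE; apply: (iffP existsP) => [[p /andP[ps /existsP[q]]]|[p [q]]].
  by move=> /andP[qs /and3P[pq /eqP ? /eqP ?]]; exists p, q.
move=> [ps qs pq <- qp]; exists p; rewrite ps; apply/existsP; exists q.
by rewrite qs pq qp !eqxx.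
Qed.

Lemma alone_multi s p : p \in s -> idx p \notin multi s -> alone s p.
Proof.
move=> ps pm q qs qp; apply/eqP; apply: contraNT pm => pq.
by apply/multiP; exists q, p.
Qed.

(** Only [p] contributes to the coordinate of its index. *)
Lemma alone_coef s p c x l : p \in s -> alone s p -> supported s c ->
  pcomb c = row_mx x l -> c p = l 0 (idx p).
Proof.
move=> ps al sc; rewrite comb_point => /eq_row_mx[_ <-]; rewrite mxE.
rewrite (bigD1 p)//= big1 ?addr0// => q /andP[/eqP qp qnp].
have [qs|/sc//] := boolP (q \in s); by rewrite (al q qs qp) eqxx in qnp.
Qed.

Lemma basis_idx s i : pbasis s -> exists2 p, p \in s & idx p = i.
Proof.
move=> [_ sp]; have [c sc] := sp (row_mx 0 (ebasis R i)).
rewrite comb_point => /eq_row_mx[_ /rowP/(_ i)]; rewrite !mxE eqxx => e.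
apply/not_exists2P => np; move: e; rewrite big1 => [|p /eqP pi].
  by move=> /eqP; rewrite eq_sym oner_eq0.
by apply: sc; have [|] := np p; [move/negP | rewrite pi].
Qed.

(** The dual basis. It turns membership in a cell into finitely many linear inequalities, whence
    measurability and interior points. *)
Lemma basis_coord s : pbasis s -> exists phi : X -> 'rV[R]_(n + n),
  [/\ forall p q, p \in s -> q \in s -> dotp (phi p) (point q) = (q == p)%:R,
   forall c p, supported s c -> p \in s -> dotp (phi p) (pcomb c) = c p
  & forall w, pcomb (fun p => if p \in s then dotp (phi p) w else 0) = w].
Proof.
move=> [si sp].
have /choice[phi phiP] : forall p, exists Y, forall q, q \in s ->
    dotp Y (point q) = (q == p)%:R.
  by move=> p; have [Y YP] := dual_exists (fun q => (q == p)%:R) si; exists Y.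
have phiC c p : supported s c -> p \in s -> dotp (phi p) (pcomb c) = c p.
  move=> sc ps; rewrite dotp_comb (bigD1 p)//= phiP// eqxx mulr1 big1 ?addr0//.
  move=> q qp; have [qs|/sc ->] := boolP (q \in s); last by rewrite mul0r.
  by rewrite phiP// (negbTE qp) mulr0.
exists phi; split=> // [p q ps qs|w]; first exact: phiP.
have [c sc cw] := sp w; rewrite -[RHS]cw; congr comb; apply/funext => p.
by case: ifPn => [ps|/sc//]; rewrite -cw phiC.
Qed.

Lemma coord_cell s I phi x :
  (forall c p, supported s c -> p \in s -> dotp (phi p) (pcomb c) = c p) ->
  (forall w, pcomb (fun p => if p \in s then dotp (phi p) w else 0) = w) ->
  cell s I x <-> forall p, p \in s -> 0 <= dotp (phi p) (row_mx x (ind I)).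
Proof.
move=> phiC phiK; split=> [[c [c0 sc <-]] p ps|h]; first by rewrite phiC.
exists (fun p => if p \in s then dotp (phi p) (row_mx x (ind I)) else 0).
split=> // [p|p /negbTE -> //]; by case: ifP => // /h.
Qed.

Lemma borel_like_cell s I : pbasis s -> borel_like (cell s I).
Proof.
move=> /basis_coord[phi [_ phiC phiK]].
have -> : cell s I = [set x | forall p : X, (if p \in s then
    [set x | 0 <= dotp (lsubmx (phi p)) x + dotp (rsubmx (phi p)) (ind I)]
    else setT) x].
  apply/seteqP; split=> x /=.
    move=> /(coord_cell _ _ phiC phiK) h p; case: ifP => //= /h.
    by rewrite dotp_row_mx.
  move=> h; apply/(coord_cell _ _ phiC phiK) => p ps; have := h p.
  by rewrite ps dotp_row_mx.
apply: borel_like_forall => p; case: ifP => _; first exact: borel_like_halfspace.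
by move=> d T F _; rewrite preimage_setT.
Qed.

(** [phi p] is 1 at [p] and 0 at another vertex over the same index; with a zero first block it
    would depend on the index alone. *)
Lemma coord_nonconstant s phi p : p \in s ->
  (forall q, q \in s -> dotp (phi p) (point q) = (q == p)%:R) ->
  ~ alone s p -> lsubmx (phi p) != 0.
Proof.
move=> ps phiP nal; apply/negP => /eqP l0; apply: nal => q qs qp.
have := phiP p ps; rewrite eqxx dotp_point l0 dotpC dotp0r add0r => e1.
have := phiP q qs; rewrite dotp_point l0 dotpC dotp0r add0r qp e1.
by case: eqP => // _ /eqP; rewrite oner_eq0.
Qed.

(** The walls of all cells in the slice. Vertices that are alone over their index are excluded
    because their coefficient is constant on the slice and cuts out no hyperplane. *)
Definition degenerate I : set 'rV[R]_n :=
  [set x | exists s p, [/\ pbasis s, p \in s, ~ alone s p &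
    exists2 c, supported s c & pcomb c = row_mx x (ind I) /\ c p = 0]].

Lemma small_degenerate I : small (degenerate I).
Proof.
apply: (@sub_small _ _ _ [set x | exists sp : {set X} * X,
   [/\ pbasis sp.1, sp.2 \in sp.1, ~ alone sp.1 sp.2 &
    exists2 c, supported sp.1 c & pcomb c = row_mx x (ind I) /\ c sp.2 = 0]]).
  by move=> x [s [p h]]; exists (s, p).
apply: small_exists => -[s p] /=.
have [bs|nbs] := pselect (pbasis s); last by exists [::] => // x [].
have [ps|nps] := boolP (p \in s); last by exists [::] => // x [].
have [al|nal] := pselect (alone s p); first by exists [::] => // x [].
have [phi [phiP phiC _]] := basis_coord bs.
have y0 : lsubmx (phi p) != 0.
  by apply: (coord_nonconstant ps) => // q qs; exact: phiP.
apply: sub_small (small_hyperplane (- dotp (rsubmx (phi p)) (ind I)) y0).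
move=> x [_ _ _ [c sc [cx cp]]] /=.
have := phiC c p sc ps; rewrite cx cp dotp_row_mx => /eqP.
by rewrite addr_eq0 => /eqP.
Qed.

(** Coefficients over an index outside [I] vanish; two vertices of [s] over such an index put the
    whole cell into a wall. *)
Lemma small_cell s I : pbasis s -> ~~ (multi s \subset I) -> small (cell s I).
Proof.
move=> bs /fintype.subsetPn[i /multiP[p [q [ps qs pq pi qi]]] iI].
apply: sub_small (small_degenerate I) => x [c fc].
exists s, p; split=> //.
  by move=> /(_ q qs); rewrite qi pi => /(_ erefl) qp; rewrite qp eqxx in pq.
have [c0 sc cw] := fc; exists c => //; split=> //.
have := cell_coef_le p fc; rewrite pi (negbTE iI) => ?.
by apply/eqP; rewrite eq_le andbC.
Qed.

(** Vertices over indices outside [I] are alone, so their coefficients in the full slice equal 1.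
    Dropping them is a translation by their sum [a]. *)
Lemma vol_cell s I : pbasis s -> multi s \subset I ->
  vol (cell s I) = vol (cell s finset.setT).
Proof.
move=> bs mI.
pose d p : R := ((p \in s) && (idx p \notin I))%:R.
pose a := \sum_p d p *: v p.
have sd : supported s d by move=> p /negbTE ps; rewrite /d ps.
have al p : p \in s -> idx p \notin I -> alone s p.
  by move=> ps pI; apply: alone_multi => //; apply: contra pI; exact/fintype.subsetP.
have dE : pcomb d = row_mx a (ind (~: I)).
  rewrite comb_point; congr row_mx; apply/rowP => i; rewrite !mxE inE.
  case: (boolP (i \in I)) => iI /=; last first.
    have [p ps pi] := basis_idx i bs.
    rewrite (bigD1 p) ?pi//= /d ps pi iI big1 ?addr0// => q /andP[/eqP qi qp].
    case: (boolP (q \in s)) => // qs; rewrite qi iI/=.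
    by rewrite (al p ps _ q qs) ?pi ?qi// eqxx in qp.
  by apply: big1 => p /eqP pi; rewrite /d pi iI andbF.
have indE : ind I + ind (~: I) = ind finset.setT.
  by apply/rowP => i; rewrite !mxE !inE; case: (i \in I); rewrite ?addr0 ?add0r.
rewrite -(@vol_translate _ _ (cell s finset.setT) a); last exact: borel_like_cell.
congr vol; apply/seteqP; split=> x /= [c [c0 sc cw]].
  exists (fun p => c p + d p); split=> [p|p ps|].
  - by rewrite addr_ge0.
  - by rewrite sc// sd// addr0.
  - by rewrite combD cw dE add_row_mx indE.
exists (fun p => c p - d p); split=> [p|p ps|].
- rewrite subr_ge0 /d; case: (boolP (p \in s)) => //= ps; case: (boolP (_ \in I)) => //= pI.
  by rewrite (alone_coef ps (al p ps pI) sc cw) mxE inE.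
- by rewrite sc// sd// subrr.
- by rewrite combB cw dE opp_row_mx add_row_mx addrK -indE addrK.
Qed.

Lemma vol_cell_gt0 s : pbasis s -> 0 < vol (cell s finset.setT).
Proof.
move=> bs; have [phi [_ phiC phiK]] := basis_coord bs.
(* Unit mass over each index is shared equally among its vertices, which makes every coefficient of
   [x0] positive. *)
pose N i := (\sum_(p | idx p == i) ((p \in s)%:R : R)).
have N0 i : 0 < N i.
  have [p ps pi] := basis_idx i bs; rewrite /N (bigD1 p) ?pi//= ps.
  by rewrite ltr_pwDl// sumr_ge0.
pose c p := (p \in s)%:R / N (idx p).
have sc : supported s c by move=> p /negbTE ps; rewrite /c ps mul0r.
have cp p : p \in s -> 0 < c p by move=> ps; rewrite /c ps divr_gt0.
pose x0 := \sum_p c p *: v p.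
have cE : pcomb c = row_mx x0 (ind finset.setT).
  rewrite comb_point; congr row_mx; apply/rowP => i; rewrite !mxE inE.
  transitivity (N i / N i); last by rewrite divff// gt_eqF.
  by rewrite /N mulr_suml; apply: eq_bigr => p /eqP pi; rewrite /c pi.
(* [nrm p] dominates the l1-norm of the linear part of coordinate [p], and the [+ 1] makes it
   positive. On a cube of radius [r], no coordinate varies by more than its value at [x0]. *)
pose nrm p := \sum_j `|lsubmx (phi p) 0 j| + 1.
have nrm0 p : 0 < nrm p by rewrite ltr_wpDl// sumr_ge0.
have [r r0 rP] := @finite_lower_bound R X (fun p => p \in s) (fun p => c p / nrm p)
  (fun p ps => divr_gt0 (cp p ps) (nrm0 p)).
apply: (@vol_gt0 _ _ _ x0 r); [exact: bnd_cell | exact: r0 |].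
move=> x xr; apply/(coord_cell _ _ phiC phiK) => p ps.
have -> : row_mx x (ind finset.setT) = pcomb c + row_mx (x - x0) 0.
  by rewrite cE add_row_mx addr0 addrCA subrr addr0.
rewrite dotpDr phiC// dotp_row_mx dotp0r addr0.
suff : `|dotp (lsubmx (phi p)) (x - x0)| <= c p.
  by rewrite ler_norml => /andP[? _]; lra.
apply: (@le_trans _ _ (r * nrm p)); last by rewrite -ler_pdivlMr// rP.
apply: le_trans (ler_norm_sum _ _ _) _.
apply: (@le_trans _ _ (\sum_j `|lsubmx (phi p) 0 j| * r)).
  apply: ler_sum => j _; rewrite normrM ler_wpM2l//.
  by have := xr j; rewrite !mxE.
by rewrite -mulr_suml mulrC ler_wpM2l ?(ltW r0)// lerDl.
Qed.

End Simplices.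

(** * Regular triangulations and the formula for the mixed volume *)

Section RegularTriangulation.
Variables (R : realType) (n : nat) (X : finType).
Variables (idx : X -> 'I_n) (v : X -> 'rV[R]_n).
Implicit Types (c : X -> R) (s t S : {set X}) (I : {set 'I_n}) (x : 'rV[R]_n).
Implicit Types (Y : 'rV[R]_(n + n)) (h : X -> R).

Local Notation point := (point idx v).
Local Notation cell := (cell idx v).
Local Notation pcomb := (comb point).
Local Notation pbasis := (basis point).
Local Notation pinspan := (inspan point).
Local Notation ind := (ind R).

(* The maximal simplices of the regular triangulation of the Cayley polytope
   of S with heights h, given by their supporting affine function Y. *)
Definition tri S h s := [/\ s \subset S, pbasis s &
  exists2 Y, forall p, p \in s -> dotp Y (point p) = h p
    & forall p, p \in S -> p \notin s -> dotp Y (point p) < h p].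

(** No further lifted point lies on the graph of the functional through a lifted basis. Weak
    supporting inequalities thereby become the strict ones of [tri]. *)
Definition generic h := forall s Y p, pbasis s ->
  (forall q, q \in s -> dotp Y (point q) = h q) -> p \notin s ->
  dotp Y (point p) != h p.

(** Weak duality, with complementary slackness in the case of equality. *)
Lemma tri_cost_ge S h s Y c :
  (forall p, p \in s -> dotp Y (point p) = h p) ->
  (forall p, p \in S -> p \notin s -> dotp Y (point p) < h p) ->
  (forall p, 0 <= c p) -> supported S c ->
  dotp Y (pcomb c) <= cost h c /\ (dotp Y (pcomb c) = cost h c -> supported s c).
Proof.
move=> Ys YS c0 cS; rewrite dotp_comb /cost.
have le p : c p * dotp Y (point p) <= c p * h p.
  have [/cS ->|] := boolP (p \notin S); first by rewrite !mul0r.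
  rewrite negbK => pS; rewrite ler_wpM2l//.
  by have [/Ys ->//|ps] := boolP (p \in s); rewrite ltW// YS.
split; first by apply: ler_sum => p _; exact: le.
move=> e p ps; have : \sum_q (c q * h q - c q * dotp Y (point q)) = 0.
  by rewrite sumrB e subrr.
move/eqP; rewrite psumr_eq0 => [|q _]; last by rewrite subr_ge0.
move=> /allP/(_ p (mem_index_enum _))/=; rewrite -mulrBr mulf_eq0 => /orP[/eqP//|].
rewrite subr_eq0 => /eqP hp.
have [pS|/cS//] := boolP (p \in S).
by have := YS p pS ps; rewrite hp ltxx.
Qed.

(** By complementary slackness the coefficients of [x] on [s] are also supported on [t]. Off the
    walls, a vertex of [s] missing from [t] is then alone over an index outside [I]; comparing it
    with a vertex of [t] over that index gives contradictory strict inequalities. *)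
Lemma tri_disjoint S h I x s t : ~ degenerate idx v I x ->
  tri S h s -> tri S h t -> cell s I x -> cell t I x -> s = t.
Proof.
move=> ndeg.
wlog [p ps pt] : s t / exists2 p, p \in s & p \notin t.
  move=> W ts tt cs ct; apply/eqP; rewrite finset.eqEsubset; apply/andP; split.
    by apply/fintype.subsetPn => -[p ps pt]; move: (pt); rewrite -(W s t)// ?ps//; exists p.
  by apply/fintype.subsetPn => -[p ps pt]; move: (pt); rewrite -(W t s)// ?ps//; exists p.
move=> [sS bs [Y Ys YS]] [tS bt [Z Zt ZS]] [c [c0 sc cx]] [d [d0 sd dx]].
have sub (u : {set X}) (g : X -> R) : u \subset S -> supported u g -> supported S g.
  by move=> uS ug q qS; apply: ug; apply: contra qS; exact/fintype.subsetP.
have [dY dYs] := tri_cost_ge Ys YS d0 (sub _ _ tS sd).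
have [cZ cZt] := tri_cost_ge Zt ZS c0 (sub _ _ sS sc).
have cY : dotp Y (pcomb c) = cost h c.
  rewrite dotp_comb; apply: eq_bigr => q _.
  by have [/Ys ->//|/sc ->] := boolP (q \in s); rewrite !mul0r.
have dZ : dotp Z (pcomb d) = cost h d.
  rewrite dotp_comb; apply: eq_bigr => q _.
  by have [/Zt ->//|/sd ->] := boolP (q \in t); rewrite !mul0r.
have ct : supported t c.
  by apply: cZt; rewrite dx in dY dZ; rewrite cx in cY cZ *; lra.
have key q : q \in s -> q \notin t -> alone idx s q /\ idx q \notin I.
  move=> qs qt; have al : alone idx s q.
    by apply/not_notP => nal; apply: ndeg; exists s, q; split=> //; exists c; rewrite ?ct.
  split=> //; apply/negP => qI.
  have := alone_coef qs al sc cx; rewrite (ct q qt) mxE qI => /eqP.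
  by rewrite eq_sym oner_eq0.
have [alp pI] := key p ps pt.
have [q qt qp] := basis_idx (idx p) bt.
have qs : q \notin s by apply: contra pt => qs; rewrite -(alp q qs qp).
(* The difference of two points over one index has zero last block, so alone vertices of [s], among
   them all those outside [t], get coefficient zero. On the span of the rest [Y] and [Z] agree. *)
have [b sb bE] := bs.2 (row_mx (v p - v q) 0).
have spn : pinspan (s :&: t)%SET (row_mx (v p - v q) 0).
  exists b => // r; rewrite inE negb_and => /orP[/sb//|rt].
  have [rs|/sb//] := boolP (r \in s).
  by rewrite (alone_coef rs (key r rs rt).1 sb bE) mxE.
have YZ : dotp Y (row_mx (v p - v q) 0) = dotp Z (row_mx (v p - v q) 0).
  by apply: eq_on_inspan spn => r; rewrite inE => /andP[rs rt]; rewrite Ys// Zt.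
have pq : point p - point q = row_mx (v p - v q) 0.
  by rewrite /point qp opp_row_mx add_row_mx subrr.
move: YZ; rewrite -pq !dotpBr (Ys p ps) (Zt q qt).
have := YS q (fintype.subsetP tS q qt) qs.
have := ZS p (fintype.subsetP sS p ps) pt.
by move=> h1 h2 h3; exfalso; clear -h1 h2 h3; lra.
Qed.

(** A span that misses some direction of $\mathbb R^n$ meets the slice inside a hyperplane. Off
    these hyperplanes the support of every solution spans all directions. *)
Definition nonspanning I : set 'rV[R]_n :=
  [set x | exists s, ~ (forall x', pinspan s (row_mx x' 0)) /\
                     pinspan s (row_mx x (ind I))].

Lemma small_nonspanning I : small (nonspanning I).
Proof.
apply: small_exists => s.
have [sp|/existsNP[x' nsp]] := pselect (forall x', pinspan s (row_mx x' 0)).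
  by exists [::] => // x [].
have [Y [Ys]] := annihilator_exists nsp.
rewrite dotp_row_mx dotp0r addr0 => Yx'.
have Y0 : lsubmx Y != 0.
  by apply: contraNneq Yx' => ->; rewrite dotpC dotp0r.
apply: sub_small (small_hyperplane (- dotp (rsubmx Y) (ind I)) Y0) => x [_ sx] /=.
have : dotp Y (row_mx x (ind I)) = dotp 0 (row_mx x (ind I)).
  by apply: eq_on_inspan sx => p /Ys ->; rewrite dotpC dotp0r.
by rewrite (dotpC 0) dotp0r dotp_row_mx => /eqP; rewrite addr_eq0 => /eqP.
Qed.

(** The support [U] of an optimal solution has indices in [I] and, off [nonspanning], spans every
    direction of $\mathbb R^n$. One vertex over each remaining index completes it to a basis. *)
Lemma tri_cover S h I x : generic h -> (forall i, exists2 p, p \in S & idx p = i) ->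
  cell S I x -> ~ nonspanning I x -> exists2 s, tri S h s & cell s I x.
Proof.
move=> gh Si [c fc] nx.
have [c0 [f0 iU opt]] := optimum_exists (total_point idx v) h fc.
have [c00 c0S c0x] := f0.
set U := supp c0 in iU.
have sU : supported U c0 by exact: suppP.
have US : U \subset S.
  apply/fintype.subsetP => p; rewrite inE; apply: contraR => /c0S ->; exact: eqxx.
have UI p : p \in U -> idx p \in I.
  rewrite inE; apply: contraR => pI; have := cell_coef_le p f0.
  by rewrite (negbTE pI) => ?; rewrite eq_le andbC.
have spn x' : pinspan U (row_mx x' 0).
  by apply: contrapT => nsp; apply: nx; exists U; split; [move=> /(_ x') | exists c0].
have [Y0 Y0U] := dual_exists h iU.
(* Over each index, the vertex with least excess over the linear part of [Y0]: for an index outside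
   [I] this is where the supporting functional will touch. *)
have /choice[g gP] : forall i, exists p, [/\ p \in S, idx p = i &
    forall q, q \in S -> idx q = i ->
      h p - dotp (lsubmx Y0) (v p) <= h q - dotp (lsubmx Y0) (v q)].
  move=> i.
  have [|p [pS pi] pmin] := @finite_min R X (fun p => p \in S /\ idx p = i)
    (fun p => h p - dotp (lsubmx Y0) (v p)).
  - by have [p pS pi] := Si i; exists p.
  - by exists p; split=> // q qS qi; apply: pmin.
pose s : {set X} := (U :|: [set p | (idx p \notin I) && (p == g (idx p))])%SET.
have Us : U \subset s by exact: finset.subsetUl.
have gs i : i \notin I -> g i \in s.
  by move=> iI; have [_ gi _] := gP i; rewrite !inE gi iI eqxx orbT.
have sI p : p \in s -> idx p \notin I -> p = g (idx p).
  rewrite !inE => /orP[|/andP[_ /eqP]//] pU pI.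
  by move: (UI p); rewrite inE => /(_ pU); rewrite (negbTE pI).
have sS : s \subset S.
  apply/fintype.subsetP => p; have [pI|pI] := boolP (idx p \in I).
    by rewrite !inE pI orbF => pU; apply: (fintype.subsetP US); rewrite inE.
  by move=> ps; rewrite (sI p ps pI); have [] := gP (idx p).
have bs : pbasis s.
  split.
    move=> d sd d0; apply: iU => // p pU.
    have [ps|/sd//] := boolP (p \in s).
    have pI : idx p \notin I.
      by move: ps; rewrite inE (negbTE pU)/= inE => /andP[].
    have al : alone idx s p.
      by move=> q qs qp; rewrite (sI p ps pI) (sI q qs) qp.
    have dw : pcomb d = row_mx 0 0 by rewrite d0 row_mx0.
    by rewrite (alone_coef ps al sd dw) mxE.
  have spe i : pinspan s (row_mx 0 (ebasis R i)).
    have [p ps pi] : exists2 p, p \in s & idx p = i.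
      have [iI|iI] := boolP (i \in I); last by exists (g i); [exact: gs | case: (gP i)].
      have [_ _ _ /(_ i)] := (feasible_cellP _ _ _ _ _ _).1 f0; rewrite iI => e.
      apply/not_exists2P => np; move: e; rewrite big1 => [|p /eqP pi].
        by move=> /eqP; rewrite eq_sym oner_eq0.
      apply: sU; apply/negP => pU.
      by have [|] := np p; [rewrite (fintype.subsetP Us) | rewrite pi].
    have -> : row_mx 0 (ebasis R i) = point p + row_mx (- v p) 0.
      by rewrite /point pi add_row_mx subrr addr0.
    by apply: inspanD; [exact: inspan1 | exact: inspan_sub (spn _)].
  move=> w; rewrite -[w]hsubmxK.
  have -> : row_mx (lsubmx w) (rsubmx w) = row_mx (lsubmx w) 0 +
      \sum_i rsubmx w 0 i *: row_mx (0 : 'rV_n) (ebasis R i).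
    rewrite -[RHS]hsubmxK !linearD/= row_mxKl row_mxKr add0r; congr row_mx.
      rewrite linear_sum big1/= ?addr0// => i _.
      by rewrite linearZ/= row_mxKl scaler0.
    apply/rowP => j; rewrite linear_sum summxE (bigD1 j)//= big1 => [|i ij].
      by rewrite linearZ/= row_mxKr addr0 [RHS]mxE [ebasis R j _ _]mxE eqxx mulr1.
    by rewrite linearZ/= row_mxKr !mxE (negbTE ij) mulr0.
  apply: inspanD; first exact: inspan_sub (spn _).
  by apply: inspan_sum => i _; apply: inspanZ.
have [Y Ys] := dual_exists h bs.1.
have YU p : p \in U -> dotp Y (point p) = h p by move=> /(fintype.subsetP Us)/Ys.
exists s; last first.
  exists c0; split=> // p ps; apply: sU; apply: contra ps; exact/fintype.subsetP.
split=> //; exists Y => // p pS ps.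
(* Genericity leaves a weak inequality. For an index in [I] it is dual feasibility at the optimum;
   otherwise it is minimality of [g], as [Y] and [Y0] have the same linear part. *)
rewrite lt_def eq_sym (gh s Y p)//=.
have [pI|pI] := boolP (idx p \in I).
  apply: (optimum_dual_le f0 opt YU pS).
  have [q qU qi] : exists2 q, q \in U & idx q = idx p.
    have [_ _ _ /(_ (idx p))] := (feasible_cellP _ _ _ _ _ _).1 f0; rewrite pI => e.
    apply/not_exists2P => np; move: e; rewrite big1 => [|q /eqP qi].
      by move=> /eqP; rewrite eq_sym oner_eq0.
    apply: sU; apply/negP => qU.
    by have [|] := np q; [rewrite qU | rewrite qi].
  have -> : point p = point q + row_mx (v p - v q) 0.
    by rewrite /point qi add_row_mx addr0 addrCA subrr addr0.
  by apply: inspanD => //; exact: inspan1.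
have [gS gi gmin] := gP (idx p).
have Yg := Ys _ (gs _ pI).
have YY0 x' : dotp (lsubmx Y) x' = dotp (lsubmx Y0) x'.
  have := eq_on_inspan (fun q qU => etrans (YU q qU) (esym (Y0U q qU))) (spn x').
  by rewrite !dotp_row_mx !dotp0r !addr0.
move: Yg; rewrite !dotp_point gi !YY0.
have := gmin p pS erefl; lra.
Qed.

Definition mixed s := multi idx s == finset.setT.

(** Expand the product over [i] of $1-[i\notin D]$ by distributivity; [I] collects the factors from
    which 1 is taken. *)
Lemma sum_sign_supersets (D : {set 'I_n}) :
  \sum_(I : {set 'I_n} | D \subset I) ((-1) ^+ (n - #|I|) : R) =
  (D == finset.setT)%:R.
Proof.
have := @bigA_distr R 0 1 *%R +%R _ (fun=> 1) (fun i : 'I_n => - (i \notin D)%:R).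
have -> : \prod_(i < n) (1 - (i \notin D)%:R : R) = (D == finset.setT)%:R.
  case: (boolP (D == finset.setT)) => [/eqP ->|].
    by apply: big1 => i _; rewrite inE subr0.
  rewrite -finset.subTset => /fintype.subsetPn[i _ iD].
  by rewrite (bigD1 i)//= iD subrr mul0r.
move=> ->; rewrite [LHS]big_mkcond/=; apply: eq_bigr => I _.
case: ifPn => [DI|/fintype.subsetPn[i iD iI]]; last first.
  by rewrite (bigD1 i)//= (negbTE iI) iD oppr0 mul0r.
rewrite (eq_bigr (fun i => if i \in ~: I then -1 else 1)); last first.
  move=> i _; rewrite inE; case: (boolP (i \in I)) => //= iI.
  suff -> : i \notin D by [].
  by apply: contra iI; exact/fintype.subsetP.
rewrite -big_mkcond/= prodr_const; congr (_ ^+ _).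
have := cardsC I; rewrite card_ord => e.
by transitivity (#|I| + #|~: I| - #|I|)%N; [rewrite e | rewrite addKn].
Qed.

Theorem mixed_volume_tri S h : generic h ->
  (forall i, exists2 p, p \in S & idx p = i) ->
  mixed_volume (hull idx v S) = (n`!%:R)^-1 *
    \sum_(s | `[< tri S h s >] && mixed s) vol (cell s finset.setT).
Proof.
move=> gh Si; rewrite /mixed_volume; congr (_ * _).
have volI (I : {set 'I_n}) : vol (Defs.msum I (hull idx v S)) =
    \sum_(s | `[< tri S h s >])
      if multi idx s \subset I then vol (cell s finset.setT) else 0.
  (* Cells may overlap on [degenerate] and fail to cover on [nonspanning]; both sets are
     negligible. *)
  rewrite msum_hull (@vol_decomposition _ _ _ (fun s => `[< tri S h s >]) _
    (fun s => cell s I) (degenerate idx v I `|` nonspanning I)).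
  - apply: eq_bigr => s /asboolP[sS bs _]; case: ifPn => mI; first exact: vol_cell.
    exact/vol_small/small_cell.
  - exact: bnd_cell.
  - by move=> s /asboolP[_ bs _]; exact: borel_like_cell.
  - exact/smallU/small_nonspanning/small_degenerate.
  - move=> s /asboolP[sS _ _] x [c [c0 sc cx]]; exists c; split=> // p pS.
    by apply: sc; apply: contra pS; exact/fintype.subsetP.
  - move=> x Sx Nx; have [|s ts sx] := tri_cover gh Si Sx; first by move=> h'; apply: Nx; right.
    by exists s => //; exact/asboolP.
  - move=> x s t Nx /asboolP ts /asboolP tt; apply: tri_disjoint ts tt.
    by move=> h'; apply: Nx; left.
under eq_bigr do rewrite volI mulr_sumr.
rewrite exchange_big/= [RHS]big_mkcondr/=; apply: eq_bigr => s _.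
transitivity (\sum_(I : {set 'I_n} | multi idx s \subset I)
    (-1) ^+ (n - #|I|) * vol (cell s finset.setT)).
  by rewrite [RHS]big_mkcond/=; apply: eq_bigr => I _; case: ifP; rewrite ?mulr0.
rewrite -mulr_suml sum_sign_supersets -/(mixed s).
by case: ifP; rewrite ?mul1r ?mul0r.
Qed.

End RegularTriangulation.

(** * Heights with prescribed leading scales *)

Section Heights.
Variables (R : realType) (n : nat) (X : finType).
Variables (idx : X -> 'I_n) (v : X -> 'rV[R]_n).
Implicit Types (s t S : {set X}) (h : X -> R).
Local Notation point := (point idx v).
Local Notation pbasis := (basis point).

Lemma lead_coef_eq (D : {poly R}) k :
  (forall j, (k < j)%N -> D`_j = 0) -> D`_k != 0 -> lead_coef D = D`_k.
Proof.
move=> hj Dk; suff sD : size D = k.+1 by rewrite lead_coefE sD.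
apply/eqP; rewrite eqn_leq; apply/andP; split; first exact/leq_sizeP.
by rewrite ltnNge; apply/negP => sk; move: Dk; rewrite nth_default// eqxx.
Qed.

Lemma poly_near_pinfty (D : {poly R}) : D != 0 ->
  \forall x \near +oo, [/\ D.[x] != 0, (0 < lead_coef D -> 0 < D.[x]) &
                            (lead_coef D < 0 -> D.[x] < 0)].
Proof.
move=> D0.
have pos (E : {poly R}) : 0 < lead_coef E -> \forall x \near +oo, 0 < E.[x].
  move=> l0; have [M MP] := poly_pinfty_gt_lc l0.
  exists M; split; first exact: num_real.
  by move=> x Mx; apply: lt_le_trans l0 (MP x (ltW Mx)).
have : lead_coef D != 0 by rewrite lead_coef_eq0.
rewrite neq_lt => /orP[l0|l0].
  have := pos (- D); rewrite lead_coefN oppr_gt0 => /(_ l0).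
  apply: filterS => x; rewrite hornerN oppr_gt0 => Dx; split=> //.
    by rewrite lt_eqF.
  by move=> l1; have := lt_trans l0 l1; rewrite ltxx.
have := pos D l0; apply: filterS => x Dx; split=> //.
  by rewrite gt_eqF.
by move=> l1; have := lt_trans l0 l1; rewrite ltxx.
Qed.

(* h behaves like (eta, delta, generic) ordered lexicographically. *)
Lemma lexicographic_heights (eta delta : X -> R) : exists2 h, generic idx v h &
  forall s p Y Y0 Y1, pbasis s -> p \notin s ->
    (forall q, q \in s -> dotp Y (point q) = h q) ->
    (forall q, q \in s -> dotp Y0 (point q) = eta q) ->
    [/\ dotp Y0 (point p) < eta p -> dotp Y (point p) < h p,
        eta p < dotp Y0 (point p) -> h p < dotp Y (point p) &
        dotp Y0 (point p) = eta p ->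
        (forall q, q \in s -> dotp Y1 (point q) = delta q) ->
        dotp Y1 (point p) < delta p -> dotp Y (point p) < h p].
Proof.
pose N := #|X|.
(* Heights will be values at a large [H]. [eta] and [delta] sit at the exponents [N.+1] and [N],
   above the private powers of the points, which have distinct exponents below [N] and ensure
   genericity. *)
pose W p : {poly R} := eta p *: 'X^(N.+1) + delta p *: 'X^N + 'X^(enum_rank p).
have WE p k : (W p)`_k = eta p * (k == N.+1)%:R + delta p * (k == N)%:R +
    (k == enum_rank p)%:R by rewrite !coefD !coefZ !coefXn.
have rN (p : X) : (enum_rank p < N)%N by exact: ltn_ord.
have WrE p q : (W q)`_(enum_rank p) = (p == q)%:R.
  rewrite WE (ltn_eqF (rN p)) (ltn_eqF (ltnW (rN p) : (_ < N.+1)%N)) !mulr0 !add0r.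
  by rewrite (inj_eq val_inj) (inj_eq enum_rank_inj).
have /choice[b bP] : forall sp : {set X} * X, exists b, pbasis sp.1 ->
    supported sp.1 b /\ comb point b = point sp.2.
  move=> [s p]; have [[si sp]|nb] := pselect (pbasis s); last by exists (fun=> 0).
  by have [c sc cp] := sp (point p); exists c.
(* The gap at the point [sp.2] between its height and the interpolation of the heights on the basis
   [sp.1], as a polynomial in [H]. *)
pose D sp := W sp.2 - \sum_q b sp q *: W q.
have DE sp k : (D sp)`_k = (W sp.2)`_k - \sum_q b sp q * (W q)`_k.
  by rewrite coefB coef_sum; congr (_ - _); apply: eq_bigr => q _; rewrite coefZ.
(* The private power of [sp.2] survives with coefficient 1, because [b] is supported on a basis that
   omits this point. *)
have D0 sp : pbasis sp.1 -> sp.2 \notin sp.1 -> D sp != 0.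
  move=> bs ps; have [sb _] := bP sp bs; apply/eqP => e.
  have /eqP := DE sp (enum_rank sp.2); rewrite e coef0 big1 => [|q _].
    by rewrite WrE eqxx subr0 eq_sym oner_eq0.
  have [->|qp] := eqVneq q sp.2; first by rewrite sb// mul0r.
  by rewrite WrE eq_sym (negbTE qp) mulr0.
have DH sp H Y : pbasis sp.1 -> (forall q, q \in sp.1 -> dotp Y (point q) = (W q).[H]) ->
    (D sp).[H] = (W sp.2).[H] - dotp Y (point sp.2).
  move=> bs Ys; have [sb bp] := bP sp bs; rewrite hornerD hornerN horner_sum -bp.
  rewrite dotp_comb; congr (_ - _); apply: eq_bigr => q _; rewrite hornerZ.
  by have [/Ys ->//|/sb ->] := boolP (q \in sp.1); rewrite !mul0r.
have Ddot sp (g : X -> R) Y : pbasis sp.1 ->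
    (forall q, q \in sp.1 -> dotp Y (point q) = g q) ->
    \sum_q b sp q * g q = dotp Y (point sp.2).
  move=> bs Ys; have [sb bp] := bP sp bs; rewrite -bp dotp_comb.
  by apply: eq_bigr => q _; have [/Ys ->//|/sb ->] := boolP (q \in sp.1); rewrite !mul0r.
have DN1 sp Y : pbasis sp.1 -> (forall q, q \in sp.1 -> dotp Y (point q) = eta q) ->
    (D sp)`_N.+1 = eta sp.2 - dotp Y (point sp.2).
  move=> bs Ys; rewrite -(Ddot sp eta)// DE.
  have E q : (W q)`_N.+1 = eta q.
    by rewrite WE eqxx mulr1 gtn_eqF// mulr0 addr0 gtn_eqF ?addr0// ltnS ltnW.
  by rewrite E; congr (_ - _); apply: eq_bigr => q _; rewrite E.
have DN sp Y : pbasis sp.1 -> (forall q, q \in sp.1 -> dotp Y (point q) = delta q) ->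
    (D sp)`_N = delta sp.2 - dotp Y (point sp.2).
  move=> bs Ys; rewrite -(Ddot sp delta)// DE.
  have E q : (W q)`_N = delta q.
    by rewrite WE eqxx mulr1 ltn_eqF// mulr0 add0r gtn_eqF ?addr0.
  by rewrite E; congr (_ - _); apply: eq_bigr => q _; rewrite E.
have DN2 sp j : (N.+1 < j)%N -> (D sp)`_j = 0.
  move=> Nj; rewrite DE.
  have E q : (W q)`_j = 0.
    rewrite WE !gtn_eqF ?mulr0 ?addr0//; last exact: ltnW.
    by apply: ltn_trans (rN q) _; exact: ltnW.
  by rewrite E big1 ?subr0// => q _; rewrite E mulr0.
(* Pairs of a basis and a point are finite in number, so one [H] settles all signs. *)
have : \forall H \near +oo, forall sp : {set X} * X, pbasis sp.1 -> sp.2 \notin sp.1 ->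
   [/\ (D sp).[H] != 0, (0 < lead_coef (D sp) -> 0 < (D sp).[H]) &
                            (lead_coef (D sp) < 0 -> (D sp).[H] < 0)].
  apply: filter_forall => sp.
  have [bs|nbs] := pselect (pbasis sp.1); last by apply: nearW => H.
  have [ps|nps] := boolP (sp.2 \in sp.1); first by apply: nearW => H _ //.
  have := poly_near_pinfty (D0 sp bs nps); apply: filterS => H HP _ _; exact: HP.
move=> /filter_ex[H HP].
exists (fun p => (W p).[H]) => [s Y p bs Ys ps|s p Y Y0 Y1 bs ps Ys Y0s].
  have [h1 _ _] := HP (s, p) bs ps.
  by move: h1; rewrite (DH (s, p) H Y bs Ys)/= subr_eq0 eq_sym.
have [h1 h2 h3] := HP (s, p) bs ps.
move: h1 h2 h3; rewrite (DH (s, p) H Y bs Ys)/= => h1 h2 h3.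
have e1 := DN1 (s, p) Y0 bs Y0s; rewrite /= in e1.
split.
- move=> lt; rewrite -subr_gt0; apply: h2.
  by rewrite (lead_coef_eq (DN2 _)) e1 ?subr_gt0// gt_eqF ?subr_gt0.
- move=> lt; rewrite -subr_lt0; apply: h3.
  by rewrite (lead_coef_eq (DN2 _)) e1 ?subr_lt0// lt_eqF ?subr_lt0.
- move=> e Y1s lt; rewrite -subr_gt0; apply: h2.
  have e2 := DN (s, p) Y1 bs Y1s; rewrite /= in e2.
  have z j : (N < j)%N -> (D (s, p))`_j = 0.
    rewrite leq_eqVlt => /orP[/eqP <-|/DN2 //]; by rewrite e1 e subrr.
  by rewrite (lead_coef_eq z) e2 ?subr_gt0// gt_eqF ?subr_gt0.
Qed.

End Heights.

(** * Comparison of mixed volumes through common heights *)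

Definition transverse (R : realType) (n : nat) (a b : 'I_n -> 'rV[R]_n) :=
  row_free (\matrix_(i < n) (b i - a i)).

Section Comparison.
Variables (R : realType) (n : nat) (X : finType).
Variables (idx : X -> 'I_n) (v : X -> 'rV[R]_n).
Implicit Types (s t S : {set X}) (h eta : X -> R).
Local Notation point := (point idx v).
Local Notation pbasis := (basis point).
Local Notation tri := (tri idx v).
Local Notation hull := (hull idx v).

Definition full S := forall i, exists2 p, p \in S & idx p = i.

(** Common heights allow a term by term comparison in [mixed_volume_tri], where additional cells
    contribute nonnegatively. *)
Lemma mv_le S S' h : generic idx v h -> full S -> full S' ->
  (forall s, tri S h s -> mixed idx s -> tri S' h s) ->
  mixed_volume (hull S) <= mixed_volume (hull S').
Proof.
move=> gh fS fS' sub; rewrite !(mixed_volume_tri gh)//.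
rewrite ler_wpM2l ?invr_ge0 ?ler0n// big_mkcond [leRHS]big_mkcond/=.
apply: ler_sum => s _; case: ifP => [/andP[/asboolP ts ms]|_].
  by have /asboolP -> := sub s ts ms; rewrite ms.
by case: ifP => // /andP[/asboolP[_ bs _] _]; exact/ltW/vol_cell_gt0.
Qed.

Lemma mv_lt S S' h s : generic idx v h -> full S -> full S' ->
  (forall t, tri S h t -> mixed idx t -> tri S' h t) ->
  tri S' h s -> mixed idx s -> ~ tri S h s ->
  mixed_volume (hull S) < mixed_volume (hull S').
Proof.
move=> gh fS fS' sub ts ms nts; rewrite !(mixed_volume_tri gh)//.
rewrite ltr_pM2l ?invr_gt0 ?ltr0n ?fact_gt0//.
rewrite [ltRHS](bigD1 s)/=; last by rewrite ms andbT; exact/asboolP.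
apply: (@le_lt_trans _ _ (\sum_(t | (`[< tri S' h t >] && mixed idx t) && (t != s))
   vol (cell idx v t finset.setT))); last first.
  by rewrite ltrDr; apply: vol_cell_gt0; case: ts.
rewrite big_mkcond [leRHS]big_mkcond/=.
apply: ler_sum => t _; case: ifP => [/andP[/asboolP tt mt]|_].
  have /asboolP -> := sub t tt mt; rewrite mt/=.
  by case: eqP tt => // ->.
by case: ifP => // /andP[/andP[/asboolP[_ bt _] _] _]; exact/ltW/vol_cell_gt0.
Qed.

(** On a simplex of [S] the leading scale [eta] is interpolated by the zero functional, and it is
    positive at the new points, which therefore lie above the simplex. *)
Lemma tri_extend S S' h eta : S \subset S' ->
  (forall s p Y Y0, pbasis s -> p \notin s ->
    (forall q, q \in s -> dotp Y (point q) = h q) ->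
    (forall q, q \in s -> dotp Y0 (point q) = eta q) ->
    dotp Y0 (point p) < eta p -> dotp Y (point p) < h p) ->
  (forall p, p \in S -> eta p = 0) -> (forall p, p \in S' -> p \notin S -> 0 < eta p) ->
  forall s, tri S h s -> tri S' h s.
Proof.
move=> SS' lex e0 e1 s [sS bs [Y Ys YS]].
split=> //; first exact: fintype.subset_trans sS SS'.
exists Y => // p pS' ps; have [pS|pS] := boolP (p \in S); first exact: YS.
apply: (lex s p Y 0) => // [q qs|]; rewrite dotpC dotp0r; last exact: e1.
by rewrite e0//; exact: (fintype.subsetP sS).
Qed.

Lemma mv_mono S S' : full S -> S \subset S' ->
  mixed_volume (hull S) <= mixed_volume (hull S').
Proof.
move=> fS SS'.
pose eta p : R := (p \notin S)%:R.
have [h gh lex] := lexicographic_heights idx v eta (fun=> 0).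
apply: (mv_le gh) => //.
  by move=> i; have [p pS pi] := fS i; exists p => //; exact: (fintype.subsetP SS').
move=> s ts _; apply: (tri_extend SS' (eta := eta)) ts.
- by move=> t p Y Y0 bt pt Yt Y0t; have [] := lex t p Y Y0 0 bt pt Yt Y0t.
- by move=> p pS; rewrite /eta pS.
- by move=> p _ pS; rewrite /eta pS.
Qed.

Lemma hull_sub S S' i : (forall p, p \in S -> idx p = i -> hull S' i (v p)) ->
  hull S i `<=` hull S' i.
Proof.
move=> h x /hullP[c [c0 cS c1 ->]].
have /choice[d dP] : forall p, exists d, p \in S -> idx p = i ->
    [/\ forall q, 0 <= d q, forall q, ~~ ((q \in S') && (idx q == i)) -> d q = 0,
     \sum_q d q = 1 & v p = \sum_q d q *: v q].
  move=> p; have [pS|pS] := pselect (p \in S /\ idx p = i).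
    by have /hullP[d dP] := h p pS.1 pS.2; exists d.
  by exists (fun=> 0) => p1 p2; case: pS.
have cP p : c p = 0 \/ (p \in S /\ idx p = i).
  have [/andP[? /eqP ?]|/cS ->] := boolP ((p \in S) && (idx p == i)); by [right|left].
apply/hullP; exists (fun q => \sum_p c p * d p q); split.
- move=> q; apply: sumr_ge0 => p _; have [->|[pS pi]] := cP p; first by rewrite mul0r.
  by rewrite mulr_ge0//; have [] := dP p pS pi.
- move=> q qS; apply: big1 => p _; have [->|[pS pi]] := cP p; first by rewrite mul0r.
  by have [_ -> //] := dP p pS pi; rewrite mulr0.
- rewrite exchange_big/= -[RHS]c1; apply: eq_bigr => p _; rewrite -mulr_sumr.
  have [->|[pS pi]] := cP p; first by rewrite mul0r.
  by have [_ _ -> _] := dP p pS pi; rewrite mulr1.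
- under [RHS]eq_bigr do rewrite scaler_suml.
  rewrite exchange_big/=; apply: eq_bigr => p _.
  have [->|[pS pi]] := cP p.
    by rewrite scale0r big1// => q _; rewrite mul0r scale0r.
  have [_ _ _ {1}->] := dP p pS pi; rewrite scaler_sumr.
  by apply: eq_bigr => q _; rewrite scalerA.
Qed.

Lemma hull_point S p : p \in S -> hull S (idx p) (v p).
Proof.
move=> pS; apply/hullP; exists (fun q => (q == p)%:R); split=> //.
- by move=> q; have [->|//] := eqVneq q p; rewrite pS eqxx.
- by rewrite (bigD1 p)//= eqxx big1 ?addr0// => q /negbTE ->.
- rewrite (bigD1 p)//= eqxx scale1r big1 ?addr0// => q /negbTE ->.
  by rewrite scale0r.
Qed.

Lemma indep_of_dual s : (forall p, p \in s -> exists Y,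
    forall q, q \in s -> dotp Y (point q) = (q == p)%:R) -> indep point s.
Proof.
move=> h c sc c0 p; have [ps|/sc//] := boolP (p \in s).
have [Y YP] := h p ps.
have : dotp Y (comb point c) = 0 by rewrite c0 dotp0r.
rewrite dotp_comb (bigD1 p)//= YP// eqxx mulr1 big1 ?addr0// => q qp.
have [qs|/sc ->] := boolP (q \in s); last by rewrite mul0r.
by rewrite YP// (negbTE qp) mulr0.
Qed.

(** Differences of vertices over one index have zero last block, so a relation between the [n]
    directions lifts to a relation between the points of [s], in which each chosen point occurs
    once. *)
Lemma mixed_transverse s : indep point s -> mixed idx s ->
  exists p q : 'I_n -> X, [/\ forall i, p i \in s, forall i, q i \in s,
    forall i, idx (p i) = i, forall i, idx (q i) = i & transverse (v \o p) (v \o q)].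
Proof.
move=> bs ms.
have /choice[f fP] : forall i, exists pq : X * X,
    [/\ pq.1 \in s, pq.2 \in s, pq.1 != pq.2, idx pq.1 = i & idx pq.2 = i].
  move=> i; have : i \in multi idx s by rewrite (eqP ms) inE.
  by move=> /multiP[p [q h]]; exists (p, q).
exists (fun i => (f i).1), (fun i => (f i).2); split; try by move=> i; case: (fP i).
rewrite /transverse -kermx_eq0; apply/rowV0P => k /sub_kermxP kM.
pose c p := \sum_i k 0 i * ((p == (f i).2)%:R - (p == (f i).1)%:R).
have c0 : forall p, c p = 0.
  apply: bs => [p ps|].
    apply: big1 => i _; have [h1 h2 _ _ _] := fP i.
    have [e|_] := eqVneq p (f i).2; first by rewrite e h2 in ps.
    have [e|_] := eqVneq p (f i).1; first by rewrite e h1 in ps.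
    by rewrite subrr mulr0.
  rewrite /c comb_sum.
  transitivity (row_mx (k *m \matrix_i (v (f i).2 - v (f i).1)) (0 : 'rV[R]_n)).
    rewrite mulmx_sum_row -[RHS]hsubmxK row_mxKl row_mxKr -[LHS]hsubmxK !linear_sum/=.
    have E i : comb point (fun p => k 0 i * ((p == (f i).2)%:R - (p == (f i).1)%:R))
        = row_mx (k 0 i *: (v (f i).2 - v (f i).1)) 0.
      rewrite combZ combB !comb1.
      have [_ _ _ e1 e2] := fP i.
      by rewrite /point e1 e2 opp_row_mx add_row_mx scale_row_mx subrr scaler0.
    congr row_mx; last by apply: big1 => i _; rewrite E row_mxKr.
    by apply: eq_bigr => i _; rewrite E row_mxKl rowK.
  by rewrite kM row_mx0.
apply/rowP => j; rewrite mxE -(c0 (f j).2) /c (bigD1 j)//= eqxx.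
have [_ _ nj _ j2] := fP j.
rewrite eq_sym (negbTE nj) subr0 mulr1 big1 ?addr0// => i ij.
have [_ _ _ i1 i2] := fP i.
have [e|_] := eqVneq (f j).2 (f i).2; first by rewrite -i2 -e j2 eqxx in ij.
have [e|_] := eqVneq (f j).2 (f i).1; first by rewrite -i1 -e j2 eqxx in ij.
by rewrite subrr mulr0.
Qed.

End Comparison.

(** * Labelled configurations built from vertex lists *)

Section Configuration.
Variables (R : realType) (n : nat) (Z : seq 'rV[R]_n).
Implicit Types (T : 'I_n -> seq 'rV[R]_n) (P Q : 'I_n -> set 'rV[R]_n).

(** Vectors are labelled by an index since one vector may be a vertex of several polytopes. The list
    [Z] of all vectors in play makes this a finite type. *)
Definition config := ('I_n * seq_sub Z)%type.
Definition cidx (p : config) : 'I_n := p.1.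
Definition cvec (p : config) : 'rV[R]_n := val p.2.
Definition pick_pts T : {set config} := [set p : config | val p.2 \in T p.1]%SET.

Lemma hull_pick T i : (forall x, x \in T i -> x \in Z) ->
  hull cidx cvec (pick_pts T) i = Defs.conv [set x | x \in T i].
Proof.
move=> TZ; congr Defs.conv; apply/seteqP; split=> x /=.
  by move=> [p [+ <- ->]]; rewrite inE.
by move=> xT; exists (i, SeqSub (TZ x xT)); split=> //; rewrite inE.
Qed.

Lemma full_pick T : (forall i, T i != [::]) -> (forall i x, x \in T i -> x \in Z) ->
  full cidx (pick_pts T).
Proof.
move=> T0 TZ i; case E : (T i) (T0 i) => [//|x t] _.
have xT : x \in T i by rewrite E inE eqxx.
by exists (i, SeqSub (TZ i x xT)) => //; rewrite inE.
Qed.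

Local Notation point := (point cidx cvec).
Implicit Types a b : 'I_n -> 'rV[R]_n.

Definition segs a b : {set config} := pick_pts (fun i => [:: a i; b i]).

(** With [y] dual to the directions, $(y,-\langle y,a_i\rangle)$ reads the coefficient of [b j] and
    $(-y,\langle y,b_i\rangle)$ that of [a j]. For spanning, differences give the first block and
    the points over the [a i] supply the second. *)
Lemma basis_segs a b : transverse a b -> (forall i, a i \in Z) ->
  (forall i, b i \in Z) -> basis point (segs a b).
Proof.
move=> tr aZ bZ; pose M := \matrix_(i < n) (b i - a i).
have uM : M \in unitmx by rewrite -row_free_unit.
have dual j : exists y, forall i, dotp y (b i - a i) = (i == j)%:R.
  exists (col j (invmx M))^T => i.
  have := mulmxV uM; move=> /matrixP/(_ i j); rewrite !mxE => <-.
  by rewrite /dotp; apply: eq_bigr => k _; rewrite !mxE mulrC.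
split.
  apply: indep_of_dual => -[j z]; rewrite inE/= !inE => zj.
  have [y yP] := dual j.
  have [zb|zb] := eqVneq (ssval z) (b j).
    exists (row_mx y (\row_i - dotp y (a i))) => -[i w]; rewrite inE/= !inE => wi.
    rewrite dotp_point row_mxKl row_mxKr mxE /cvec/= -dotpBr.
    have -> : ((i, w) == (j, z)) = (i == j) && (ssval w == ssval z).
      by rewrite xpair_eqE.
    have [->|wb] := eqVneq (ssval w) (b i).
      rewrite yP zb; case: (eqVneq i j) => [->|//]; by rewrite eqxx.
    move: wi; rewrite (negbTE wb) orbF => /eqP wa; rewrite wa subrr dotp0r zb.
    case: (eqVneq i j) => //= ij; subst i.
    case: eqP => // ab; by rewrite wa ab eqxx in wb.
  have za : ssval z = a j by move: zj; rewrite (negbTE zb) orbF => /eqP.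
  exists (row_mx (- y) (\row_i dotp y (b i))) => -[i w]; rewrite inE/= !inE => wi.
  rewrite dotp_point row_mxKl row_mxKr mxE /cvec/= dotpC dotpNr dotpC addrC -dotpBr.
  have -> : ((i, w) == (j, z)) = (i == j) && (ssval w == ssval z).
    by rewrite xpair_eqE.
  have [->|wb] := eqVneq (ssval w) (b i).
    rewrite subrr dotp0r; case: (eqVneq i j) => [->|//] /=.
    by rewrite eq_sym (negbTE zb).
  move: wi; rewrite (negbTE wb) orbF => /eqP ->; rewrite yP za.
  by case: (eqVneq i j) => [->|//]; rewrite eqxx.
have pa i : point (i, SeqSub (aZ i)) = row_mx (a i) (ebasis R i) by [].
have pb i : point (i, SeqSub (bZ i)) = row_mx (b i) (ebasis R i) by [].
have ina i : (i, SeqSub (aZ i)) \in segs a b by rewrite inE/= !inE eqxx.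
have inb i : (i, SeqSub (bZ i)) \in segs a b by rewrite inE/= !inE eqxx orbT.
have spx x : inspan point (segs a b) (row_mx x 0).
  have -> : row_mx x 0 = \sum_i (x *m invmx M) 0 i *: row_mx (b i - a i) (0 : 'rV[R]_n).
    transitivity (\sum_i row_mx ((x *m invmx M) 0 i *: row i M) (0 : 'rV[R]_n)).
      rewrite -{1}[x](mulmxKV uM) mulmx_sum_row -[RHS]hsubmxK.
      rewrite !linear_sum/=; congr row_mx; last by rewrite big1// => i _; rewrite row_mxKr.
      by apply: eq_bigr => i _; rewrite row_mxKl.
    by apply: eq_bigr => i _; rewrite rowK scale_row_mx scaler0.
  apply: inspan_sum => i _; apply: inspanZ.
  have -> : row_mx (b i - a i) 0 = point (i, SeqSub (bZ i)) - point (i, SeqSub (aZ i)).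
    by rewrite pa pb opp_row_mx add_row_mx subrr.
  by apply: inspanD; [|apply: inspanN]; exact: inspan1.
move=> w; rewrite -[w]hsubmxK.
have -> : row_mx (lsubmx w) (rsubmx w) =
    row_mx (lsubmx w - \sum_i rsubmx w 0 i *: a i) 0 +
    \sum_i rsubmx w 0 i *: point (i, SeqSub (aZ i)).
  rewrite -[RHS]hsubmxK !linearD/= !linear_sum/= row_mxKl row_mxKr add0r.
  congr row_mx.
    rewrite [X in _ = _ + X](eq_bigr (fun i => rsubmx w 0 i *: a i)) ?sumrN ?subrK// => i _.
    by rewrite linearZ/= pa row_mxKl.
  apply/rowP => j; rewrite summxE (bigD1 j)//= big1 => [|i ij].
    by rewrite linearZ/= pa row_mxKr addr0 [RHS]mxE [ebasis R j _ _]mxE eqxx mulr1.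
  by rewrite linearZ/= pa row_mxKr !mxE (negbTE ij) mulr0.
apply: inspanD; first exact: spx.
by apply: inspan_sum => i _; apply: inspanZ; exact: inspan1.
Qed.

Lemma transverse_neq a b i : transverse a b -> a i != b i.
Proof.
move=> tr; have uM : (\matrix_(i < n) (b i - a i)) \in unitmx by rewrite -row_free_unit.
apply/eqP => ab; have := mulmxV uM; move=> /matrixP/(_ i i); rewrite !mxE eqxx.
rewrite big1 => [/eqP|k _]; first by rewrite eq_sym oner_eq0.
by rewrite !mxE ab subrr mul0r.
Qed.

Lemma mixed_segs a b : transverse a b -> (forall i, a i \in Z) ->
  (forall i, b i \in Z) -> mixed cidx (segs a b).
Proof.
move=> tr aZ bZ; rewrite /mixed -finset.subTset; apply/fintype.subsetP => i _.
apply/multiP; exists (i, SeqSub (aZ i)), (i, SeqSub (bZ i)); split=> //.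
- by rewrite inE/= !inE eqxx.
- by rewrite inE/= !inE eqxx orbT.
- rewrite xpair_eqE eqxx/=; exact: transverse_neq.
Qed.

End Configuration.

(** * Strict monotonicity and critical directions *)

Section StrictMonotonicity.
Variables (R : realType) (n : nat).
Implicit Types (P Q : 'I_n -> set 'rV[R]_n) (u x : 'rV[R]_n) (a b : 'I_n -> 'rV[R]_n).

Lemma dotp_conv_le (m : nat) (A : set 'rV[R]_m) (u x : 'rV[R]_m) (M : R) :
  (forall y, A y -> dotp u y <= M) -> Defs.conv A x -> dotp u x <= M.
Proof.
move=> AM [k [w [p [w0 w1 pA ->]]]]; rewrite dotp_sumr.
apply: (@le_trans _ _ (\sum_(j < k) w j * M)); last by rewrite -mulr_suml w1 mul1r.
by apply: ler_sum => j _; rewrite dotpZr ler_wpM2l// AM.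
Qed.

Lemma sub_conv (m : nat) (A : set 'rV[R]_m) : A `<=` Defs.conv A.
Proof.
move=> x Ax; exists 1%N, (fun=> 1), (fun=> x); split=> //.
  by rewrite big_ord_recl big_ord0 addr0.
by rewrite big_ord_recl big_ord0 addr0 scale1r.
Qed.

Lemma dotp_le_supp_fun (K : set 'rV[R]_n) u x : polytope K -> K x ->
  dotp u x <= supp_fun K u.
Proof.
move=> [s [_ ->]] Kx; apply: ub_le_sup; last by exists x.
(* The supremum needs some upper bound; the sum over all generators is a crude one. *)
exists (\sum_(y <- s) `|dotp u y|) => _ [y Ky <-]; apply: dotp_conv_le Ky => z zs.
apply: le_trans (ler_norm _) _; move: zs => /=.
elim: s {Kx} => // t s IH; rewrite inE big_cons => /orP[/eqP ->|/IH h].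
  by rewrite lerDl sumr_ge0.
by apply: le_trans h _; rewrite lerDr.
Qed.

Lemma supp_fun_le (K : set 'rV[R]_n) u (M : R) : (exists x, K x) ->
  (forall x, K x -> dotp u x <= M) -> supp_fun K u <= M.
Proof.
move=> [x Kx] KM; apply: ge_sup; first by exists (dotp u x), x.
by move=> _ [y Ky <-]; exact: KM.
Qed.

Lemma polytopes_lists P : (forall i, polytope (P i)) ->
  exists2 s : 'I_n -> seq 'rV[R]_n, (forall i, s i != [::]) &
    forall i, P i = Defs.conv [set x | x \in s i].
Proof.
move=> /choice[s sP]; exists s => i; by have [] := sP i.
Qed.

Lemma transverse_dotp_neq0 a b u : transverse a b -> u != 0 ->
  exists i, dotp u (b i - a i) != 0.
Proof.
move=> tr u0; apply/not_existsP => no.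
have uM : (\matrix_(i < n) (b i - a i)) \in unitmx by rewrite -row_free_unit.
move: u0; apply/negP; rewrite negbK.
have Mu : (\matrix_(i < n) (b i - a i)) *m u^T = 0.
  apply/matrixP => i j; have /negP := no i; rewrite negbK => /eqP zi.
  rewrite !mxE -[RHS]zi dotpC; apply: eq_bigr => k _.
  by rewrite !mxE (ord1 j).
rewrite -trmx_eq0 -(mulKmx uM u^T) Mu mulmx0.
exact: eqxx.
Qed.

Definition critical P Q := exists u a b,
  [/\ u != 0, transverse a b, forall i, Bset (P i) (Q i) u (a i)
    & forall i, Bset (P i) (Q i) u (b i)].

Section Fixed.
Variables (P Q : 'I_n -> set 'rV[R]_n).
Hypotheses (polP : forall i, polytope (P i)) (polQ : forall i, polytope (Q i)).
Hypothesis PQ : forall i, P i `<=` Q i.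

(** The leading functional [Y0] of a mixed simplex that is new in [Q] lies below [eta], which is 0
    on the vertices of [P] and 1 elsewhere. So [Y0] is at most 0 over [P] and at least 0 on the
    simplex: its first block [u] puts the vertices of the simplex into the sets [Bset]. *)
Lemma mv_lt_critical : mixed_volume P < mixed_volume Q -> critical P Q.
Proof.
move=> PltQ.
have [sP sP0 PE] := polytopes_lists polP.
have [sQ sQ0 QE] := polytopes_lists polQ.
pose Z := flatten [seq sP i ++ sQ i | i <- enum 'I_n].
have inZ i x : x \in sP i ++ sQ i -> x \in Z.
  by move=> xi; apply/flattenP; exists (sP i ++ sQ i) => //; apply: map_f; rewrite mem_enum.
have inZP i x : x \in sP i -> x \in Z by move=> xi; apply: (inZ i); rewrite mem_cat xi.
have inZQ i x : x \in sQ i -> x \in Z.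
  by move=> xi; apply: (inZ i); rewrite mem_cat xi orbT.
(* [S2] also contains the vertices of [P]: the configurations become nested, and the hulls remain
   [Q] because [P i] is contained in [Q i]. *)
pose S1 := pick_pts Z sP; pose S2 := pick_pts Z (fun i => sP i ++ sQ i).
pose pt := point (@cidx R n Z) (@cvec R n Z).
have f1 : full (@cidx R n Z) S1 by apply: full_pick.
have S12 : S1 \subset S2.
  by apply/fintype.subsetP => p; rewrite !inE mem_cat => ->.
have f2 : full (@cidx R n Z) S2.
  by move=> i; have [p pS pi] := f1 i; exists p => //; exact: (fintype.subsetP S12).
have h1 : hull (@cidx R n Z) (@cvec R n Z) S1 = P.
  by apply/funext => i; rewrite hull_pick ?PE// => x; exact: inZP.
have h2 : hull (@cidx R n Z) (@cvec R n Z) S2 = Q.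
  apply/funext => i; rewrite QE -(@hull_pick R n Z sQ)//; last exact: inZQ.
  apply/seteqP; split; last first.
    apply: hull_sub => p pS <-; apply: hull_point.
    by move: pS; rewrite !inE mem_cat => ->; rewrite orbT.
  apply: hull_sub => p; rewrite inE mem_cat => pS pi.
  rewrite hull_pick -?QE; last exact: inZQ.
  move: pS => /orP[pS|pS]; last by rewrite QE; apply: sub_conv; rewrite /= -pi.
  by apply: PQ; rewrite PE; apply: sub_conv; rewrite /= -pi.
pose eta p : R := (p \notin S1)%:R.
have [h gh lex] := lexicographic_heights (@cidx R n Z) (@cvec R n Z) eta (fun=> 0).
have [s [ts ms nts]] : exists s, [/\ tri (@cidx R n Z) (@cvec R n Z) S2 h s,
    mixed (@cidx R n Z) s & ~ tri (@cidx R n Z) (@cvec R n Z) S1 h s].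
  apply/not_existsP => no; move: PltQ; rewrite -h1 -h2 ltNge => /negP; apply.
  apply: (mv_le gh) => // s ts ms; apply: contrapT => nts.
  by apply: (no s).
have [sS2 bs [Y Ys YS2]] := ts.
have [p0 p0s p0S1] : exists2 p, p \in s & p \notin S1.
  apply/fintype.subsetPn/negP => sS1; apply: nts; split=> //; exists Y => // p pS ps.
  by apply: YS2 => //; exact: (fintype.subsetP S12).
have [Y0 Y0s] := dual_exists eta bs.1.
have Y0S p : p \in S2 -> dotp Y0 (pt p) <= eta p.
  move=> pS; have [/Y0s ->//|ps] := boolP (p \in s).
  rewrite leNgt; apply/negP => lt.
  have [_ /(_ lt) lt2 _] := lex s p Y Y0 0 bs ps Ys Y0s.
  by have := lt_trans lt2 (YS2 p pS ps); rewrite ltxx.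
pose u := lsubmx Y0; pose z := rsubmx Y0.
have ptE p : dotp Y0 (pt p) = dotp u (cvec p) + z 0 (cidx p) by exact: dotp_point.
have Ple i x : P i x -> dotp u x <= - z 0 i.
  rewrite PE; apply: dotp_conv_le => y yP.
  have pS1 : (i, SeqSub (inZP i y yP)) \in S1 by rewrite inE.
  have := Y0S _ (fintype.subsetP S12 _ pS1); rewrite ptE /eta pS1 /= /cvec/= => ?; lra.
have Pne i : exists x, P i x.
  have [p pS1 pi] := f1 i; exists (cvec p); rewrite -h1 -pi; exact: hull_point.
have Bs p : p \in s -> Bset (P (cidx p)) (Q (cidx p)) u (cvec p).
  move=> ps; split.
    by rewrite -h2; apply: hull_point; exact: (fintype.subsetP sS2).
  apply: supp_fun_le => // x Px; apply: le_trans (Ple _ _ Px) _.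
  have := Y0s p ps; rewrite -/pt ptE /eta => e.
  have : 0 <= (p \notin S1)%:R :> R by [].
  by rewrite -e; lra.
have [p [q [ps qs pi qi tr]]] := mixed_transverse bs.1 ms.
exists u, (fun i => cvec (p i)), (fun i => cvec (q i)); split=> //.
(* If [u] were 0, [Y0] would depend on the index alone, yet it is 1 at [p0] and at most 0 at a
   vertex of [P] over the same index. *)
- apply/eqP => u0; have := Y0s p0 p0s; rewrite -/pt ptE u0 dotpC dotp0r add0r /eta p0S1.
  have [p1 p1S p1i] := f1 (cidx p0).
  have := Y0S p1 (fintype.subsetP S12 _ p1S).
  rewrite ptE u0 dotpC dotp0r add0r /eta p1S p1i /= => + e; rewrite e.
  by rewrite ler10.
- by move=> i; rewrite -{1 2}(pi i); exact: Bs.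
- by move=> i; rewrite -{1 2}(qi i); exact: Bs.
Qed.

Variables a b : 'I_n -> 'rV[R]_n.
Hypotheses (tr : transverse a b) (aQ : forall i, Q i (a i)) (bQ : forall i, Q i (b i)).

Let segs_config : exists Z (S0 S3 : {set config Z}),
  [/\ hull (@cidx R n Z) (@cvec R n Z) S0 = P, hull (@cidx R n Z) (@cvec R n Z) S3 = Q,
    S0 \subset S3, segs Z a b \subset S3 & full (@cidx R n Z) S0 /\
    (forall i, a i \in Z /\ b i \in Z)].
Proof.
have [sP sP0 PE] := polytopes_lists polP.
have [sQ sQ0 QE] := polytopes_lists polQ.
pose T i := sP i ++ sQ i ++ [:: a i; b i].
pose Z := flatten [seq T i | i <- enum 'I_n].
have inZ i x : x \in T i -> x \in Z.
  by move=> xi; apply/flattenP; exists (T i) => //; apply: map_f; rewrite mem_enum.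
have inZP i x : x \in sP i -> x \in Z by move=> xi; apply: (inZ i); rewrite !mem_cat xi.
have inZQ i x : x \in sQ i -> x \in Z.
  by move=> xi; apply: (inZ i); rewrite !mem_cat xi orbT.
exists Z, (pick_pts Z sP), (pick_pts Z T); split.
- by apply/funext => i; rewrite hull_pick ?PE// => x; exact: inZP.
- apply/funext => i; rewrite QE -(@hull_pick R n Z sQ)//; last exact: inZQ.
  apply/seteqP; split; last first.
    apply: hull_sub => p pS <-; apply: hull_point.
    by move: pS; rewrite !inE !mem_cat => ->; rewrite orbT.
  apply: hull_sub => p; rewrite inE !mem_cat !inE => pS pi.
  rewrite hull_pick -?QE; last exact: inZQ.
  rewrite /cidx in pi; rewrite -pi /cvec.
  move: pS => /orP[pS|/orP[pS|/orP[/eqP ->|/eqP ->]]] //.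
    by apply: PQ; rewrite PE; apply: sub_conv.
  by rewrite QE; apply: sub_conv.
- by apply/fintype.subsetP => p; rewrite !inE !mem_cat => ->.
- by apply/fintype.subsetP => p; rewrite !inE !mem_cat !inE => ->; rewrite !orbT.
- split; first exact: full_pick.
  by move=> i; split; apply: (inZ i); rewrite !mem_cat !inE eqxx ?orbT.
Qed.

(** A simplex in a triangulation of [P] would be a basis, on which [Y] cannot vanish; hence there is
    none. Heights that are lowest on the segments make their simplex a mixed cell of [Q]. *)
Lemma mv_lt_annihilated (Y : 'rV[R]_(n + n)) : Y != 0 ->
  (forall i x, P i x -> dotp Y (row_mx x (ebasis R i)) = 0) ->
  mixed_volume P < mixed_volume Q.
Proof.
move=> Y0 YP; have [Z [S0 [S3 [h0 h3 S03 ES3 [f0 abZ]]]]] := segs_config.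
have f3 : full (@cidx R n Z) S3.
  by move=> i; have [p pS pi] := f0 i; exists p => //; exact: (fintype.subsetP S03).
have bE := basis_segs tr (fun i => (abZ i).1) (fun i => (abZ i).2).
have mE := mixed_segs tr (fun i => (abZ i).1) (fun i => (abZ i).2).
pose eta (p : config Z) : R := (p \notin segs Z a b)%:R.
have [h gh lex] := lexicographic_heights (@cidx R n Z) (@cvec R n Z) eta (fun=> 0).
have nt s : ~ tri (@cidx R n Z) (@cvec R n Z) S0 h s.
  move=> [sS bs _]; move: Y0; apply/negP; rewrite negbK; apply/eqP/rowP => j.
  have e w : dotp Y w = 0.
    rewrite -[RHS](dotp0r w) [RHS]dotpC; apply: eq_on_inspan (bs.2 w) => p ps.
    rewrite [RHS]dotpC dotp0r; apply: YP; rewrite -h0.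
    by apply: hull_point; exact: (fintype.subsetP sS).
  have := e (ebasis R j); rewrite /dotp (bigD1 j)//= !mxE eqxx mulr1 big1 ?addr0//.
  by move=> i ij; rewrite mxE eq_sym (negbTE ij) mulr0.
rewrite -h0 -h3; apply: (@mv_lt _ _ _ _ _ S0 S3 h (segs Z a b)) => //.
  by move=> t /nt.
split=> //; have [Y' Y's] := dual_exists h bE.1; exists Y' => // p pS ps.
have [] := lex (segs Z a b) p Y' 0 0 bE ps Y's.
  by move=> q qs; rewrite dotpC dotp0r /eta qs.
by move=> + _ _; apply; rewrite dotpC dotp0r /eta ps.
Qed.

(** [d] measures the position relative to the supporting hyperplanes of the [P i]. The strict step
    is between [S1] and [S2]: the endpoints with [d = 0] must already belong to [S1], since only
    those with [d > 0] are lifted above [P] at the leading scale. *)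
Lemma critical_mv_lt u : u != 0 -> (forall i, supp_fun (P i) u <= dotp u (a i)) ->
  (forall i, supp_fun (P i) u <= dotp u (b i)) ->
  mixed_volume P < mixed_volume Q.
Proof.
move=> u0 ua ub; have [Z [S0 [S3 [h0 h3 S03 ES3 [f0 abZ]]]]] := segs_config.
have bE := basis_segs tr (fun i => (abZ i).1) (fun i => (abZ i).2).
have mE := mixed_segs tr (fun i => (abZ i).1) (fun i => (abZ i).2).
set E := segs Z a b in bE mE ES3 *.
pose d (p : config Z) := dotp u (cvec p) - supp_fun (P (cidx p)) u.
have dE p : p \in E -> 0 <= d p.
  rewrite inE !inE /d /cvec /cidx subr_ge0 => /orP[/eqP ->|/eqP ->]; [exact: ua|exact: ub].
have dP p : p \in S0 -> d p <= 0.
  move=> pS; rewrite subr_le0; apply: dotp_le_supp_fun => //.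
  by rewrite -h0; exact: hull_point.
pose S1 : {set config Z} := (S0 :|: [set p in E | d p == 0])%SET.
pose S2 : {set config Z} := (S0 :|: E)%SET.
have S01 : S0 \subset S1 by exact: finset.subsetUl.
have S12 : S1 \subset S2.
  apply/fintype.subsetP => p; rewrite !inE => /orP[->//|/andP[-> _]]; by rewrite orbT.
have S23 : S2 \subset S3 by rewrite finset.subUset S03.
have fS (S : {set config Z}) : S0 \subset S -> full (@cidx R n Z) S.
  move=> S0S i; have [p pS pi] := f0 i; exists p => //; exact: (fintype.subsetP S0S).
have f1 := fS _ S01; have f2 := fS _ (fintype.subset_trans S01 S12).
rewrite -h0 -h3; apply: le_lt_trans (mv_mono _ f0 S01) _.
apply: lt_le_trans (mv_mono _ f2 S23).
(* The leading functional through the segments is [d] itself, which is nonpositive on [P]; where it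
   vanishes, [delta] lifts the points outside [E] above the simplex. *)
pose eta p : R := if p \in E then d p else 0.
pose delta p : R := (p \notin E)%:R.
have [h gh lex] := lexicographic_heights (@cidx R n Z) (@cvec R n Z) eta delta.
have [p0 p0E p0d] : exists2 p, p \in E & 0 < d p.
  apply/not_exists2P => no.
  have z p : p \in E -> d p = 0.
    by move=> pE; apply/eqP; rewrite eq_le dE// andbT leNgt; apply/negP; case: (no p).
  have zi i : dotp u (b i - a i) = 0.
    have [aZ bZ] := abZ i.
    have := z (i, SeqSub aZ); rewrite inE/= !inE eqxx => /(_ isT).
    have := z (i, SeqSub bZ); rewrite inE/= !inE eqxx orbT => /(_ isT).
    by rewrite /d /cvec /cidx/= dotpBr; lra.
  by have [i] := transverse_dotp_neq0 tr u0; rewrite zi eqxx.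
apply: (@mv_lt _ _ _ _ _ S1 S2 h E) => //.
- move=> t tt _; apply: (tri_extend S12 (eta := eta)) tt.
  + by move=> s p Y Y0 bs ps Ys Y0s; have [] := lex s p Y Y0 0 bs ps Ys Y0s.
  + move=> p; rewrite /eta inE => /orP[pS0|]; last by rewrite inE => /andP[-> /eqP].
    case: ifP => // pE; apply/eqP; by rewrite eq_le dP// dE.
  + move=> p pS2 pS1; have pE : p \in E.
      by move: pS2 pS1; rewrite !inE => /orP[->|->].
    rewrite /eta pE lt_def dE// andbT; apply: contra pS1 => d0.
    by rewrite inE inE pE d0 orbT.
- split=> //; first exact: finset.subsetUr.
  have [Y YE] := dual_exists h bE.1; exists Y => // p pS pE.
  have pS0 : p \in S0 by move: pS; rewrite inE (negbTE pE) orbF.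
  pose Y0 : 'rV[R]_(n + n) := row_mx u (\row_i - supp_fun (P i) u).
  have Y0E q : dotp Y0 (point (@cidx R n Z) (@cvec R n Z) q) = d q.
    by rewrite dotp_point row_mxKl row_mxKr mxE.
  have [|l1 _ l3] := lex E p Y Y0 0 bE pE YE.
    by move=> q qE; rewrite Y0E /eta qE.
  have := dP p pS0; rewrite le_eqVlt => /orP[/eqP d0|d0].
    apply: l3; rewrite ?Y0E /eta ?(negbTE pE)//.
      by move=> q qE; rewrite dotpC dotp0r /delta qE.
    by rewrite dotpC dotp0r /delta pE.
  by apply: l1; rewrite Y0E /eta (negbTE pE).
- move=> [ES1 _ _]; move: (fintype.subsetP ES1 _ p0E).
  rewrite inE => /orP[/dP|]; first by rewrite leNgt p0d.
  by rewrite inE => /andP[_ /eqP d0]; rewrite d0 ltxx in p0d.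
Qed.

End Fixed.
End StrictMonotonicity.

(** * Rado's theorem and essential collections *)

Section Rado.

(** Induction on the total size. If neither [x] nor [y] can be removed from a list, there are
    violating sets [I1] and [J1], and modularity of dimension for the spans [A] and [B] contradicts
    the rank condition on the union and the intersection. *)
Lemma rado_transversal (F : fieldType) (V : vectType F) (n : nat) (D : 'I_n -> seq V) :
  (forall I : {set 'I_n}, (#|I| <= \dim (\sum_(i in I) <<D i>>))%N) ->
  exists2 d : 'I_n -> V, (forall i, d i \in D i) & free [seq d i | i <- enum 'I_n].
Proof.
have [k] := ubnP (\sum_i size (D i))%N; elim: k D => // k IH D; rewrite ltnS => Dk hall.
have [big|small] := pselect (exists i, (1 < size (D i))%N); last first.
  have sz i : exists x, D i = [:: x].
    have := hall [set i]%SET; rewrite cards1 big_set1.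
    have /negP : ~ (1 < size (D i))%N by move=> h; apply: small; exists i.
    rewrite -leqNgt.
    case: (D i) => [|x [|y t]] //; last by exists x.
    by rewrite span_nil dimv0.
  have /choice[d dP] := sz.
  exists d => [i|]; first by rewrite dP inE.
  rewrite /free eqn_leq dim_span size_map size_enum_ord/=.
  have := hall finset.setT; rewrite cardsT card_ord => h; apply: (leq_trans h).
  apply/eq_leq; congr (\dim _); rewrite span_def big_map big_enum/=.
  by apply: eq_big => [i|i _]; rewrite ?inE// dP span_seq1.
have [i0] := big; case E : (D i0) => [|x [|y t]] // _.
pose D1 z i := if i == i0 then z :: t else D i.
have sub z : z \in [:: x; y] -> forall i w, w \in D1 z i -> w \in D i.
  move=> zxy i w; rewrite /D1; case: eqP => [->|//]; rewrite E.
  move: zxy; rewrite !inE => /orP[/eqP ->|/eqP ->] /orP[/eqP ->|->];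
    by rewrite ?eqxx ?orbT.
have small z : (\sum_i size (D1 z i) < k)%N.
  apply: leq_trans Dk; rewrite (bigD1 i0)//= [X in (_ < X)%N](bigD1 i0)//= /D1 eqxx E/=.
  rewrite -addSn leq_add2l (eq_bigr (fun i => size (D i)))// => i /negbTE -> //.
have red z : z \in [:: x; y] ->
    (forall I : {set 'I_n}, (#|I| <= \dim (\sum_(i in I) <<D1 z i>>))%N) ->
    exists2 d : 'I_n -> V, (forall i, d i \in D i) & free [seq d i | i <- enum 'I_n].
  move=> zxy hz; have [d dD fd] := IH (D1 z) (small z) hz; exists d => // i.
  exact: sub zxy _ _ (dD i).
have [hx|/existsNP[I1 nI1]] := pselect (forall I : {set 'I_n},
  (#|I| <= \dim (\sum_(i in I) <<D1 x i>>))%N); first by apply: (red x); rewrite ?inE ?eqxx.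
have [hy|/existsNP[J1 nJ1]] := pselect (forall I : {set 'I_n},
  (#|I| <= \dim (\sum_(i in I) <<D1 y i>>))%N).
  by apply: (red y); rewrite ?inE ?eqxx ?orbT.
exfalso.
pose W (I : {set 'I_n}) : {vspace V} := (\sum_(i in I) <<D i>>)%VS.
have split_ z (I : {set 'I_n}) : ~ (#|I| <= \dim (\sum_(i in I) <<D1 z i>>))%N ->
    i0 \in I /\ (\dim (<<z :: t>> + W (I :\ i0)) <= #|I :\ i0|)%N.
  move=> /negP; rewrite -ltnNge => nI.
  have i0I : i0 \in I.
    apply/negPn/negP => ni; move: nI; rewrite ltnNge => /negP; apply.
    rewrite (eq_bigr (fun i => <<D i>>%VS)) ?hall// => i iI.
    by rewrite /D1; case: eqP iI ni => // -> ->.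
  split=> //; move: nI; rewrite (cardsD1 i0) i0I add1n ltnS.
  rewrite (big_setD1 i0)//= {1}/D1 eqxx; congr (\dim (_ + _) <= _)%N.
  by apply: eq_bigr => i; rewrite !inE /D1 => /andP[/negbTE ->].
have [i0I dI] := split_ x I1 nI1; have [i0J dJ] := split_ y J1 nJ1.
set I := I1 :\ i0 in dI; set J := J1 :\ i0 in dJ.
set A := (<<x :: t>> + W I)%VS in dI; set B := (<<y :: t>> + W J)%VS in dJ.
have i0IJ : i0 \notin I :|: J by rewrite !inE eqxx.
have Wsub (I' J' : {set 'I_n}) : I' \subset J' -> (W I' <= W J')%VS.
  move=> IJ; apply/subv_sumP => i iI; apply: (sumv_sup i) => //.
  exact: (fintype.subsetP IJ).
(* The sum [A + B] contains both [x] and [y], so the rank condition applies with [i0] restored; this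
   is the extra 1 that breaks the count. *)
have h1 : (#|I :|: J|.+1 <= \dim (A + B))%N.
  have := hall (i0 |: (I :|: J)); rewrite cardsU1 i0IJ add1n => /leq_trans; apply.
  apply: dimvS; rewrite big_setU1//= E subv_add; apply/andP; split.
    apply/span_subvP => w; rewrite !inE => wE.
    have xA : x \in (A + B)%VS.
      apply: (subvP (addvSl _ _)); apply: (subvP (addvSl _ _)).
      by apply: memv_span; rewrite inE eqxx.
    have yB : y \in (A + B)%VS.
      apply: (subvP (addvSr _ _)); apply: (subvP (addvSl _ _)).
      by apply: memv_span; rewrite inE eqxx.
    case/or3P: wE => [/eqP ->|/eqP ->|wt] //.
    apply: (subvP (addvSl _ _)); apply: (subvP (addvSl _ _)).
    by apply: memv_span; rewrite inE wt orbT.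
  apply/subv_sumP => i; rewrite inE => /orP[iI|iJ].
    apply: subv_trans (addvSl _ _); apply: subv_trans (addvSr _ _).
    exact: (sumv_sup i).
  apply: subv_trans (addvSr _ _); apply: subv_trans (addvSr _ _).
  exact: (sumv_sup i).
have h2 : (#|I :&: J| <= \dim (A :&: B))%N.
  apply: leq_trans (hall (I :&: J)) _; apply: dimvS; rewrite subv_cap.
  by apply/andP; split; apply: subv_trans (addvSr _ _); apply: Wsub;
    [exact: finset.subsetIl | exact: finset.subsetIr].
have := leq_add h1 h2; rewrite dimv_sum_cap => /leq_trans/(_ (leq_add dI dJ)).
by rewrite addSn cardsUI ltnn.
Qed.

Variable R : realType.

Lemma free_rows (k m : nat) (M : 'M[R]_(k, m)) :
  free [seq row j M | j <- enum 'I_k] = row_free M.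
Proof.
have sz : size [seq row j M | j <- enum 'I_k] = k by rewrite size_map size_enum_ord.
have nthE (j : 'I_k) : [seq row j M | j <- enum 'I_k]`_j = row j M.
  by rewrite (nth_map j) ?size_enum_ord// nth_ord_enum.
pose X := @Tuple k _ [seq row j M | j <- enum 'I_k] (introT eqP sz).
rewrite -kermx_eq0; apply/(@freeP _ _ k X)/rowV0P => h.
  move=> u /sub_kermxP; rewrite mulmx_sum_row => uM; apply/rowP => j; rewrite mxE.
  apply: (h (fun j => u 0 j)); rewrite -[RHS]uM; apply: eq_bigr => i _.
  by rewrite nthE.
move=> c c0 j; have /rowP/(_ j) : \row_i c i = 0; last by rewrite !mxE.
apply: h; apply/sub_kermxP; rewrite mulmx_sum_row -[RHS]c0.
by apply: eq_bigr => i _; rewrite mxE nthE.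
Qed.

Variables (n : nat) (K : 'I_n -> set 'rV[R]_n).

(** The points are a vertex of the sum of the segments and its neighbours along the edges with index
    in [I]. *)
Lemma transverse_essential (a b : 'I_n -> 'rV[R]_n) : transverse a b ->
  (forall i, K i (a i)) -> (forall i, K i (b i)) -> essential K.
Proof.
move=> /row_freeP[B MB] aK bK I _.
pose M := \matrix_(i < n) (b i - a i).
pose f (j : 'I_#|I|) : 'I_n := enum_val j.
exists (\sum_(i in I) a i), (rowsub f M); split.
- by exists a.
- apply/row_freeP; exists (B *m (rowsub f 1%:M)^T).
  rewrite mulmxA mul_rowsub_mx MB; apply/matrixP => i j; rewrite !mxE.
  rewrite (bigD1 (f i))//= !mxE eqxx mul1r big1 ?addr0 => [|l li].
    by rewrite eq_sym (inj_eq enum_val_inj).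
  by rewrite !mxE eq_sym (negbTE li) mul0r.
- move=> j; exists (fun i => if i == f j then b i else a i); split.
    by move=> i _; case: ifP.
  rewrite (bigD1 (f j)) ?enum_valP//= [RHS](bigD1 (f j)) ?enum_valP//= eqxx.
  rewrite [in RHS](eq_bigr a) => [|i /andP[_ /negbTE ->]//].
  by rewrite row_rowsub rowK addrAC (addrC (a _)) subrK.
Qed.

(** Each row of [M] is a sum of differences of points of the [K i], so finitely many differences
    meet the rank condition for a given [I]. Pooling these lists over all [I] prepares Rado's
    theorem. *)
Lemma essential_transverse : essential K -> exists a b : 'I_n -> 'rV[R]_n,
  [/\ transverse a b, forall i, K i (a i) & forall i, K i (b i)].
Proof.
move=> ess.
have /choice[E EP] : forall I : {set 'I_n}, exists E : 'I_n -> seq 'rV[R]_n,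
    (forall i d, d \in E i -> exists a b, [/\ K i a, K i b & d = b - a]) /\
    (#|I| <= \dim (\sum_(i in I) <<E i>>))%N.
  move=> I; have [|x0 [M [[f [fK x0E]] fM MK]]] := ess I.
    by rewrite -[X in (_ <= X)%N]card_ord max_card.
  have /choice[g gP] := MK.
  exists (fun i => if i \in I then [seq g j i - f i | j <- enum 'I_#|I|] else [::]).
  split=> [i d|].
    case: ifP => // iI /mapP[j _ ->]; exists (f i), (g j i); split=> //; first exact: fK.
    by have [h _] := gP j; exact: h.
  have : free [seq row j M | j <- enum 'I_#|I|] by rewrite free_rows.
  rewrite /free size_map size_enum_ord => /eqP {1}<-; apply: dimvS.
  apply/span_subvP => _ /mapP[j _ ->].
  have -> : row j M = \sum_(i in I) (g j i - f i).
    by rewrite sumrB -x0E; have [_ <-] := gP j; rewrite addrC addKr.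
  apply: memv_sumr => i iI; rewrite iI; apply: memv_span.
  by apply: map_f; rewrite mem_enum.
pose D i := flatten [seq E J i | J <- enum {: {set 'I_n}}].
have ED (I : {set 'I_n}) i : {subset E I i <= D i}.
  move=> x xE; apply/flattenP; exists (E I i) => //; apply: map_f.
  by rewrite mem_enum.
have DE i d : d \in D i -> exists a b, [/\ K i a, K i b & d = b - a].
  by move=> /flattenP[_ /mapP[I _ ->]]; have [h _] := EP I; exact: h.
have [|d dD fd] := @rado_transversal R 'rV[R]_n n D.
  move=> I; have [_ h] := EP I; apply: leq_trans h _; apply: dimvS.
  apply/subv_sumP => i iI; apply: (sumv_sup i) => //; apply: sub_span; exact: ED.
have /choice[a /choice[b abP]] : forall i, exists a b, [/\ K i a, K i b & d i = b - a].
  by move=> i; apply: DE.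
exists a, b; split; try by move=> i; case: (abP i).
rewrite /transverse -free_rows.
suff <- : [seq d i | i <- enum 'I_n] = [seq row j (\matrix_(i < n) (b i - a i)) | j <- enum 'I_n].
  by [].
by apply: eq_map => i; rewrite rowK; case: (abP i).
Qed.

End Rado.

(** * Farkas' lemma *)

Section Farkas.
Variables (R : realType) (m : nat).
Implicit Types (w a Y : 'rV[R]_m) (l : seq 'rV[R]_m).

(** The conic hull, by recursion on the generators to match the induction in [farkas_seq]. *)
Fixpoint cone l w : Prop :=
  if l is a :: l' then exists2 t : R, 0 <= t & cone l' (w - t *: a) else w = 0.

Lemma dotp_gt0 w : w != 0 -> 0 < dotp w w.
Proof.
move=> w0; rewrite lt_def sumr_ge0 ?andbT => [|i _]; last by rewrite -expr2 sqr_ge0.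
apply: contra w0; rewrite psumr_eq0 => [/allP h|i _]; last by rewrite -expr2 sqr_ge0.
apply/eqP/rowP => i; rewrite mxE; have := h i (mem_index_enum _).
by rewrite mulf_eq0 orbb => /eqP.
Qed.

Lemma dotpZl (k : R) (u w : 'rV[R]_m) : dotp (k *: u) w = k * dotp u w.
Proof. by rewrite dotpC dotpZr (dotpC w). Qed.

Lemma dotpBl (u v w : 'rV[R]_m) : dotp (u - v) w = dotp u w - dotp v w.
Proof. by rewrite dotpC dotpBr !(dotpC w). Qed.

(* Induction on the generators: if the separating Y found for l fails on the
   new generator a, project everything along a onto the kernel of Y. *)
Lemma farkas_seq l w : cone l w \/
  exists Y, (forall a, a \in l -> dotp Y a <= 0) /\ 0 < dotp Y w.
Proof.
have [k] := ubnP (size l); elim: k l w => // k IH [|a l] w /=.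
  move=> _; have [->|w0] := eqVneq w 0; first by left.
  by right; exists w; split=> //; exact: dotp_gt0.
rewrite ltnS => lk.
have [cl|[Y [Yl Yw]]] := IH l w lk.
  by left; exists 0 => //; rewrite scale0r subr0.
have [Ya|Ya] := leP (dotp Y a) 0.
  right; exists Y; split=> // x; rewrite inE => /orP[/eqP ->//|]; exact: Yl.
pose pr x := x - (dotp Y x / dotp Y a) *: a.
have [|cl|[Z [Zl Zw]]] := IH [seq pr x | x <- l] (pr w).
- by rewrite size_map.
(* Undoing the projections adds only nonnegative multiples of [a], because [Y] is nonpositive on [l]
   and positive at [a] and [w]. *)
- left; have : exists2 s : R, 0 <= s & cone l (pr w - s *: a).
    elim: l (pr w) cl Yl {lk} => [|x l IHl] z /=.
      by move=> -> _; exists 0; rewrite // scale0r subr0.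
    move=> [t t0 ct] Yl; have [|s s0 cs] := IHl _ ct.
      by move=> y yl; apply: Yl; rewrite inE yl orbT.
    exists (s - t * (dotp Y x / dotp Y a)).
      rewrite addr_ge0// -mulrN mulr_ge0// -mulNr divr_ge0 ?(ltW Ya)// oppr_ge0.
      by apply: Yl; rewrite inE eqxx.
    exists t => //; move: cs; congr (cone _ _).
    by apply/rowP => i; rewrite !mxE; ring.
  move=> [s s0 cs]; exists (dotp Y w / dotp Y a + s).
    by rewrite addr_ge0// divr_ge0// ltW.
  by move: cs; rewrite /pr scalerDl opprD addrA.
- right; pose Z' := Z - (dotp Z a / dotp Y a) *: Y.
  have E x : dotp Z' x = dotp Z (pr x).
    by rewrite /Z' /pr dotpBl dotpBr dotpZl dotpZr; ring.
  have Z'a : dotp Z' a = 0 by rewrite E /pr divff ?gt_eqF// scale1r subrr dotp0r.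
  exists Z'; split; last by rewrite E.
  move=> x; rewrite inE => /orP[/eqP ->|xl]; first by rewrite Z'a.
  by rewrite E; apply: Zl; apply: map_f.
Qed.

Lemma farkas (X : finType) (A : X -> 'rV[R]_m) w :
  (exists2 c, (forall p, 0 <= c p) & comb A c = w) \/
  exists Y, (forall p, dotp Y (A p) <= 0) /\ 0 < dotp Y w.
Proof.
have [cw|[Y [YA Yw]]] := farkas_seq [seq A p | p <- enum X] w; last first.
  by right; exists Y; split=> // p; apply: YA; apply: map_f; rewrite mem_enum.
left; elim: (enum X) w cw => [|p s IH] w /=.
  by move=> ->; exists (fun=> 0) => //; rewrite /comb big1// => q _; rewrite scale0r.
move=> [t t0 /IH[c c0 cw]]; exists (fun q => c q + t * (q == p)%:R).
  by move=> q; rewrite addr_ge0// mulr_ge0.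
by rewrite combD combZ comb1 cw subrK.
Qed.

End Farkas.

(** * Convex hulls and closures *)

Section ConvexHull.
Variables (R : realType) (m : nat).
Implicit Types (A B : set 'rV[R]_m) (x y z : 'rV[R]_m).

Lemma conv_fin A (F : finType) (w : F -> R) (p : F -> 'rV[R]_m) :
  (forall f, 0 <= w f) -> \sum_f w f = 1 -> (forall f, A (p f)) ->
  Defs.conv A (\sum_f w f *: p f).
Proof.
move=> w0 w1 pA; exists #|F|, (fun j => w (enum_val j)), (fun j => p (enum_val j)).
split=> //; first by rewrite -[RHS]w1 [RHS](reindex (@enum_val F F))//=; exact/onW_bij/enum_val_bij.
by rewrite (reindex (@enum_val F F))//=; exact/onW_bij/enum_val_bij.
Qed.

(** Weights multiply, and the double combination is summed over dependent pairs. *)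
Lemma conv_sub A B : A `<=` Defs.conv B -> Defs.conv A `<=` Defs.conv B.
Proof.
move=> AB x [k [w [p [w0 w1 pA ->]]]].
have /choice[q qP] : forall j, exists q : {k' : nat & ('I_k' -> R) * ('I_k' -> 'rV[R]_m)}%type,
    [/\ forall i, 0 <= (tagged q).1 i, \sum_i (tagged q).1 i = 1,
      forall i, B ((tagged q).2 i) & p j = \sum_i (tagged q).1 i *: (tagged q).2 i].
  by move=> j; have [k' [w' [p' h]]] := AB _ (pA j); 
  exists (existT _ k' (w', p')).
pose l j := tag (q j); pose wl j := (tagged (q j)).1; pose pl j := (tagged (q j)).2.
have plP j : [/\ forall i, 0 <= wl j i, \sum_i wl j i = 1, forall i, B (pl j i)
  & p j = \sum_i wl j i *: pl j i] := qP j.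
have -> : \sum_(j < k) w j *: p j = \sum_(t : {j : 'I_k & 'I_(l j)})
    (w (tag t) * wl (tag t) (tagged t)) *: pl (tag t) (tagged t).
  rewrite -(@sig_big_dep _ _ _ _ _ predT (fun _ => predT)
    (fun j i => (w j * wl j i) *: pl j i))/=.
  apply: eq_bigr => j _; have [_ _ _ {1}->] := plP j.
  by rewrite scaler_sumr; apply: eq_bigr => i _; rewrite scalerA.
apply: conv_fin.
- by move=> t; rewrite mulr_ge0//; have [] := plP (tag t).
- rewrite -(@sig_big_dep _ _ _ _ _ predT (fun _ => predT) (fun j i => w j * wl j i))/=.
  rewrite -[RHS]w1; apply: eq_bigr => j _; rewrite -mulr_sumr.
  by have [_ -> _ _] := plP j; rewrite mulr1.
- by move=> t; have [_ _ h _] := plP (tag t).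
Qed.

Lemma conv_segment A x y (t : R) : 0 <= t <= 1 -> Defs.conv A x -> Defs.conv A y ->
  Defs.conv A (x + t *: (y - x)).
Proof.
move=> /andP[t0 t1] Ax Ay; apply: (conv_sub (@subset_refl _ (Defs.conv A))).
have -> : x + t *: (y - x) =
    \sum_(b : bool) (if b then t else 1 - t) *: (if b then y else x).
  rewrite big_bool/= scalerBl scale1r scalerBr addrCA; congr (_ + _).
apply: conv_fin => [[]|| []] //; first by rewrite subr_ge0.
by rewrite big_bool/= addrC subrK.
Qed.

Lemma closure_rowP A z : closure A z <->
  forall e : R, 0 < e -> exists2 y, A y & forall j, `|y 0 j - z 0 j| < e.
Proof.
split=> [cl e e0|h B /nbhs_ballP[e /= e0 eB]].
  have [|y [Ay zy]] := cl (ball z e); first exact: nbhsx_ballx.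
  by exists y => // j; have [_ /(_ 0 j)] := zy; rewrite /ball/= distrC.
have [y Ay yz] := h e e0; exists y; split=> //; apply: eB; split=> // i j.
by rewrite (ord1 i) /ball/= distrC.
Qed.

End ConvexHull.

(** * Cayley polytopes as sections of cones *)

Section CayleyPolytope.
Variables (R : realType) (n : nat) (X : finType).
Variables (idx : X -> 'I_n) (v : X -> 'rV[R]_n).
Implicit Types (S : {set X}) (z : 'rV[R]_(n + n)) (c : X -> R).
Local Notation point := (point idx v).
Local Notation hull := (hull idx v).

Lemma cayley_hull S :
  cayley (hull S) = Defs.conv [set z | exists2 p, p \in S & z = point p].
Proof.
apply/seteqP; split; apply: conv_sub => z.
  move=> [i [x /hullP[c [c0 cS c1 ->]] ->]]; apply/convP; exists c; split=> //.
    by move=> p pS; apply: cS; rewrite (negbTE pS).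
  rewrite -/(comb point c) comb_point; congr row_mx; apply/rowP => j; rewrite !mxE.
  have [<-|ij] := eqVneq i j.
    rewrite -[LHS]c1 big_mkcond/= [RHS]big_mkcond/=; apply: eq_bigr => p _.
    by case: ifPn => // pi; rewrite cS// (negbTE pi) andbF.
  rewrite big1// => p /eqP pj; apply: cS; rewrite pj eq_sym (negbTE ij) andbF//.
by move=> [p pS ->]; apply: sub_conv; exists (idx p), (v p) => //; exact: hull_point.
Qed.

(** [total] is 1 on every lifted point, so the equation on [z] is the normalisation of the weights
    and membership reduces to a cone. *)
Lemma cayleyP S z : cayley (hull S) z <-> dotp (total R n) z = 1 /\
  exists c, [/\ forall p, 0 <= c p, supported S c & comb point c = z].
Proof.
have tot c : dotp (total R n) (comb point c) = \sum_p c p.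
  by rewrite dotp_comb; apply: eq_bigr => p _; rewrite total_point mulr1.
rewrite cayley_hull convP; split=> [[c [c0 cS c1 ->]]|[z1 [c [c0 cS cz]]]].
  by rewrite -/(comb point c) tot; split=> //; exists c.
by exists c; split=> //; rewrite -tot cz.
Qed.

End CayleyPolytope.

(** * From a critical direction to an outer simplex *)

Section SimplexCriterion.
Variables (R : realType) (n : nat).
Implicit Types (P Q E : 'I_n -> set 'rV[R]_n) (z : 'rV[R]_(n + n)).

Lemma cayley_total P z : cayley P z -> dotp (total R n) z = 1.
Proof.
move=> [k [w [p [w0 w1 pP ->]]]]; rewrite dotp_sumr -[RHS]w1; apply: eq_bigr => j _.
have [i [x _ ->]] := pP j.
by rewrite dotpZr dotp_row_mx row_mxKl row_mxKr dotpC dotp0r dotp_ebasis mxE add0r mulr1.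
Qed.

Lemma cayley_mono P Q : (forall i, P i `<=` Q i) -> cayley P `<=` cayley Q.
Proof.
move=> PQ; apply: conv_sub => z [i [x Px ->]]; apply: sub_conv.
by exists i, x => //; exact: PQ.
Qed.

(** Over [ebasis R i] the coefficients at every other index sum to 0, so only vertices of [Q i]
    contribute. *)
Lemma cayley_fiber Q i x : (forall i, polytope (Q i)) ->
  cayley Q (row_mx x (ebasis R i)) -> Q i x.
Proof.
move=> polQ; have [sQ _ QE] := polytopes_lists polQ.
pose Z := flatten [seq sQ i | i <- enum 'I_n].
have inZ j y : y \in sQ j -> y \in Z.
  by move=> yj; apply/flattenP; exists (sQ j) => //; apply: map_f; rewrite mem_enum.
have <- : hull (@cidx R n Z) (@cvec R n Z) (pick_pts Z sQ) = Q.
  by apply/funext => j; rewrite hull_pick ?QE// => y; exact: inZ.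
move=> /cayleyP[_ [c [c0 cS]]]; rewrite comb_point => /eq_row_mx[<- e].
have ce j : \sum_(p | cidx p == j) c p = (i == j)%:R.
  by move/rowP: e => /(_ j); rewrite !mxE.
have c_out p : cidx p != i -> c p = 0.
  move=> pi; have := ce (cidx p); rewrite eq_sym (negbTE pi) => /eqP.
  by rewrite psumr_eq0// => /allP/(_ p (mem_index_enum _)); rewrite eqxx => /eqP.
apply/hullP; exists c; split=> //.
  by move=> p; rewrite negb_and => /orP[/cS|/c_out].
transitivity ((i == i)%:R : R); last by rewrite eqxx.
rewrite -ce [RHS]big_mkcond/=.
by apply: eq_bigr => p _; case: ifPn => // /c_out.
Qed.

Lemma closure_dotp_le (m : nat) (A : set 'rV[R]_m) (Y y : 'rV[R]_m) (M : R) :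
  (forall x, A x -> dotp Y x <= M) -> closure A y -> dotp Y y <= M.
Proof.
move=> AM /closure_rowP cl; rewrite leNgt; apply/negP => lt.
pose B := \sum_j `|Y 0 j| + 1.
have B0 : 0 < B by rewrite ltr_wpDl// sumr_ge0.
have [|x Ax xy] := cl ((dotp Y y - M) / B); first by rewrite divr_gt0// subr_gt0.
have : dotp Y y - dotp Y x < dotp Y y - M; last by have := AM _ Ax; lra.
rewrite -dotpBr; apply: le_lt_trans (ler_norm _) _.
apply: le_lt_trans (ler_norm_sum _ _ _) _.
apply: (@le_lt_trans _ _ (\sum_j `|Y 0 j| * ((dotp Y y - M) / B))).
  apply: ler_sum => j _; rewrite normrM ler_wpM2l//.
  by have := xy j; rewrite !mxE distrC => /ltW.
rewrite -mulr_suml mulrCA -[ltRHS]mulr1 ltr_pM2l ?subr_gt0//.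
by rewrite ltr_pdivrMr// mul1r /B ltrDl.
Qed.

(** By Farkas' lemma a point outside the cone is cut off by a closed half-space containing the
    polytope, hence its closure. *)
Lemma cayley_closed Q z : (forall i, polytope (Q i)) -> dotp (total R n) z = 1 ->
  closure (cayley Q) z -> cayley Q z.
Proof.
move=> polQ z1 cl; have [sQ _ QE] := polytopes_lists polQ.
pose Z := flatten [seq sQ i | i <- enum 'I_n].
have inZ j y : y \in sQ j -> y \in Z.
  by move=> yj; apply/flattenP; exists (sQ j) => //; apply: map_f; rewrite mem_enum.
pose S := pick_pts Z sQ; pose pt := point (@cidx R n Z) (@cvec R n Z).
have hQ : hull (@cidx R n Z) (@cvec R n Z) S = Q.
  by apply/funext => j; rewrite hull_pick ?QE// => y; exact: inZ.
have [[c c0 cz]|[Y [YS Yz]]] := farkas (fun p => if p \in S then pt p else 0) z.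
  rewrite -hQ; apply/cayleyP; split=> //.
  exists (fun p => if p \in S then c p else 0); split.
  - by move=> p; case: ifP.
  - by move=> p /negbTE ->.
  - by rewrite -cz; apply: eq_bigr => p _; case: ifP; rewrite ?scale0r ?scaler0.
suff : dotp Y z <= 0 by rewrite leNgt Yz.
apply: closure_dotp_le cl => x; rewrite -hQ cayley_hull; apply: dotp_conv_le.
by move=> _ [p pS ->]; have := YS p; rewrite pS.
Qed.

Lemma simplex_of_indep (m : nat) (X : finType) (w : X -> 'rV[R]_m) (D : {set X}) :
  indep w D -> (0 < #|D|)%N ->
  simplex (Defs.conv [set z | exists2 p, p \in D & z = w p]) (#|D|.-1).
Proof.
move=> iD D0.
pose e (i : 'I_(#|D|.-1.+1)) : X := enum_val (cast_ord (prednK D0) i).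
have eD i : e i \in D by exact: enum_valP.
have e_inj : injective e by move=> i j /enum_val_inj/cast_ord_inj.
have e_surj p : p \in D -> exists i, p = e i.
  move=> pD; exists (cast_ord (esym (prednK D0)) (enum_rank_in pD p)).
  by rewrite /e cast_ordKV enum_rankK_in.
exists (w (e ord0)), (\matrix_j (w (e (lift ord0 j)) - w (e ord0))); split.
  rewrite -kermx_eq0; apply/rowV0P => u /sub_kermxP; rewrite mulmx_sum_row => uM.
  apply/rowP => j; rewrite mxE.
  have [Y YP] := dual_exists (fun p => (p == e (lift ord0 j))%:R) iD.
  have : dotp Y (\sum_i u 0 i *: row i (\matrix_j (w (e (lift ord0 j)) - w (e ord0)))) = 0.
    by rewrite uM dotp0r.
  rewrite dotp_sumr (bigD1 j)//= big1 => [|i ij].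
    by rewrite addr0 rowK dotpZr dotpBr !YP// eqxx (inj_eq e_inj)/= subr0 mulr1.
  rewrite rowK dotpZr dotpBr !YP// !(inj_eq e_inj) (inj_eq lift_inj) (negbTE ij)/=.
  by rewrite subr0 mulr0.
congr Defs.conv; apply/seteqP; split=> z /=.
  move=> [p /e_surj[i ->] ->]; have [j ->|->] := unliftP ord0 i; last by left.
  by right; exists j; rewrite rowK addrC subrK.
move=> [->|[j ->]]; first by exists (e ord0).
by exists (e (lift ord0 j)) => //; rewrite rowK addrC subrK.
Qed.

Variables (P Q : 'I_n -> set 'rV[R]_n).
Hypotheses (polP : forall i, polytope (P i)) (polQ : forall i, polytope (Q i)).
Hypothesis PQ : forall i, P i `<=` Q i.

Definition outer_simplex := exists E : 'I_n -> set 'rV[R]_n,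
  [/\ forall i, polytope (E i), fully_mixed E, simplex (cayley E) (2 * n - 1)
    & cayley E `<=` rel_closure (cayley Q) (cayley Q `\` cayley P)].

(** [Y], made of [u] and the negated support values, is nonpositive on the Cayley polytope of [P],
    nonnegative on that of the segments and positive at one of its points [w]. A small move towards
    [w] thus leaves the polytope of [P]. *)
Lemma critical_outer_simplex : critical P Q -> outer_simplex.
Proof.
move=> [u [a [b [u0 tr aB bB]]]].
pose E i := Defs.conv [set x | x \in [:: a i; b i]].
pose Z := [seq a i | i <- enum 'I_n] ++ [seq b i | i <- enum 'I_n].
have aZ i : a i \in Z by rewrite mem_cat map_f// mem_enum.
have bZ i : b i \in Z by rewrite mem_cat map_f ?orbT// mem_enum.
have hE : hull (@cidx R n Z) (@cvec R n Z) (segs Z a b) = E.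
  by apply/funext => i; rewrite hull_pick// => x; rewrite !inE => /orP[/eqP ->|/eqP ->].
have bas := basis_segs tr aZ bZ.
have [i0 ui0] := transverse_dotp_neq0 tr u0.
have Ea i : E i (a i) by apply: sub_conv; rewrite /= inE eqxx.
have Eb i : E i (b i) by apply: sub_conv; rewrite /= !inE eqxx orbT.
have EQ i : E i `<=` Q i.
  have [sQ [_ QE]] := polQ i; rewrite QE; apply: conv_sub => x /=; rewrite -QE.
  by rewrite !inE => /orP[/eqP ->|/eqP ->]; [case: (aB i) | case: (bB i)].
pose Y : 'rV[R]_(n + n) := row_mx u (\row_i - supp_fun (P i) u).
have YE i x : dotp Y (row_mx x (ebasis R i)) = dotp u x - supp_fun (P i) u.
  by rewrite dotp_row_mx row_mxKl row_mxKr dotp_ebasis mxE.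
have YP z : cayley P z -> dotp Y z <= 0.
  apply: dotp_conv_le => _ [i [x Px ->]]; rewrite YE subr_le0.
  exact: dotp_le_supp_fun.
have Ege z : cayley E z -> 0 <= dotp Y z.
  move=> Ez; rewrite -hE cayley_hull in Ez.
  have : dotp (- Y) z <= 0; last by rewrite dotpC dotpNr dotpC oppr_le0.
  apply: dotp_conv_le Ez => _ [[i y] + ->]; rewrite inE/= !inE => yi.
  rewrite dotpC dotpNr dotpC oppr_le0 YE subr_ge0 /cvec/=.
  by move: yi => /orP[/eqP ->|/eqP ->]; [case: (aB i) | case: (bB i)].
have [w Ew Yw] : exists2 w, cayley E w & 0 < dotp Y w.
  have inE_ x : E i0 x -> cayley E (row_mx x (ebasis R i0)).
    by move=> Ex; apply: sub_conv; exists i0, x.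
  have [la|la] := ltP (supp_fun (P i0) u) (dotp u (a i0)).
    by exists (row_mx (a i0) (ebasis R i0)); [exact: inE_ | rewrite YE subr_gt0].
  exists (row_mx (b i0) (ebasis R i0)); [exact: inE_ | rewrite YE subr_gt0].
  have [_ ha] := aB i0; have [_ hb] := bB i0.
  rewrite lt_def hb andbT; apply: contra ui0 => /eqP e; rewrite dotpBr subr_eq0 e.
  by rewrite eq_le ha la.
exists E; split.
- by move=> i; exists [:: a i; b i].
- move=> i; exists (a i), (b i - a i); split=> //.
    have ab : b i - a i != 0 by rewrite subr_eq0 eq_sym (transverse_neq i tr).
    by rewrite /row_free rank_rV ab.
  by move=> j; rewrite (ord1 j) row_id addrC subrK.
- have -> : (2 * n - 1 = (n + n).-1)%N by rewrite mul2n addnn subn1.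
  have := @simplex_of_indep _ _ _ _ bas.1; rewrite (card_basis bas) -cayley_hull hE.
  apply; apply: leq_trans (leq_addr _ _).
  exact: leq_ltn_trans (leq0n i0) (ltn_ord i0).
- move=> z Ez; have Qz := cayley_mono EQ Ez.
  split; last first.
    exists 1%N, (fun=> 1), (fun=> z); rewrite !big_ord_recl !big_ord0 !addr0 scale1r.
    by split.
  apply/closure_rowP => e e0.
  (* [B] bounds all entries of [w - z]; the denominator [B + B] keeps the displacement strictly
     below [e]. *)
  pose B := \sum_j `|(w - z) 0 j| + 1.
  have B0 : 0 < B by rewrite ltr_wpDl// sumr_ge0.
  pose t := Num.min 1 (e / (B + B)).
  have t0 : 0 < t by rewrite lt_min ltr01 divr_gt0// addr_gt0.
  have t1 : t <= 1 by rewrite ge_min lexx.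
  exists (z + t *: (w - z)).
    split; first by apply: conv_segment; rewrite ?t1 ?(ltW t0)//; exact: cayley_mono EQ _ Ew.
    move=> /YP; rewrite dotpDr dotpZr dotpBr leNgt => /negP; apply.
    have -> : dotp Y z + t * (dotp Y w - dotp Y z) = (1 - t) * dotp Y z + t * dotp Y w.
      by ring.
    by rewrite ltr_wpDl ?mulr_gt0// mulr_ge0 ?subr_ge0// Ege.
  move=> j; rewrite [X in `|X - _|]mxE addrAC subrr add0r mxE normrM gtr0_norm//.
  apply: (@le_lt_trans _ _ (e / (B + B) * B)).
    rewrite ler_pM ?(ltW t0)//; first by rewrite ge_min lexx orbT.
    by rewrite /B (bigD1 j)//= -addrA lerDl addr_ge0// sumr_ge0.
  have BB : 0 < B + B by rewrite addr_gt0.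
  by rewrite mulrAC -mulrA gtr_pMr// ltr_pdivrMr// mul1r ltrDl.
Qed.

End SimplexCriterion.

(** * From an outer simplex to a critical direction *)

Section OuterSimplex.
Variables (R : realType) (n : nat).
Implicit Types (P Q E : 'I_n -> set 'rV[R]_n).

(* The vertices of the simplex are extreme, so each lies over a vertex e_i; as E_i
   is not a point, at least two of them lie over each e_i. *)
Lemma simplex_transverse E d : fully_mixed E -> simplex (cayley E) d ->
  exists a b : 'I_n -> 'rV[R]_n,
    [/\ transverse a b, forall i, E i (a i) & forall i, E i (b i)].
Proof.
move=> fm [x0 [M [fM CE]]].
pose w (k : 'I_d.+1) := if unlift ord0 k is Some j then x0 + row j M else x0.
have w0 : w ord0 = x0 by rewrite /w unlift_none.
have wl j : w (lift ord0 j) = x0 + row j M by rewrite /w liftK.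
have {}CE : cayley E = Defs.conv [set z | exists2 k, k \in finset.setT & z = w k].
  rewrite CE; congr Defs.conv; apply/seteqP; split=> z /=.
    move=> [->|[j ->]]; first by exists ord0; rewrite ?inE.
    by exists (lift ord0 j); rewrite ?inE.
  by move=> [k _ ->]; have [j ->|->] := unliftP ord0 k; [right; exists j | left].
have Ew k : cayley E (w k) by rewrite CE; apply: sub_conv; exists k; rewrite ?inE.
have tw k : dotp (total R n) (w k) = 1 by apply: cayley_total (Ew k).
(* All vertices lie on the hyperplane [total = 1], which turns affine into linear independence. *)
have iw : indep w finset.setT.
  move=> c _ c0.
  have s0 : \sum_k c k = 0.
    transitivity (dotp (total R n) (comb w c)); last by rewrite c0 dotp0r.
    by rewrite dotp_comb; apply: eq_bigr => k _; rewrite tw mulr1.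
  have : \row_j c (lift ord0 j) *m M = 0.
    rewrite -[RHS]c0 mulmx_sum_row /comb big_ord_recl w0.
    under [in RHS]eq_bigr do rewrite wl scalerDr.
    rewrite big_split/= addrA -scaler_suml -scalerDl.
    rewrite big_ord_recl in s0; rewrite s0 scale0r add0r.
    by apply: eq_bigr => j _; rewrite mxE.
  move/eqP; rewrite mulmx_free_eq0// => /eqP/rowP cl.
  have cl0 j : c (lift ord0 j) = 0 by have := cl j; rewrite !mxE.
  move=> k; have [j ->|->] := unliftP ord0 k; first exact: cl0.
  by move: s0; rewrite big_ord_recl big1 ?addr0// => j _; exact: cl0.
(* On the simplex the functional [Y] attains its maximum 1 only at [w k], so a generator with
   nonzero weight in [w k] equals it. *)
have vert k : exists ix : 'I_n * 'rV[R]_n, E ix.1 ix.2 /\ w k = row_mx ix.2 (ebasis R ix.1).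
  have [Y YP] := dual_exists (fun q => (q == k)%:R) iw.
  have {}YP q : dotp Y (w q) = (q == k)%:R by apply: YP; rewrite inE.
  have [N [l [g [l0 l1 gE wkE]]]] := Ew k.
  have gC j : cayley E (g j) by apply: sub_conv.
  have Yg j : dotp Y (g j) <= 1.
    have := gC j; rewrite CE; apply: dotp_conv_le => _ [q _ ->]; rewrite YP.
    by case: (q == k).
  have [j lj] : exists j, l j != 0.
    apply/not_existsP => no; move: l1; rewrite big1 => [/eqP|j _].
      by rewrite eq_sym oner_eq0.
    by apply/eqP; have /negP := no j; rewrite negbK.
  have Ygj : dotp Y (g j) = 1.
    have : \sum_j l j * (1 - dotp Y (g j)) = 0.
      under eq_bigr do rewrite mulrBr mulr1 -dotpZr.
      by rewrite sumrB l1 -dotp_sumr -wkE YP eqxx subrr.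
    move/eqP; rewrite psumr_eq0 => [|i _]; last by rewrite mulr_ge0 ?subr_ge0.
    move=> /allP/(_ j (mem_index_enum _)); rewrite mulf_eq0 (negbTE lj)/= subr_eq0.
    by move=> /eqP.
  have : cayley E (g j) by [].
  rewrite CE => /convP[c [c0 _ c1 gjE]].
  have ck : c k = 1.
    move: Ygj; rewrite gjE dotp_sumr (bigD1 k)//= dotpZr YP eqxx mulr1 big1 ?addr0//.
    by move=> q /negbTE qk; rewrite dotpZr YP qk mulr0.
  have cq q : q != k -> c q = 0.
    move=> qk; move: c1; rewrite (bigD1 k)//= ck -[RHS]addr0 => /addrI/eqP.
    rewrite psumr_eq0// => /allP/(_ q (mem_index_enum _)); rewrite qk => /eqP//.
  have <- : g j = w k.
    by rewrite gjE (bigD1 k)//= ck scale1r big1 ?addr0// => q /cq ->; rewrite scale0r.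
  by have [i [x Ex ->]] := gE j; exists (i, x).
have /choice[f fP] := vert.
pose idx k := (f k).1; pose v k := (f k).2.
have ptE : point idx v = w by apply/funext => k; have [_ ->] := fP k.
have ms : mixed idx finset.setT.
  rewrite /mixed -finset.subTset; apply/fintype.subsetP => i _.
  apply/negPn/negP => im.
  (* If at most one vertex lies over [i], every point of [E i] is that vertex, against
     [fully_mixed]. *)
  have fib y : E i y -> exists2 k, idx k = i & y = v k.
    move=> Ey; have : cayley E (row_mx y (ebasis R i)).
      by apply: sub_conv; exists i, y.
    rewrite CE => /convP[c [c0 _ c1]]; rewrite -ptE -/(comb (point idx v) c) => yE.
    have ce j : \sum_(k | idx k == j) c k = (i == j)%:R.
      by move: yE; rewrite comb_point => /eq_row_mx[_ /rowP/(_ j)]; rewrite !mxE.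
    have c_out k : idx k != i -> c k = 0.
      move=> ki; have := ce (idx k); rewrite eq_sym (negbTE ki) => /eqP.
      by rewrite psumr_eq0// => /allP/(_ k (mem_index_enum _)); rewrite eqxx => /eqP.
    have [k ki] : exists k, idx k = i.
      apply/not_existsP => no; have := ce i; rewrite eqxx big1 => [/eqP|k /eqP/no//].
      by rewrite eq_sym oner_eq0.
    have al : alone idx finset.setT k by apply: alone_multi; [rewrite inE | rewrite ki].
    have ck : c k = 1.
      rewrite (@alone_coef _ _ _ idx v finset.setT k c y (ebasis R i))// ?inE//.
      - by rewrite mxE ki eqxx.
      - by move=> q; rewrite inE.
    exists k => //; move: yE; rewrite comb_point => /eq_row_mx[-> _].
    rewrite (bigD1 k)//= ck scale1r big1 ?addr0// => q qk.
    rewrite c_out ?scale0r//; apply: contra qk => /eqP qi; apply/eqP.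
    by apply: al; rewrite ?inE ?qi ?ki.
  have [y0 [N [y0E fN /(_ ord0) y1E]]] := fm i.
  have [k ki yk] := fib _ y0E; have [q qi yq] := fib _ y1E.
  have qk : q = k.
    have al : alone idx finset.setT k by apply: alone_multi; [rewrite inE | rewrite ki].
    by apply: al; rewrite ?inE ?qi ?ki.
  move: fN; rewrite /row_free rank_rV => /eqP N0.
  have : N != 0 by move: N0; case: (N != 0).
  rewrite -(row_id ord0 N) => /eqP; apply.
  by apply: (@addrI _ y0); rewrite addr0 yq qk yk.
have iw' : indep (point idx v) finset.setT by rewrite ptE.
have [p [q [_ _ pi qi tr]]] := mixed_transverse iw' ms.
exists (v \o p), (v \o q); split=> // i.
  by have [h _] := fP (p i); rewrite -/(idx (p i)) pi in h.
by have [h _] := fP (q i); rewrite -/(idx (q i)) qi in h.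
Qed.

Section Fixed.
Variables (P Q : 'I_n -> set 'rV[R]_n).
Hypotheses (polP : forall i, polytope (P i)) (polQ : forall i, polytope (Q i)).
Hypothesis PQ : forall i, P i `<=` Q i.
Variables a b : 'I_n -> 'rV[R]_n.
Hypotheses (tr : transverse a b) (aQ : forall i, Q i (a i)) (bQ : forall i, Q i (b i)).

(* Separate the cone over P from the open cone spanned by the segments: a common
   point could be moved into the interior of both, hence away from the closure. *)
Lemma segments_critical (Z2 := [seq a i | i <- enum 'I_n] ++ [seq b i | i <- enum 'I_n]) :
  (0 < n)%N ->
  (forall Y : 'rV[R]_(n + n),
    (forall i x, P i x -> dotp Y (row_mx x (ebasis R i)) = 0) -> Y = 0) ->
  cayley (hull (@cidx R n Z2) (@cvec R n Z2) (segs Z2 a b)) `<=`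
    closure (cayley Q `\` cayley P) ->
  critical P Q.
Proof.
move=> n0 noY clE.
have aZ i : a i \in Z2 by rewrite mem_cat map_f// mem_enum.
have bZ i : b i \in Z2 by rewrite mem_cat map_f ?orbT// mem_enum.
have bas := basis_segs tr aZ bZ.
have [sP sP0 PE] := polytopes_lists polP.
pose Z := flatten [seq sP i | i <- enum 'I_n].
have inZ j y : y \in sP j -> y \in Z.
  by move=> yj; apply/flattenP; exists (sP j) => //; apply: map_f; rewrite mem_enum.
pose S0 := pick_pts Z sP; pose S2 := segs Z2 a b.
pose pt0 := point (@cidx R n Z) (@cvec R n Z).
pose pt2 := point (@cidx R n Z2) (@cvec R n Z2).
have hP : hull (@cidx R n Z) (@cvec R n Z) S0 = P.
  by apply/funext => j; rewrite hull_pick ?PE// => y; exact: inZ.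
have f0 : full (@cidx R n Z) S0 by apply: full_pick.
(* A functional vanishing on [S0] annihilates all Cayley points over [P], which [noY] forbids unless
   it is zero. *)
have spn w : inspan pt0 S0 w.
  apply: contrapT => /annihilator_exists[Y [YS Yw]].
  move: Yw; rewrite (noY Y) ?(dotpC 0) ?dotp0r ?eqxx// => i x.
  rewrite -hP => Px.
  have : cayley (hull (@cidx R n Z) (@cvec R n Z) S0) (row_mx x (ebasis R i)).
    by apply: sub_conv; exists i, x.
  by move=> /cayleyP[_ [c [_ cS <-]]]; rewrite dotp_comb big1// => p _;
    have [/YS ->|/cS ->] := boolP (p \in S0); rewrite ?mulr0 ?mul0r.
(* Negated endpoints encode the difference of the two cones, and [w0] lies in the open cone over the
   segments. *)
pose A (p : config Z + config Z2) : 'rV[R]_(n + n) := match p with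
  | inl p => if p \in S0 then pt0 p else 0
  | inr q => if q \in S2 then - pt2 q else 0 end.
pose w0 := \sum_(q in S2) pt2 q.
have [[c c0 cw]|[Y [YA Yw]]] := farkas A w0; last first.
  have Y0 p : p \in S0 -> dotp Y (pt0 p) <= 0 by move=> pS; have := YA (inl p); rewrite /A pS.
  have Y2 q : q \in S2 -> 0 <= dotp Y (pt2 q).
    by move=> qS; have := YA (inr q); rewrite /A qS dotpNr oppr_le0.
  pose u := lsubmx Y; pose z := rsubmx Y.
  have Ple i x : P i x -> dotp u x <= - z 0 i.
    rewrite PE; apply: dotp_conv_le => y yP.
    have pS : (i, SeqSub (inZ i y yP)) \in S0 by rewrite inE.
    by have := Y0 _ pS; rewrite dotp_point /cvec/= -/u -/z => ?; lra.
  have Pne i : exists x, P i x.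
    have [p pS pi] := f0 i; exists (cvec p); rewrite -hP -pi; exact: hull_point.
  have Bs i x (xZ : x \in Z2) : (i, SeqSub xZ) \in S2 -> supp_fun (P i) u <= dotp u x.
    move=> /Y2; rewrite dotp_point /cvec/= -/u -/z => h.
    apply: supp_fun_le => // y /Ple; lra.
  have aS i : (i, SeqSub (aZ i)) \in S2 by rewrite inE/= !inE eqxx.
  have bS i : (i, SeqSub (bZ i)) \in S2 by rewrite inE/= !inE eqxx orbT.
  exists u, a, b; split=> //.
  (* With [u = 0], [Y] depends on the index alone and is both nonpositive and nonnegative on the
     endpoints, against [Yw]. *)
  - apply/eqP => u0; move: Yw; rewrite /w0 dotp_sumr big1 ?ltxx// => q qS.
    apply/eqP; rewrite eq_le Y2// andbT dotp_point -/u u0 (dotpC 0) dotp0r add0r.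
    have [x Px] := Pne (cidx q); have := Ple _ _ Px.
    by rewrite u0 dotpC dotp0r oppr_ge0.
  - by move=> i; split=> //; exact: Bs (aS i).
  - by move=> i; split=> //; exact: Bs (bS i).
(* Here the cones meet: [zeta] lies in the cone over [P] and has coefficients at least 1 on the
   endpoints. *)
exfalso.
pose cP p := if p \in S0 then c (inl p) else 0.
pose dE q := if q \in S2 then 1 + c (inr q) else 0.
have cPd : comb pt0 cP = comb pt2 dE.
  move: cw; rewrite {1}/comb big_sumType/= => /eqP.
  have -> : \sum_i c (inl i) *: (if i \in S0 then pt0 i else 0) = comb pt0 cP.
    by apply: eq_bigr => p _; rewrite /cP; case: ifP; rewrite ?scale0r ?scaler0.
  have -> : \sum_i c (inr i) *: (if i \in S2 then - pt2 i else 0) = w0 - comb pt2 dE.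
    rewrite /w0 /comb [X in X - _]big_mkcond/= -sumrB; apply: eq_bigr => q _; rewrite /dE.
    case: ifP => _; last by rewrite scaler0 scale0r subr0.
    by rewrite scalerDl scale1r opprD addNKr scalerN.
  by rewrite addrCA -subr_eq0 [w0 + _]addrC addrK subr_eq0 => /eqP.
set zeta := comb pt2 dE in cPd.
pose W := comb pt0 (fun p => (p \in S0)%:R).
have [phi [_ phiC phiK]] := basis_coord bas.
(* For this [s], adding [s *: W] keeps the coefficients on the endpoints nonnegative, while every
   coefficient on [S0] becomes at least [s]. *)
have [s s0 sP'] := @finite_lower_bound R (config Z2) (fun=> True)
  (fun q => 1 / (`|dotp (phi q) W| + 1))
  (fun q _ => divr_gt0 ltr01 (ltr_wpDl (normr_ge0 _) ltr01)).
have sphi q : `|s * dotp (phi q) W| <= 1.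
  rewrite normrM gtr0_norm//; have := sP' q Logic.I.
  rewrite ler_pdivlMr ?ltr_wpDl// => h; apply: le_trans h.
  by rewrite ler_wpM2l ?(ltW s0)// lerDl.
pose T := dotp (total R n) zeta; pose N := dotp (total R n) W.
have totE (Z' : seq 'rV[R]_n) (g : config Z' -> R) :
    dotp (total R n) (comb (point (@cidx R n Z') (@cvec R n Z')) g) = \sum_p g p.
  by rewrite dotp_comb; apply: eq_bigr => p _; rewrite total_point mulr1.
have T0 : 0 < T.
  pose i0 := Ordinal n0; pose q0 : config Z2 := (i0, SeqSub (aZ i0)).
  have q0S : q0 \in S2 by rewrite inE/= !inE eqxx.
  rewrite /T totE (bigD1 q0)//= {1}/dE q0S ltr_pwDl ?ltr_pwDl// sumr_ge0// => q _.
  by rewrite /dE; case: ifP => // _; rewrite addr_ge0.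
have N0 : 0 <= N by rewrite /N totE sumr_ge0.
have TN : 0 < T + s * N by rewrite ltr_pwDl// mulr_ge0// ltW.
pose zs := (T + s * N)^-1 *: (zeta + s *: W).
have zsE : (T + s * N) *: zs = zeta + s *: W.
  by rewrite /zs scalerA divff ?scale1r// gt_eqF.
have zs_in : cayley (hull (@cidx R n Z2) (@cvec R n Z2) S2) zs.
  apply/cayleyP; split.
    by rewrite dotpZr dotpDr dotpZr -/T -/N mulVf// gt_eqF.
  exists (fun q => (T + s * N)^-1 *
    (dE q + s * (if q \in S2 then dotp (phi q) W else 0))); split.
  - move=> q; rewrite mulr_ge0 ?invr_ge0 ?(ltW TN)//= /dE; case: ifP => _.
      have := sphi q; rewrite ler_norml => /andP[h _]; have := c0 (inr q); lra.
    by rewrite mulr0 addr0.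
  - by move=> q /negbTE qS; rewrite /dE qS mulr0 addr0 mulr0.
  - by rewrite combZ combD combZ phiK.
have /choice[be beP] : forall j : 'I_(n + n), exists be, supported S0 be /\
    comb pt0 be = delta_mx 0 j.
  by move=> j; have [be ? ?] := spn (delta_mx 0 j); exists be.
(* [B] dominates the expansions of the unit vectors in the points of [S0]. After rescaling, a point
   [y] this close to [zs] changes the coefficients on [S0] by at most [s], so it stays in the Cayley
   polytope of [P]. *)
pose B := \sum_j \sum_p `|be j p| + 1.
have B0 : 0 < B by rewrite ltr_wpDl// sumr_ge0// => j _; rewrite sumr_ge0.
have /closure_rowP/(_ (s / ((T + s * N) * B))) cl := clE zs zs_in.
have [|y [Qy nPy] yz] := cl; first by rewrite divr_gt0// mulr_gt0.
apply: nPy.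
pose dl := (T + s * N) *: (y - zs).
have dlE : dl = comb pt0 (fun p => \sum_j dl 0 j * be j p).
  rewrite comb_sum [LHS]row_sum_delta; apply: eq_bigr => j _.
  by rewrite combZ; have [_ ->] := beP j.
have dlB j : `|dl 0 j| <= s / B.
  have -> : dl 0 j = (T + s * N) * (y 0 j - zs 0 j) by rewrite 3!mxE.
  rewrite normrM gtr0_norm// -ler_pdivlMl//; apply: le_trans (ltW (yz j)) _.
  by rewrite invfM mulrCA.
have bound p : `|\sum_j dl 0 j * be j p| <= s.
  apply: le_trans (ler_norm_sum _ _ _) _.
  apply: (@le_trans _ _ (\sum_j (s / B) * `|be j p|)).
    by apply: ler_sum => j _; rewrite normrM ler_wpM2r.
  rewrite -mulr_sumr mulrAC ler_pdivrMr// ler_wpM2l ?(ltW s0)//.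
  apply: (@le_trans _ _ (\sum_j \sum_p `|be j p|)); last by rewrite lerDl.
  by apply: ler_sum => j _; rewrite (bigD1 p)//= lerDl sumr_ge0.
rewrite -hP; apply/cayleyP; split; first exact: cayley_total Qy.
exists (fun p => (T + s * N)^-1 *
  (cP p + s * (p \in S0)%:R + \sum_j dl 0 j * be j p)); split.
- move=> p; rewrite mulr_ge0 ?invr_ge0 ?(ltW TN)//.
  case: (boolP (p \in S0)) => pS.
    have := bound p; rewrite ler_norml => /andP[h _]; rewrite /cP pS mulr1.
    by have := c0 (inl p); lra.
  rewrite /cP (negbTE pS) mulr0 addr0 add0r big1// => j _.
  by have [-> //] := beP j; rewrite mulr0.
- move=> p pS; rewrite /cP (negbTE pS) mulr0 addr0 add0r big1 ?mulr0// => j _.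
  by have [-> //] := beP j; rewrite mulr0.
- rewrite combZ combD combD combZ -dlE cPd -zsE /dl -scalerDr addrCA subrr addr0.
  by rewrite scalerA mulVf ?scale1r// gt_eqF.
Qed.

End Fixed.

Lemma outer_simplex_critical P Q : (forall i, polytope (P i)) ->
  (forall i, polytope (Q i)) -> (forall i, P i `<=` Q i) ->
  outer_simplex P Q -> critical P Q.
Proof.
move=> polP polQ PQ [E [polE fm sE ER]].
have Ecl z : cayley E z -> closure (cayley Q `\` cayley P) z by move=> /ER[].
(* The inclusion in [Q i] is recovered from the closure because the Cayley polytope of [Q] is
   closed. *)
have EQ i x : E i x -> Q i x.
  move=> Ex; have Cx : cayley E (row_mx x (ebasis R i)) by apply: sub_conv; exists i, x.
  apply: cayley_fiber => //; apply: cayley_closed => //; first exact: cayley_total Cx.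
  by move=> B /(Ecl _ Cx)[y [[Qy _] By]]; exists y.
(* For [n = 0] the value of [total] is an empty sum, yet it must be 1 at the vertex [x0]. *)
have n0 : (0 < n)%N.
  have [x0 [M [_ sE']]] := sE.
  have /cayley_total : cayley E x0 by rewrite sE'; apply: sub_conv; left.
  case: (n) x0 {M sE'} => // x0; rewrite /dotp big_ord0 => /eqP.
  by rewrite eq_sym oner_eq0.
have [a [b [tr aE bE]]] := simplex_transverse fm sE.
have aQ i : Q i (a i) by exact: EQ.
have bQ i : Q i (b i) by exact: EQ.
(* If some [Y] annihilates the Cayley points over [P], their cone has no interior to move into; the
   critical direction then comes from the strict inequality of mixed volumes. *)
have [[Y [Y0 YP]]|noY] := pselect (exists Y : 'rV[R]_(n + n), Y != 0 /\
    forall i x, P i x -> dotp Y (row_mx x (ebasis R i)) = 0).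
  exact/mv_lt_critical/(mv_lt_annihilated polP polQ PQ tr aQ bQ Y0 YP).
apply: (segments_critical polP tr aQ bQ n0).
  move=> Y YP; apply/eqP/negPn/negP => Y0; apply: noY; by exists Y.
move=> z zE; apply: Ecl; apply: cayley_mono z zE => i x.
have [sE_ [_ EE]] := polE i.
rewrite hull_pick; last first.
  move=> y; rewrite !inE mem_cat => /orP[/eqP ->|/eqP ->];
  by rewrite map_f ?orbT// mem_enum.
rewrite EE; apply: conv_sub => y /=; rewrite -EE !inE => /orP[/eqP ->|/eqP ->].
  exact: aE.
exact: bE.
Qed.

End OuterSimplex.

Lemma critical_essential (R : realType) (n : nat) (P Q : 'I_n -> set 'rV[R]_n) :
  critical P Q <->
  exists u : 'rV[R]_n, u != 0 /\ essential (fun i => Bset (P i) (Q i) u).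
Proof.
split=> [[u [a [b [u0 tr aB bB]]]]|[u [u0 /essential_transverse[a [b [tr aB bB]]]]]].
  by exists u; split=> //; exact: transverse_essential tr aB bB.
by exists u, a, b.
Qed.

Theorem theorem4p4 (R : realType) (n : nat)
  (P Q : 'I_n -> set 'rV[R]_n) :
  (forall i, polytope (P i)) -> (forall i, polytope (Q i)) ->
  (forall i, P i `<=` Q i) ->
  [/\ (mixed_volume P < mixed_volume Q <->
       exists E : 'I_n -> set 'rV[R]_n,
         [/\ forall i, polytope (E i), fully_mixed E,
             simplex (cayley E) (2 * n - 1)
           & cayley E `<=` rel_closure (cayley Q) (cayley Q `\` cayley P)]),
      (mixed_volume P < mixed_volume Q <->
       exists u : 'rV[R]_n, u != 0 /\ essential (fun i => Bset (P i) (Q i) u))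
    & ((exists E : 'I_n -> set 'rV[R]_n,
         [/\ forall i, polytope (E i), fully_mixed E,
             simplex (cayley E) (2 * n - 1)
           & cayley E `<=` rel_closure (cayley Q) (cayley Q `\` cayley P)]) <->
       exists u : 'rV[R]_n, u != 0 /\ essential (fun i => Bset (P i) (Q i) u))].
Proof.
move=> polP polQ PQ.
have mv : mixed_volume P < mixed_volume Q <-> critical P Q.
  split; first exact: mv_lt_critical.
  move=> [u [a [b [u0 tr aB bB]]]].
  by apply: (critical_mv_lt polP polQ PQ tr _ _ u0) => i;
    [case: (aB i) | case: (bB i) | case: (aB i) | case: (bB i)].
have os : outer_simplex P Q <-> critical P Q.
  by split; [exact: outer_simplex_critical | exact: critical_outer_simplex].
have ce := critical_essential P Q.
by rewrite /outer_simplex in os; split; [rewrite mv os | rewrite mv ce | rewrite os ce].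
Qed.
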